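(* Let $p,q \in (1,\infty)\setminus\{2\}$ with $p \neq q$. Then $\mathcal L(\ell^p \oplus \ell^q)$ is not Connes-amenable.
   Context: For a Banach space $E$, $\mathcal L(E)$ is the Banach algebra of bounded linear operators on $E$. A Banach algebra $\mathfrak B$ is called dual if there is a closed submodule $\mathfrak B_\ast$ of the Banach $\mathfrak B$-bimodule $\mathfrak B^\ast$ such that $\mathfrak B = (\mathfrak B_\ast)^\ast$; the $w^\ast$-topology on $\mathfrak B$ is $\sigma(\mathfrak B,\mathfrak B_\ast)$. For reflexive $E$, $\mathcal L(E)$ is a dual Banach algebra with predual $E\hat\otimes E^\ast$ (projective tensor product), the duality being $\langle x\otimes\phi, T\rangle = \langle Tx,\phi\rangle$. A derivation from a Banach algebra $\mathfrak B$ into a Banach $\mathfrak B$-bimodule $F$ is a bounded linear map $D$ with $D(ab) = a\cdot Db + (Da)\cdot b$; it is inner if it is of the form $a \mapsto a\cdot x - x\cdot a$ for some $x \in F$. The dual $F^\ast$ of a Banach $\mathfrak B$-bimodule is a Banach $\mathfrak B$-bimodule via $\langle x, a\cdot\phi\rangle = \langle x\cdot a,\phi\rangle$, $\langle x,\phi\cdot a\rangle = \langle a\cdot x,\phi\rangle$. If $\mathfrak B$ is dual, $F^\ast$ is a $w^\ast$-Banach $\mathfrak B$-bimodule if for each $\phi\in F^\ast$ the maps $\mathfrak B \to F^\ast$, $b\mapsto b\cdot\phi$ and $b\mapsto\phi\cdot b$, are $w^\ast$-continuous ($\sigma(\mathfrak B,\mathfrak B_\ast)$-$\sigma(F^\ast,F)$).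 $\mathfrak B$ is Connes-amenable if, for every $w^\ast$-Banach $\mathfrak B$-bimodule $F^\ast$, every $w^\ast$-continuous derivation $\mathfrak B\to F^\ast$ is inner. *)

(* Defs.v *)
From HB Require Import structures.
From mathcomp Require Import all_boot all_order all_algebra.
From mathcomp Require Import complex.
From mathcomp Require Import all_classical all_reals all_analysis.

Set Implicit Arguments.
Unset Strict Implicit.
Unset Printing Implicit Defensive.

Import Order.TTheory GRing.Theory Num.Theory.
Import numFieldNormedType.Exports.

Local Open Scope classical_set_scope.
Local Open Scope ring_scope.
Local Open Scope complex_scope.

HB.instance Definition _ (R : realType) := NormedModule.copy R[i] R[i]^o.

(* The library's norm on a normed space over R[i] takes its values in R[i];
   rnorm is the same norm, read in R. *)
Definition rnorm (R : realType) (V : normedModType R[i]) (x : V) : R :=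
  complex.Re `|x|.

Section rnorm_theory.
Context (R : realType) (V : normedModType R[i]).
Implicit Types x y : V.

Lemma rnormE x : `|x| = (rnorm x)%:C.
Proof.
have := normr_ge0 x; rewrite lecE /= /rnorm => /andP[/eqP + _].
by case: `|x| => a b /= ->.
Qed.

Lemma rnorm_ge0 x : 0 <= rnorm x.
Proof. by have := normr_ge0 x; rewrite rnormE ler0c. Qed.

Lemma rnormD x y : rnorm (x + y) <= rnorm x + rnorm y.
Proof. by have := ler_normD x y; rewrite !rnormE -rmorphD /= lecR. Qed.

Lemma rnormN x : rnorm (- x) = rnorm x.
Proof. by rewrite /rnorm normrN. Qed.

Lemma rnormB x y : rnorm (x - y) = rnorm (y - x).
Proof. by rewrite /rnorm distrC. Qed.

Lemma rnormZ (a : R[i]) x : rnorm (a *: x) = rnorm (a : R[i]) * rnorm x.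
Proof.
by apply: complexI; rewrite rmorphM /= -rnormE normrZ -rnormE rnormE.
Qed.

Lemma rnorm_real (r : R) : rnorm (r%:C : R[i]) = `|r|.
Proof.
by rewrite /rnorm normc_def /= expr0n /= addr0 sqrtr_sqr.
Qed.

Lemma rnormZr (r : R) x : rnorm (r%:C *: x) = `|r| * rnorm x.
Proof. by rewrite rnormZ rnorm_real. Qed.

Lemma rnorm0 : rnorm (0 : V) = 0.
Proof. by rewrite /rnorm normr0. Qed.

Lemma rnorm0_eq0 x : rnorm x = 0 -> x = 0.
Proof. by move=> x0; apply/normr0_eq0; rewrite rnormE x0. Qed.

Lemma rnorm_dist x y : `|rnorm x - rnorm y| <= rnorm (x - y).
Proof.
rewrite ler_norml; apply/andP; split.
  rewrite lerBrDl lerBlDr -[y in leLHS](subrK x) addrC rnormB.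
  by rewrite (le_trans (rnormD _ _)) // addrC.
by rewrite lerBlDr -[x in leLHS](subrK y) rnormD.
Qed.

Lemma cvg_rnorm (F : set_system V) (y : V) : Filter F ->
  (forall r, 0 < r -> F [set x | rnorm (y - x) <= r]) <-> F --> y.
Proof.
move=> FF; split=> [H|H r r0].
  apply/cvgrPdist_le => /= e e0.
  have eE : e = (complex.Re e)%:C.
    by move: e0; case: e => a b; rewrite ltcE /= => /andP[/eqP ->].
  have r0 : 0 < complex.Re e by move: e0; rewrite ltcE => /andP[].
  by apply: filterS (H _ r0) => x /=; rewrite rnormE eE lecR.
have /= := (@cvgrPdist_le _ _ _ F FF id y).1 H r%:C.
rewrite ltcR => /(_ r0); apply: filterS => x.
by rewrite rnormE lecR.
Qed.

Lemma cauchy_rnorm (F : set_system V) : Filter F -> cauchy F ->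
  forall r, 0 < r ->
  exists2 A, F A & forall x y, A x -> A y -> rnorm (x - y) <= r.
Proof.
move=> FF Fc r r0.
have e0 : (0 : R[i]) < r%:C by rewrite ltcR.
have [[A B] /= [FA FB] AB] := Fc _ (entourage_ball V (PosNum e0)).
exists (A `&` B); first exact: filterI.
move=> x y [Ax _] [_ By]; have /= := AB (x, y) (conj Ax By).
by rewrite -ball_normE /= rnormE ltcR => /ltW.
Qed.

End rnorm_theory.

Section complex_complete.
Context (R : realType).

Let Re_le (z : R[i]) : `|complex.Re z| <= rnorm z.
Proof.
case: z => a b; rewrite /rnorm normc_def /= -sqrtr_sqr ler_wsqrtr //.
by rewrite lerDl sqr_ge0.
Qed.

Let Im_le (z : R[i]) : `|complex.Im z| <= rnorm z.
Proof.
case: z => a b; rewrite /rnorm normc_def /= -sqrtr_sqr ler_wsqrtr //.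
by rewrite lerDr sqr_ge0.
Qed.

Let rnorm_le (z : R[i]) : rnorm z <= `|complex.Re z| + `|complex.Im z|.
Proof.
case: z => a b /=.
have -> : (a +i* b : R[i]) = a%:C + (0 +i* b).
  by apply/eqP; rewrite eq_complex /= addr0 add0r !eqxx.
rewrite (le_trans (rnormD _ _)) // rnorm_real lerD2l.
by rewrite /rnorm normc_def /= expr0n /= add0r sqrtr_sqr.
Qed.

Let part_cvg (h : R[i] -> R) (F : set_system R[i]) : ProperFilter F ->
  (forall x y, `|h x - h y| <= rnorm (x - y)) -> cauchy F ->
  exists a, forall r, 0 < r -> F [set z | `|a - h z| <= r].
Proof.
move=> FF h1 Fc.
have hc : cauchy (h @ F).
  apply/cauchyP => e e0; have e2 : 0 < e / 2 by rewrite divr_gt0.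
  have [A FA Ar] := cauchy_rnorm FF Fc e2.
  have [x Ax] := @filter_ex _ _ FF _ FA.
  exists (h x); rewrite /fmap /=; apply: filterS FA => y Ay /=.
  rewrite /ball /= (le_lt_trans (h1 _ _)) // (le_lt_trans (Ar _ _ Ax Ay)) //.
  by rewrite ltr_pdivrMr // ltr_pMr // ltr1n.
have /cvg_ex[a /= ha] : cvg (h @ F) by exact: R_complete hc.
by exists a => r r0; move/cvgrPdist_le: ha => /(_ r r0).
Qed.

Lemma complex_complete (F : set_system R[i]) :
  ProperFilter F -> cauchy F -> cvg F.
Proof.
move=> FF Fc.
have [|a ha] := @part_cvg (@complex.Re R) F FF _ Fc.
  by move=> x y; rewrite (le_trans _ (Re_le _)) //; case: x y => ? ? [].
have [|b hb] := @part_cvg (@complex.Im R) F FF _ Fc.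
  by move=> x y; rewrite (le_trans _ (Im_le _)) //; case: x y => ? ? [].
apply/cvg_ex; exists (a +i* b); apply/cvg_rnorm => r r0.
have r2 : 0 < r / 2 by rewrite divr_gt0.
apply: filterS2 (ha _ r2) (hb _ r2) => z /= za zb.
rewrite (le_trans (rnorm_le _)) // [leRHS](splitr r).
by case: z za zb => c d za zb; rewrite lerD.
Qed.

HB.instance Definition _ := Uniform_isComplete.Build R[i] complex_complete.

End complex_complete.

HB.instance Definition _ (E F : puniformType) := Uniform.on (E * F)%type.

Section prod_complete.
Context (R : realType) (E F : completeNormedModType R[i]).

Let rnorm1_le (z : E * F) : rnorm z.1 <= rnorm z.
Proof. by rewrite -lecR -!rnormE prod_normE /= comparable_le_max ?lexx //
  real_comparable ?normr_real. Qed.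

Let rnorm2_le (z : E * F) : rnorm z.2 <= rnorm z.
Proof. by rewrite -lecR -!rnormE prod_normE /= comparable_le_max ?lexx ?orbT //
  real_comparable ?normr_real. Qed.

Lemma rnorm_prod (z : E * F) : rnorm z = Num.max (rnorm z.1) (rnorm z.2).
Proof.
rewrite {1}/rnorm prod_normE !rnormE /Num.max /Order.max ltcR.
by case: ifP.
Qed.

Lemma prod_complete (G : set_system (E * F)%type) :
  ProperFilter G -> cauchy G -> cvg G.
Proof.
move=> GG Gc.
have part (V : completeNormedModType R[i]) (h : E * F -> V) :
    (forall x y, rnorm (h x - h y) <= rnorm (x - y)) ->
    exists a, forall r, 0 < r -> G [set z | rnorm (a - h z) <= r].
  move=> h1; have hc : cauchy (h @ G).
    apply/cauchyP => e e0.
    have e1 : 0 < complex.Re e by move: e0; rewrite ltcE => /andP[].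
    have e2 : 0 < complex.Re e / 2 by rewrite divr_gt0.
    have [A GA Ar] := cauchy_rnorm _ Gc e2.
    have [x Ax] := @filter_ex _ _ GG _ GA.
    exists (h x); rewrite /fmap /=; apply: filterS GA => y Ay /=.
    rewrite -ball_normE /= rnormE.
    have -> : e = (complex.Re e)%:C.
      by move: e0; case: (e) => c d; rewrite ltcE /= => /andP[/eqP ->].
    rewrite ltcR (le_lt_trans (h1 _ _)) // (le_lt_trans (Ar _ _ Ax Ay)) //.
    by rewrite ltr_pdivrMr // ltr_pMr // ltr1n.
  have /cvg_ex[a /= ha] : cvg (h @ G) by exact: cauchy_cvg hc.
  by exists a => r r0; move: ha => /cvg_rnorm /(_ r r0).
have [|a ha] := part E fst; first by move=> x y; exact: rnorm1_le (x - y).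
have [|b hb] := part F snd; first by move=> x y; exact: rnorm2_le (x - y).
apply/cvg_ex; exists (a, b); apply/cvg_rnorm => r r0.
apply: filterS2 (ha _ r0) (hb _ r0) => -[x y] /= xa yb.
by rewrite rnorm_prod /= ge_max xa yb.
Qed.

HB.instance Definition _ := Uniform_isComplete.Build (E * F)%type prod_complete.

End prod_complete.

Definition bounded_linear (R : realType) (E F : normedModType R[i])
    (f : E -> F) : Prop :=
  linear f /\ exists M : R, forall x, rnorm (f x) <= M * rnorm x.

Definition bop_pred (R : realType) (E F : normedModType R[i]) :
  {pred E -> F} := mem [set f : E -> F | bounded_linear f].
Arguments bop_pred {R} E F.

Record bop (R : realType) (E F : normedModType R[i]) := Bop {
  bop_fun :> E -> F ;
  bop_subproof : bop_fun \in bop_pred E F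
}.

Section bop_lmod.
Context (R : realType) (E F : normedModType R[i]).

HB.instance Definition _ := [isSub for @bop_fun R E F].
HB.instance Definition _ := [Choice of bop E F by <:].

Lemma bopP (T : bop E F) : bounded_linear T.
Proof. by have := bop_subproof T; rewrite inE. Qed.

Lemma bop_submod_closed : submod_closed (bop_pred E F).
Proof.
split.
  rewrite inE; split; first by move=> a x y /=; rewrite scaler0 addr0.
  by exists 0 => x; rewrite mul0r [leLHS](@rnorm0 _ F).
move=> a f g; rewrite !inE => -[fl [M fM]] [gl [N gN]].
have fgE z : (a *: f + g) z = a *: f z + g z by [].
split.
  move=> b x y; rewrite !fgE fl gl !scalerDr !scalerA addrACA.
  by rewrite [a * b]mulrC.
exists (rnorm a * M + N) => x; rewrite fgE.
rewrite mulrDl (le_trans (rnormD _ _)) // lerD // rnormZ -mulrA.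
by rewrite ler_wpM2l // rnorm_ge0.
Qed.

HB.instance Definition _ := GRing.isSubmodClosed.Build _ _ (bop_pred E F)
  bop_submod_closed.
HB.instance Definition _ := [SubChoice_isSubLmodule of bop E F by <:].

Lemma bopD (S T : bop E F) x : (S + T) x = S x + T x. Proof. by []. Qed.
Lemma bopN (T : bop E F) x : (- T) x = - T x. Proof. by []. Qed.
Lemma bopZ a (T : bop E F) x : (a *: T) x = a *: T x. Proof. by []. Qed.

Lemma bop_ext (S T : bop E F) : (forall x, S x = T x) -> S = T.
Proof. by move=> ST; apply: val_inj; apply: funext. Qed.

End bop_lmod.

Section bop_norm.
Context (R : realType) (E F : normedModType R[i]).
Implicit Types S T : bop E F.

Definition opnorm T : R := sup [set rnorm (T x) | x in [set x | rnorm x <= 1]].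

Lemma bop0 T : T 0 = 0.
Proof.
by have [Tl _] := bopP T; have := Tl (-1) 0 0; rewrite !scaleN1r !addNr.
Qed.

Lemma bopZx T a x : T (a *: x) = a *: T x.
Proof. by have [Tl _] := bopP T; rewrite -[a *: x]addr0 Tl bop0 addr0. Qed.

Lemma bopDx T x y : T (x + y) = T x + T y.
Proof. by have [Tl _] := bopP T; have := Tl 1 x y; rewrite !scale1r. Qed.

Let opnorm_sup T :
  has_sup [set rnorm (T x) | x in [set x | rnorm x <= 1]].
Proof.
have [_ [M TM]] := bopP T; split.
  by exists (rnorm (T 0)); exists 0 => //=; rewrite rnorm0.
exists `|M| => _ [x /= x1 <-]; rewrite (le_trans (TM x)) //.
rewrite (le_trans (ler_wpM2r (rnorm_ge0 x) (ler_norm M))) //.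
by rewrite ler_piMr.
Qed.

Lemma opnorm_ge0 T : 0 <= opnorm T.
Proof.
apply: le_trans (rnorm_ge0 (T 0)) _; apply: sup_upper_bound => //.
by exists 0 => //=; rewrite rnorm0.
Qed.

Lemma le_opnorm T x : rnorm (T x) <= opnorm T * rnorm x.
Proof.
have [x0|x0] := eqVneq (rnorm x) 0.
  by rewrite (rnorm0_eq0 x0) bop0 !rnorm0 mulr0.
have xp : 0 < rnorm x by rewrite lt_neqAle eq_sym x0 rnorm_ge0.
rewrite -ler_pdivrMr //; apply: sup_upper_bound => //.
exists ((rnorm x)^-1%:C *: x) => /=.
  by rewrite rnormZr ger0_norm ?invr_ge0 ?rnorm_ge0 // mulVf.
by rewrite bopZx rnormZr ger0_norm ?invr_ge0 ?rnorm_ge0 // mulrC.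
Qed.

Lemma opnorm_le T (M : R) : 0 <= M ->
  (forall x, rnorm (T x) <= M * rnorm x) -> opnorm T <= M.
Proof.
move=> M0 TM; apply: ge_sup; first by have [] := opnorm_sup T.
by move=> _ [x /= x1 <-]; rewrite (le_trans (TM x)) // ler_piMr.
Qed.

Definition bop_normC T : R[i] := (opnorm T)%:C.

Lemma bop_normD S T : bop_normC (S + T) <= bop_normC S + bop_normC T.
Proof.
rewrite /bop_normC -rmorphD /= lecR; apply: opnorm_le.
  by rewrite addr_ge0 // opnorm_ge0.
move=> x; rewrite bopD mulrDl (le_trans (rnormD _ _)) // lerD //;
  exact: le_opnorm.
Qed.

Lemma bop_normZ (a : R[i]) T : bop_normC (a *: T) = `|a| * bop_normC T.
Proof.
have le_normZ b S : opnorm (b *: S) <= rnorm b * opnorm S.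
  apply: opnorm_le; first by rewrite mulr_ge0 ?opnorm_ge0 ?rnorm_ge0.
  move=> x; rewrite bopZ rnormZ -mulrA ler_wpM2l ?rnorm_ge0 //.
  exact: le_opnorm.
have -> : `|a| = (rnorm a)%:C by exact: (rnormE (a : R[i])).
rewrite /bop_normC -rmorphM /=; congr (_%:C).
apply/eqP; rewrite eq_le le_normZ /=.
have [->|a0] := eqVneq a 0; first by rewrite rnorm0 mul0r opnorm_ge0.
have ap : 0 < rnorm a.
  rewrite lt_neqAle rnorm_ge0 andbT eq_sym; apply: contra a0 => /eqP.
  by move/rnorm0_eq0 => ->.
rewrite mulrC -ler_pdivlMr // mulrC.
have {1}-> : T = a^-1 *: (a *: T) by rewrite scalerA mulVf // scale1r.
rewrite (le_trans (le_normZ _ _)) // ler_wpM2r ?opnorm_ge0 //.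
rewrite -(ler_pM2r ap) mulVf ?gt_eqF //.
have -> : rnorm a^-1 * rnorm a = rnorm (a^-1 * a).
  by rewrite -(rnormZ a^-1 (a : R[i])).
by rewrite mulVf // -[1]/(1%:C) rnorm_real normr1.
Qed.

Lemma bop_norm0_eq0 T : bop_normC T = 0 -> T = 0.
Proof.
move=> [T0]; apply: bop_ext => x; apply: rnorm0_eq0; apply/eqP.
by rewrite eq_le rnorm_ge0 andbT (le_trans (le_opnorm _ _)) // T0 mul0r.
Qed.

HB.instance Definition _ := Lmodule_isNormed.Build R[i] (bop E F)
  bop_normD bop_normZ bop_norm0_eq0.

Lemma rnorm_bop T : rnorm T = opnorm T.
Proof. by []. Qed.

End bop_norm.

Section bop_complete.
Context (R : realType) (E : normedModType R[i]) (F : completeNormedModType R[i]).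

Lemma bop_complete (G : set_system (bop E F)) :
  ProperFilter G -> cauchy G -> cvg G.
Proof.
move=> GG Gc.
have pt x : exists y : F, forall r, 0 < r ->
    G [set T : bop E F | rnorm (y - T x) <= r].
  have hc : cauchy ((fun T : bop E F => T x) @ G).
    apply/cauchyP => e e0.
    have e1 : 0 < complex.Re e by move: e0; rewrite ltcE => /andP[].
    have x1 : 0 < 1 + rnorm x by rewrite ltr_pwDl ?rnorm_ge0.
    have [A GA Ar] := cauchy_rnorm _ Gc (divr_gt0 e1 x1).
    have [T AT] := @filter_ex _ _ GG _ GA.
    exists (T x); rewrite /fmap /=; apply: filterS GA => S AS /=.
    rewrite -ball_normE /= rnormE.
    have -> : e = (complex.Re e)%:C.
      by move: e0; case: (e) => c d; rewrite ltcE /= => /andP[/eqP ->].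
    rewrite ltcR (_ : T x - S x = (T - S) x) //.
    rewrite (le_lt_trans (le_opnorm _ _)) //.
    rewrite (le_lt_trans (ler_wpM2r (rnorm_ge0 _) (Ar _ _ AT AS))) //.
    by rewrite mulrAC ltr_pdivrMr // ltr_pM2l // ltrDr.
  have /cvg_ex[a /= ha] : cvg ((fun T : bop E F => T x) @ G).
    exact: cauchy_cvg hc.
  by exists a => r r0; move: ha => /cvg_rnorm /(_ r r0).
have [L HL] := choice pt.
have Luniq x y : (forall r, 0 < r -> G [set T : bop E F | rnorm (y - T x) <= r]) ->
    L x = y.
  move=> H; apply/eqP; rewrite -subr_eq0; apply/eqP/rnorm0_eq0/eqP.
  rewrite eq_le rnorm_ge0 andbT; apply/ler_addgt0Pl => r r0; rewrite addr0.
  have r2 : 0 < r / 2 by rewrite divr_gt0.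
  have [T /= [T1 T2]] := @filter_ex _ _ GG _ (filterI (HL x _ r2) (H _ r2)).
  rewrite (_ : L x - y = (L x - T x) + (T x - y)); last first.
    by rewrite addrA subrK.
  rewrite (le_trans (rnormD _ _)) // [leRHS](splitr r) lerD //.
  by rewrite rnormB.
have Llin : linear L.
  move=> a x y; apply: Luniq => r r0.
  have r2 : 0 < r / 2 by rewrite divr_gt0.
  have a1 : 0 < 1 + rnorm a by rewrite ltr_pwDl ?rnorm_ge0.
  have ra : 0 < (r / 2) / (1 + rnorm a) by rewrite divr_gt0.
  apply: filterS2 (HL x _ ra) (HL y _ r2) => T /= Tx Ty.
  rewrite bopDx bopZx opprD addrACA -scalerBr (le_trans (rnormD _ _)) //.
  rewrite [leRHS](splitr r) lerD // rnormZ.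
  rewrite (le_trans (ler_wpM2l (rnorm_ge0 _) Tx)) //.
  by rewrite mulrCA ler_piMr ?(ltW r2) // ler_pdivrMr // mul1r lerDr.
have Lclose r : 0 < r -> G [set T : bop E F |
    forall x, rnorm (L x - T x) <= r * rnorm x].
  move=> r0; have [A GA Ar] := cauchy_rnorm _ Gc r0.
  apply: filterS (GA) => T AT x /=; apply/ler_addgt0Pl => e e0.
  have [S /= [Sx AS]] := @filter_ex _ _ GG _ (filterI (HL x _ e0) GA).
  rewrite (_ : L x - T x = (L x - S x) + (S - T) x); last first.
    by rewrite bopD bopN addrA subrK.
  rewrite (le_trans (rnormD _ _)) // lerD // (le_trans (le_opnorm _ _)) //.
  by rewrite ler_wpM2r ?rnorm_ge0 // Ar.
have Lb : L \in bop_pred E F.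
  rewrite inE; split => //.
  have [T /= TL] := @filter_ex _ _ GG _ (Lclose _ ltr01).
  exists (1 + opnorm T) => x.
  rewrite -[L x](subrK (T x)) (le_trans (rnormD _ _)) // mulrDl lerD //.
  exact: le_opnorm.
apply/cvg_ex; exists (Bop Lb); apply/cvg_rnorm => r r0.
apply: filterS (Lclose _ r0) => T /= TL; rewrite rnorm_bop.
by apply: opnorm_le => //; exact: ltW.
Qed.

HB.instance Definition _ := Uniform_isComplete.Build (bop E F) bop_complete.

End bop_complete.

Definition lp_sum (R : realType) (p : R) (x : nat -> R[i]) : \bar R :=
  (\sum_(0 <= k <oo) (rnorm (x k) `^ p)%:E)%E.

Definition lp_norm (R : realType) (p : R) (x : nat -> R[i]) : R :=
  fine (lp_sum p x) `^ p^-1.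

Section lp_raw.
Context (R : realType) (p : R) (p1 : 1 <= p).
Implicit Types x y : nat -> R[i].

Let p0 : 0 < p. Proof. exact: lt_le_trans p1. Qed.
Let pn0 : p != 0. Proof. by rewrite gt_eqF. Qed.

Let powR_le (a b : R) : 0 <= a -> 0 <= b -> a `^ p <= b `^ p -> a <= b.
Proof.
move=> a0 b0 ab; rewrite leNgt; apply/negP => ba; move: ab.
by rewrite leNgt gt0_ltr_powR ?nnegrE.
Qed.

Lemma lp_sum_ge0 x : (0 <= lp_sum p x)%E.
Proof. by apply: nneseries_ge0 => k _ _; rewrite lee_fin powR_ge0. Qed.

Lemma lp_norm_ge0 x : 0 <= lp_norm p x.
Proof. exact: powR_ge0. Qed.

Lemma lp_normX x : (lp_sum p x < +oo)%E ->
  lp_sum p x = (lp_norm p x `^ p)%:E.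
Proof.
move=> xoo; rewrite /lp_norm -powRrM mulVf // powRr1 ?fine_ge0 ?lp_sum_ge0 //.
by rewrite fineK // ge0_fin_numE ?lp_sum_ge0.
Qed.

Let lp_normE x : (lp_sum p x < +oo)%E ->
  (lp_sum p x `^ p^-1)%E = (lp_norm p x)%:E.
Proof.
move=> xoo; rewrite /lp_norm -poweR_EFin fineK // ge0_fin_numE //.
exact: lp_sum_ge0.
Qed.

Lemma lp_partial x N : (lp_sum p x < +oo)%E ->
  \sum_(0 <= k < N) rnorm (x k) `^ p <= lp_norm p x `^ p.
Proof.
move=> xoo; rewrite -lee_fin -lp_normX // -sumEFin.
by apply: nneseries_lim_ge => k _ _; rewrite lee_fin powR_ge0.
Qed.

Lemma lp_norm_le x r : 0 <= r ->
  (forall N, \sum_(0 <= k < N) rnorm (x k) `^ p <= r `^ p) ->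
  (lp_sum p x < +oo)%E /\ lp_norm p x <= r.
Proof.
move=> r0 H.
have Sr : (lp_sum p x <= (r `^ p)%:E)%E.
  rewrite /lp_sum; apply: lime_le.
    by apply: is_cvg_nneseries => k _ _; rewrite lee_fin powR_ge0.
  by apply: nearW => N; rewrite sumEFin lee_fin.
have Soo : (lp_sum p x < +oo)%E by rewrite (le_lt_trans Sr) ?ltry.
split => //; move: Sr; rewrite lp_normX // lee_fin => Sr.
by apply: powR_le Sr => //; exact: lp_norm_ge0.
Qed.

Let LnormE (x : nat -> R[i]) :
  ('N[@counting nat R]_p%:E [EFin \o (fun k => rnorm (x k))] =
  (lp_sum p x) `^ p^-1)%E.
Proof.
rewrite Lnorm_counting //; congr (_ `^ _)%E; apply: eq_eseriesr => k _ /=.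
by rewrite ger0_norm ?rnorm_ge0.
Qed.

Lemma lp_triangle x y : (lp_sum p x < +oo)%E -> (lp_sum p y < +oo)%E ->
  (lp_sum p (fun k => x k + y k)%R < +oo)%E /\
  lp_norm p (fun k => x k + y k)%R <= lp_norm p x + lp_norm p y.
Proof.
move=> xoo yoo; apply: lp_norm_le; first by rewrite addr_ge0 ?lp_norm_ge0.
move=> N; set f := fun k => rnorm (x k); set g := fun k => rnorm (y k).
have fg0 k : 0 <= f k + g k by rewrite addr_ge0 ?rnorm_ge0.
have mf (h : nat -> R) : measurable_fun [set: nat] h by move=> ? ?.
have := minkowski_EFin (@counting nat R) (mf f) (mf g) p1.
rewrite !LnormE Lnorm_counting //.
rewrite (lp_normE xoo) (lp_normE yoo) -EFinD => H.
have K0 k : (0 <= ((f \+ g) k `^ p)%:E)%E by rewrite lee_fin powR_ge0.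
pose S := (\sum_(0 <= k <oo) ((f k + g k) `^ p)%:E)%E.
have {}H : (S `^ p^-1 <= (lp_norm p x + lp_norm p y)%:E)%E.
  apply: le_trans H; rewrite le_eqVlt; apply/orP; left; apply/eqP.
  congr (_ `^ _)%E; apply: eq_eseriesr => k _ /=.
  by rewrite ger0_norm ?fg0.
have S0 : (0 <= S)%E by apply: nneseries_ge0 => k _ _; exact: K0.
have Soo : (S < +oo)%E.
  apply: (@lty_poweRy _ _ p^-1); first by rewrite invr_eq0.
  by rewrite (le_lt_trans H) ?ltry.
apply: (@le_trans _ _ (fine S)).
  rewrite -lee_fin fineK ?ge0_fin_numE // -sumEFin.
  apply: le_trans (nneseries_lim_ge N _) => /=; last by move=> *; exact: K0.
  apply: lee_sum => k _; rewrite lee_fin ge0_ler_powR ?nnegrE ?rnorm_ge0 //.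
    exact: ltW.
  exact: rnormD.
have SE : S = (fine S)%:E by rewrite fineK // ge0_fin_numE.
move: H; rewrite SE poweR_EFin lee_fin => H.
have := @ge0_ler_powR _ p (ltW p0) _ _ _ _ H.
rewrite -powRrM mulVf // powRr1 ?fine_ge0 //; apply; rewrite nnegrE.
  exact: powR_ge0.
by rewrite addr_ge0 ?lp_norm_ge0.
Qed.

Lemma lp_scale (a : R[i]) x : (lp_sum p x < +oo)%E ->
  (lp_sum p (fun k => a * x k)%R < +oo)%E /\
  lp_norm p (fun k => a * x k)%R = rnorm a * lp_norm p x.
Proof.
move=> xoo.
have E : lp_sum p (fun k => a * x k)%R = ((rnorm a * lp_norm p x) `^ p)%:E.
  rewrite powRM ?rnorm_ge0 ?lp_norm_ge0 // EFinM -lp_normX // -nneseriesZl.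
    by apply: eq_eseriesr => k _;
      rewrite (rnormZ a (x k : R[i])) powRM ?rnorm_ge0 // EFinM.
  by move=> k _; rewrite lee_fin powR_ge0.
rewrite E ltry; split => //.
by rewrite /lp_norm E /= -powRrM mulfV // powRr1 // mulr_ge0 ?rnorm_ge0 ?powR_ge0.
Qed.

Lemma lp_coord x k : (lp_sum p x < +oo)%E -> rnorm (x k) <= lp_norm p x.
Proof.
move=> xoo; have := lp_partial k.+1 xoo; rewrite big_nat_recr //= => H.
have : rnorm (x k) `^ p <= lp_norm p x `^ p.
  by apply: le_trans H; rewrite lerDr sumr_ge0 // => i _; exact: powR_ge0.
by apply: powR_le; rewrite ?rnorm_ge0 ?lp_norm_ge0.
Qed.

Let trunc N x : nat -> R[i] := fun k => if (k < N)%N then x k else 0.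

Let lp_trunc x N : (lp_sum p (trunc N x) < +oo)%E /\
  lp_norm p (trunc N x) `^ p = \sum_(0 <= k < N) rnorm (x k) `^ p.
Proof.
have E : lp_sum p (trunc N x) = (\sum_(0 <= k < N) rnorm (x k) `^ p)%:E.
  rewrite /lp_sum (nneseries_split 0 N); last first.
    by move=> k _; rewrite lee_fin powR_ge0.
  rewrite add0n [X in (_ + X)%E]eseries0 ?adde0; last first.
    by move=> k Nk _; rewrite /trunc ltnNge Nk /= rnorm0 powR0.
  by rewrite -sumEFin; apply: eq_big_nat => k /andP[_ kN]; rewrite /trunc kN.
have xoo : (lp_sum p (trunc N x) < +oo)%E by rewrite E ltry.
by split=> //; apply: EFin_inj; rewrite -lp_normX.
Qed.

(* Coordinatewise limits of points of a closed ball of lp stay in the ball. *)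
Lemma lp_closed_ball (A : set (nat -> R[i])) y r : 0 <= r ->
  (forall z, A z -> (lp_sum p z < +oo)%E /\ lp_norm p z <= r) ->
  (forall N e, 0 < e -> exists2 z, A z &
    forall k, (k < N)%N -> rnorm (y k - z k) <= e) ->
  (lp_sum p y < +oo)%E /\ lp_norm p y <= r.
Proof.
move=> r0 Ar Ay; apply: lp_norm_le => // N.
have [yoo <-] := lp_trunc y N.
apply: ge0_ler_powR; rewrite ?nnegrE ?lp_norm_ge0 ?(ltW p0) //.
apply/ler_addgt0Pl => e e0.
pose c := N.+1%:R `^ p^-1 : R; have c0 : 0 < c by rewrite powR_gt0.
have [z Az yz] := Ay N _ (divr_gt0 e0 c0); have [zoo zr] := Ar z Az.
have [dyoo dyE] := lp_trunc (fun k => y k - z k) N.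
have [tzoo tzE] := lp_trunc z N.
have -> : trunc N y = (fun k => trunc N (fun k => y k - z k) k + trunc N z k).
  apply: funext => k; rewrite /trunc; case: ifP => _; last by rewrite addr0.
  by rewrite subrK.
have [_ /le_trans->//] := lp_triangle dyoo tzoo.
apply: lerD; last first.
  apply: le_trans zr; apply: (powR_le (lp_norm_ge0 _) (lp_norm_ge0 _)).
  by rewrite [leLHS]tzE; exact: (lp_partial N zoo).
apply: (powR_le (lp_norm_ge0 _) (ltW e0)); rewrite [leLHS]dyE.
apply: (@le_trans _ _ (\sum_(0 <= k < N) (e / c) `^ p)).
  rewrite !big_nat; apply: ler_sum => k /andP[_ kN].
  apply: ge0_ler_powR; rewrite ?nnegrE ?rnorm_ge0 ?(ltW p0) //.
    by rewrite ltW ?divr_gt0.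
  exact: yz.
rewrite sumr_const_nat subn0 -[leLHS]mulr_natl.
rewrite powRM ?(ltW e0) ?invr_ge0 ?(ltW c0) // mulrCA ler_piMr ?powR_ge0 //.
have -> : c^-1 `^ p = N.+1%:R^-1.
  by rewrite -powR_inv1 ?(ltW c0) // -powRrM mulN1r powRN -powRrM mulVf // powRr1.
by rewrite ler_pdivrMr // mul1r ler_nat.
Qed.

End lp_raw.

Definition lp_pred (R : realType) (p : R) : {pred nat -> R[i]} :=
  mem [set x : nat -> R[i] | (lp_sum p x < +oo)%E].

Record lp (R : realType) (p : R) (p1 : 1 <= p) := Lp {
  lp_fun :> nat -> R[i] ;
  lp_subproof : lp_fun \in lp_pred p
}.

Section lp_space.
Context (R : realType) (p : R) (p1 : 1 <= p).

HB.instance Definition _ := [isSub for @lp_fun R p p1].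
HB.instance Definition _ := [Choice of lp p1 by <:].

Lemma lpP (x : lp p1) : (lp_sum p x < +oo)%E.
Proof. by have := lp_subproof x; rewrite inE. Qed.

Lemma lp_submod_closed : submod_closed (lp_pred p).
Proof.
split.
  rewrite inE /=.
  have -> : lp_sum p (0 : nat -> R[i]) = 0%E.
    rewrite /lp_sum eseries0 // => k _ _.
    by rewrite [rnorm _](@rnorm0 R R[i]) powR0 // gt_eqF // (lt_le_trans ltr01).
  exact: ltry.
move=> a x y; rewrite !inE => xoo yoo.
have [axoo _] := lp_scale p1 a xoo.
by have [] := lp_triangle p1 axoo yoo.
Qed.

HB.instance Definition _ := GRing.isSubmodClosed.Build _ _ (lp_pred p)
  lp_submod_closed.
HB.instance Definition _ := [SubChoice_isSubLmodule of lp p1 by <:].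

Lemma lpD (x y : lp p1) k : (x + y) k = x k + y k. Proof. by []. Qed.
Lemma lpN (x : lp p1) k : (- x) k = - x k. Proof. by []. Qed.
Lemma lpZ a (x : lp p1) k : (a *: x) k = a * x k. Proof. by []. Qed.

Definition lp_normC (x : lp p1) : R[i] := (lp_norm p x)%:C.

Lemma lp_normCD (x y : lp p1) : lp_normC (x + y) <= lp_normC x + lp_normC y.
Proof.
rewrite /lp_normC -rmorphD /= lecR.
by have [] := lp_triangle p1 (lpP x) (lpP y).
Qed.

Lemma lp_normCZ (a : R[i]) (x : lp p1) : lp_normC (a *: x) = `|a| * lp_normC x.
Proof.
have -> : `|a| = (rnorm a)%:C by exact: (rnormE (a : R[i])).
rewrite /lp_normC -rmorphM /=; congr (_%:C).
by have [] := lp_scale p1 a (lpP x).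
Qed.

Lemma lp_normC_eq0 (x : lp p1) : lp_normC x = 0 -> x = 0.
Proof.
move=> [x0]; apply: val_inj; apply: funext => k /=; apply: rnorm0_eq0.
by apply/eqP; rewrite eq_le rnorm_ge0 andbT -x0 lp_coord // lpP.
Qed.

HB.instance Definition _ := Lmodule_isNormed.Build R[i] (lp p1)
  lp_normCD lp_normCZ lp_normC_eq0.

Lemma rnorm_lp (x : lp p1) : rnorm x = lp_norm p x. Proof. by []. Qed.

Lemma lp_complete (G : set_system (lp p1)) :
  ProperFilter G -> cauchy G -> cvg G.
Proof.
move=> GG Gc.
have coord (x : lp p1) k : rnorm (x k) <= rnorm x by exact: lp_coord (lpP x).
have pt k : exists y : R[i], forall r, 0 < r ->
    G [set x : lp p1 | rnorm (y - x k) <= r].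
  have hc : cauchy ((fun x : lp p1 => x k) @ G).
    apply/cauchyP => e e0.
    have e1 : 0 < complex.Re e by move: e0; rewrite ltcE => /andP[].
    have [A GA Ar] := cauchy_rnorm _ Gc (divr_gt0 e1 (ltr0n _ 2)).
    have [x Ax] := @filter_ex _ _ GG _ GA.
    exists (x k); rewrite /fmap /=; apply: filterS GA => y Ay /=.
    rewrite -ball_normE /= rnormE.
    have -> : e = (complex.Re e)%:C.
      by move: e0; case: (e) => c d; rewrite ltcE /= => /andP[/eqP ->].
    rewrite ltcR (_ : x k - y k = (x - y) k) // (le_lt_trans (coord _ _)) //.
    rewrite (le_lt_trans (Ar _ _ Ax Ay)) //.
    by rewrite ltr_pdivrMr // ltr_pMr // ltr1n.
  have /cvg_ex[a /= ha] : cvg ((fun x : lp p1 => x k) @ G).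
    exact: cauchy_cvg hc.
  by exists a => r r0; move: ha => /cvg_rnorm /(_ r r0).
have [L HL] := choice pt.
have HN N e : 0 < e -> G [set x : lp p1 | forall k, (k < N)%N ->
    rnorm (L k - x k) <= e].
  move=> e0; elim: N => [|N IH]; first by apply: nearW.
  apply: filterS2 IH (HL N _ e0) => x /= xN xn k.
  by rewrite ltnS leq_eqVlt => /predU1P[->|/xN].
have close r : 0 < r -> G [set x : lp p1 |
    (lp_sum p (fun k => L k - x k)%R < +oo)%E /\
    lp_norm p (fun k => L k - x k) <= r].
  move=> r0; have [A GA Ar] := cauchy_rnorm _ Gc r0.
  apply: filterS (GA) => x Ax /=.
  apply: (@lp_closed_ball _ _ p1 [set (fun k => z k - x k) | z in A]).
  - exact: ltW.
  - by move=> _ [z Az <-]; split; [exact: (lpP (z - x))|exact: Ar].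
  move=> N e e0.
  have [z /= [zN Az]] := @filter_ex _ _ GG _ (filterI (HN N e e0) GA).
  exists (fun k => z k - x k); first by exists z.
  by move=> k kN; rewrite opprB addrA subrK zN.
have LlP : L \in lp_pred p.
  have [x /= [xoo _]] := @filter_ex _ _ GG _ (close _ ltr01).
  rewrite inE /=; have [+ _] := lp_triangle p1 xoo (lpP x).
  by under [X in lp_sum _ X]eq_fun do rewrite subrK.
apply/cvg_ex; exists (Lp p1 LlP); apply/cvg_rnorm => r r0.
by apply: filterS (close _ r0) => x /= [].
Qed.

HB.instance Definition _ := Uniform_isComplete.Build (lp p1) lp_complete.

End lp_space.

(* Neither Banach algebras nor the actions on bimodules are assumed unital. *)
Record banachAlgebra (R : realType) := BanachAlgebra {
  ba_sort :> completeNormedModType R[i] ;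
  ba_mul : ba_sort -> ba_sort -> ba_sort ;
  ba_mulA : associative ba_mul ;
  ba_mul_linl : forall b, linear (ba_mul^~ b) ;
  ba_mul_linr : forall a, linear (ba_mul a) ;
  ba_mul_norm : forall a b, rnorm (ba_mul a b) <= rnorm a * rnorm b
}.

Record banachBimodule (R : realType) (B : banachAlgebra R) := BanachBimodule {
  bm_sort :> completeNormedModType R[i] ;
  lact : B -> bm_sort -> bm_sort ;
  ract : bm_sort -> B -> bm_sort ;
  lact_linl : forall x, linear (lact^~ x) ;
  lact_linr : forall a, linear (lact a) ;
  ract_linl : forall a, linear (ract^~ a) ;
  ract_linr : forall x, linear (ract x) ;
  lactA : forall a b x, lact a (lact b x) = lact (ba_mul a b) x ;
  ractA : forall x a b, ract (ract x a) b = ract x (ba_mul a b) ;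
  lractA : forall a x b, ract (lact a x) b = lact a (ract x b) ;
  act_bounded : exists2 M : R, 0 <= M & forall a x,
    rnorm (lact a x) <= M * (rnorm a * rnorm x) /\
    rnorm (ract x a) <= M * (rnorm x * rnorm a)
}.

Section dual_bimodule.
Context (R : realType) (B : banachAlgebra R) (F : banachBimodule B).

Lemma dual_lact_subproof (a : B) (phi : bop F R[i]) :
  (fun x => phi (ract x a)) \in bop_pred F R[i].
Proof.
rewrite inE; split=> [c x y|].
  by rewrite ract_linl bopDx bopZx.
have [M M0 HM] := act_bounded F; exists (opnorm phi * (M * rnorm a)) => x.
rewrite (le_trans (le_opnorm _ _)) // -mulrA ler_wpM2l ?opnorm_ge0 //.
by have [_] := HM a x; rewrite -mulrA [rnorm a * _]mulrC.
Qed.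

Lemma dual_ract_subproof (phi : bop F R[i]) (a : B) :
  (fun x => phi (lact a x)) \in bop_pred F R[i].
Proof.
rewrite inE; split=> [c x y|].
  by rewrite lact_linr bopDx bopZx.
have [M M0 HM] := act_bounded F; exists (opnorm phi * (M * rnorm a)) => x.
rewrite (le_trans (le_opnorm _ _)) // -mulrA ler_wpM2l ?opnorm_ge0 //.
by have [+ _] := HM a x; rewrite -mulrA.
Qed.

Definition dual_lact (a : B) (phi : bop F R[i]) : bop F R[i] :=
  Bop (dual_lact_subproof a phi).
Definition dual_ract (phi : bop F R[i]) (a : B) : bop F R[i] :=
  Bop (dual_ract_subproof phi a).

Lemma dual_lact_linl phi : linear (dual_lact^~ phi).
Proof.
by move=> c a b; apply: bop_ext => x; rewrite bopD bopZ /= ract_linr bopDx bopZx.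
Qed.

Lemma dual_lact_linr a : linear (dual_lact a).
Proof. by move=> c phi psi; apply: bop_ext. Qed.

Lemma dual_ract_linl a : linear (dual_ract^~ a).
Proof. by move=> c phi psi; apply: bop_ext. Qed.

Lemma dual_ract_linr phi : linear (dual_ract phi).
Proof.
by move=> c a b; apply: bop_ext => x; rewrite bopD bopZ /= lact_linl bopDx bopZx.
Qed.

Lemma dual_lactA a b phi :
  dual_lact a (dual_lact b phi) = dual_lact (ba_mul a b) phi.
Proof. by apply: bop_ext => x /=; rewrite ractA. Qed.

Lemma dual_ractA phi a b :
  dual_ract (dual_ract phi a) b = dual_ract phi (ba_mul a b).
Proof. by apply: bop_ext => x /=; rewrite lactA. Qed.

Lemma dual_lractA a phi b :
  dual_ract (dual_lact a phi) b = dual_lact a (dual_ract phi b).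
Proof. by apply: bop_ext => x /=; rewrite lractA. Qed.

Lemma dual_act_bounded : exists2 M : R, 0 <= M & forall a phi,
  rnorm (dual_lact a phi) <= M * (rnorm a * rnorm phi) /\
  rnorm (dual_ract phi a) <= M * (rnorm phi * rnorm a).
Proof.
have [M M0 HM] := act_bounded F; exists M => // a phi.
have K : 0 <= M * (rnorm phi * rnorm a) by rewrite !mulr_ge0 ?rnorm_ge0.
rewrite [rnorm a * _]mulrC; split; apply: opnorm_le => // x;
  apply: le_trans (le_opnorm phi _) _;
  rewrite rnorm_bop mulrCA -mulrA ler_wpM2l ?opnorm_ge0 //.
- by have [_] := HM a x; rewrite -mulrA [rnorm a * _]mulrC.
- by have [+ _] := HM a x; rewrite -mulrA.
Qed.

Definition dual_bimodule : banachBimodule B :=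
  BanachBimodule dual_lact_linl dual_lact_linr dual_ract_linl dual_ract_linr
    dual_lactA dual_ractA dual_lractA dual_act_bounded.

End dual_bimodule.

Definition derivation (R : realType) (B : banachAlgebra R)
    (F : banachBimodule B) (D : B -> F) : Prop :=
  bounded_linear D /\
  forall a b, D (ba_mul a b) = lact a (D b) + ract (D a) b.

Definition inner (R : realType) (B : banachAlgebra R)
    (F : banachBimodule B) (D : B -> F) : Prop :=
  exists x : F, forall a, D a = lact a x - ract x a.

(* For a pairing ev of V with an index set I, sigma ev is V with the coarsest
   topology making all the scalar functions v |-> ev v i continuous. *)
Definition sigma (R : realType) (V : choiceType) (I : Type)
    (ev : V -> I -> R[i]) : topologicalType :=
  initial_topology (ev : V -> {ptws I -> R[i]}).

(* Here and below P is the predual of B, regarded as a subset of the dual of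
   B. *)
Definition wstar (R : realType) (B : banachAlgebra R)
    (P : set (bop B R[i])) : topologicalType :=
  sigma (fun (b : B) (f : P) => set_val f b).

Definition wstar_dual (R : realType) (B : banachAlgebra R)
    (F : banachBimodule B) : topologicalType :=
  sigma (fun (phi : dual_bimodule F) (x : F) => phi x).

Definition wstar_bimodule (R : realType) (B : banachAlgebra R)
    (P : set (bop B R[i])) (F : banachBimodule B) : Prop :=
  forall phi : dual_bimodule F,
    continuous ((fun b => lact b phi) : wstar P -> wstar_dual F) /\
    continuous ((fun b => ract phi b) : wstar P -> wstar_dual F).

Definition Connes_amenable (R : realType) (B : banachAlgebra R)
    (P : set (bop B R[i])) : Prop :=
  forall F : banachBimodule B, wstar_bimodule P F ->
  forall D : B -> dual_bimodule F, derivation D ->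
    continuous (D : wstar P -> wstar_dual F) -> inner D.
Arguments Connes_amenable {R} B P.

Section operator_algebra.
Context (R : realType) (E : completeNormedModType R[i]).

Lemma bop_comp_subproof (S T : bop E E) :
  (fun x => S (T x)) \in bop_pred E E.
Proof.
rewrite inE; split=> [c x y|]; first by rewrite !bopDx !bopZx.
exists (opnorm S * opnorm T) => x.
rewrite (le_trans (le_opnorm _ _)) // -mulrA ler_wpM2l ?opnorm_ge0 //.
exact: le_opnorm.
Qed.

Definition bop_comp (S T : bop E E) : bop E E := Bop (bop_comp_subproof S T).

Lemma bop_compA : associative bop_comp.
Proof. by move=> S T U; apply: bop_ext. Qed.

Lemma bop_comp_linl T : linear (bop_comp^~ T).
Proof. by move=> c S U; apply: bop_ext. Qed.

Lemma bop_comp_linr S : linear (bop_comp S).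
Proof.
by move=> c T U; apply: bop_ext => x; rewrite bopD bopZ /= bopDx bopZx.
Qed.

Lemma bop_comp_norm S T : rnorm (bop_comp S T) <= rnorm S * rnorm T.
Proof.
apply: opnorm_le => [|x]; first by rewrite mulr_ge0 ?rnorm_ge0.
apply: le_trans (le_opnorm S _) _.
by rewrite !rnorm_bop -mulrA ler_wpM2l ?opnorm_ge0 ?le_opnorm.
Qed.

Definition operator_algebra : banachAlgebra R :=
  BanachAlgebra bop_compA bop_comp_linl bop_comp_linr bop_comp_norm.

End operator_algebra.

(* A finite sequence of pairs u stands for the element \sum_(z in u) z.1 (x) z.2
   of the algebraic tensor product of E and F. Two sequences stand for the same
   tensor when no bilinear form separates them. *)
Definition same_tensor (R : realType) (E F : normedModType R[i])
    (u v : seq (E * F)) : Prop :=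
  forall beta : E -> F -> R[i],
    (forall y, linear (beta^~ y)) -> (forall x, linear (beta x)) ->
    \sum_(z <- u) beta z.1 z.2 = \sum_(z <- v) beta z.1 z.2.

Definition projective_norm (R : realType) (E F : normedModType R[i])
    (u : seq (E * F)) : R :=
  inf [set \sum_(z <- v) rnorm z.1 * rnorm z.2 | v in same_tensor u].

Definition tensor_sub (R : realType) (E F : normedModType R[i])
    (u v : seq (E * F)) : seq (E * F) :=
  u ++ [seq (- z.1, z.2) | z <- v].

(* The elements of the projective tensor product, the completion of the
   algebraic one for the projective norm, are represented by these sequences. *)
Definition projective_cauchy (R : realType) (E F : normedModType R[i])
    (u : nat -> seq (E * F)) : Prop :=
  forall e : R, 0 < e -> exists N, forall m n, (N <= m)%N -> (N <= n)%N ->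
    projective_norm (tensor_sub (u m) (u n)) < e.

(* The image of the projective tensor product of E and its dual in the dual of
   L(E), under the pairing < x (x) phi, T > = phi (T x). *)
Definition operator_predual (R : realType) (E : completeNormedModType R[i]) :
    set (bop (operator_algebra E) R[i]) :=
  [set f | exists2 u : nat -> seq (E * bop E R[i]), projective_cauchy u &
    forall T : operator_algebra E,
      \sum_(z <- u n) z.2 ((T : bop E E) z.1) @[n --> \oo] --> f T].
Arguments operator_predual {R} E.

(* Main.v *)
Require Import Defs.
From HB Require Import structures.
From mathcomp Require Import all_boot all_order all_algebra.
From mathcomp Require Import complex.
From mathcomp Require Import ring lra.
From mathcomp Require Import all_classical all_reals all_analysis.

Set Implicit Arguments.
Unset Strict Implicit.
Unset Printing Implicit Defensive.

Import Order.TTheory GRing.Theory Num.Theory.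
Import numFieldNormedType.Exports.

Local Open Scope classical_set_scope.
Local Open Scope ring_scope.
Local Open Scope complex_scope.

(** Let [P] be the projection of [E = l^p (+) l^q] onto [l^p]. The commutators
    [c P - P c] pair with finite rank operators [S] through [tr (S a [c, P] b)];
    the supremum over the unit balls in [a], [b], [c] is a seminorm, the completion [F]
    of the finite rank operators for it is a bimodule, and [c |-> tr (. [c, P])] is a
    derivation into [F^*]. Reflexivity of [E] makes [F^*] a w*-bimodule and the
    derivation w*-continuous. A functional implementing it commutes with the rank
    one operators up to [tr (P .)], so it is [tr (P .) + lambda tr] on finite rank
    operators; by boundedness, [(1 + lambda) m] and [lambda m] are at most a constant
    times the norms of the projections onto the first [m] basis vectors of [l^p]
    and [l^q]. These norms are [o(m)] along suitable [m], which is absurd: up to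
    sign they are bounded by two traces [tr (T S)] over the first [m] basis vectors
    with [S : l^s -> l^r] and [T] backwards contractions. For [s < r] such a trace
    is averaged over random sign selectors of density [1 / (d + 1)]; Rosenthal's
    inequality bounds the [r]-th moments of the images under [S], and [s <> 2] leaves
    room to choose the density ([d = 0] when [s < 2], [d] large when [s > 2]). The
    case [s > r] is the case [s' < r'] for the transposes. *)

(** * Random sign selectors *)

(** If [tr (P .)] were bounded for the seminorm, it would itself implement the derivation; so the
    seminorm is built to see [P] through commutators only. The suprema over [a] and [b] make the two
    actions contractive, and the values at [a = b = 1] make the derivation bounded. A commutator
    with [P] has off-diagonal blocks only, so on one summand the seminorm evaluates traces of
    operators that factor through the other summand. This is where the exponents enter. For [s = r]
    the factorisation can be that of the identity. For [s = 2] the span of [m] Rademacher functions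
    is a Euclidean space complemented in l^r uniformly in [m]. In both cases the trace has order
    [m]. As each summand is tested against the other, neither exponent may be 2. Selectors are
    thinned for [s > 2] because density [1/(d+1)] multiplies the square function term by
    [(d+1)^(-r/2)], whereas the size to be beaten falls only by [(d+1)^(-r/s)]. *)

Section real_powers.
Context {R : realType}.
Implicit Types a b r s t v w x : R.

Lemma powR_le_mono t a b : 0 <= t -> 0 <= a -> a <= b -> a `^ t <= b `^ t.
Proof.
by move=> t0 a0 ab; apply: ge0_ler_powR => //; rewrite nnegrE // (le_trans a0).
Qed.

Lemma powRDp a s t : 0 < a -> a `^ (s + t) = a `^ s * a `^ t.
Proof. by move=> a0; rewrite powRD // (gt_eqF a0) implybT. Qed.

Lemma powR_rootK a t : 0 < t -> 0 <= a -> (a `^ t^-1) `^ t = a.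
Proof. by move=> t0 a0; rewrite -powRrM mulVf ?powRr1 // gt_eqF. Qed.

Lemma powRK_root a t : 0 < t -> 0 <= a -> (a `^ t) `^ t^-1 = a.
Proof. by move=> t0 a0; rewrite -powRrM mulfV ?powRr1 // gt_eqF. Qed.

Lemma powR_invl a t : 0 <= a -> (a^-1) `^ t = (a `^ t)^-1.
Proof. by move=> a0; rewrite -powR_inv1 // -powRrM mulN1r powRN. Qed.

Lemma powR_add_le t a b : 0 <= t -> 0 <= a -> 0 <= b ->
  (a + b) `^ t <= 2 `^ t * (a `^ t + b `^ t).
Proof.
move=> t0; wlog ab : a b / a <= b => [H a0 b0|a0 b0].
  by have [ab|/ltW ba] := leP a b; [exact: H|rewrite addrC [X in _ * X]addrC H].
rewrite mulrDr -!powRM //; apply: (@le_trans _ _ ((2 * b) `^ t)).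
  by apply: powR_le_mono => //; [exact: addr_ge0|rewrite mulr_natl mulr2n lerD2r].
by rewrite lerDr powR_ge0.
Qed.

(** The first term wins for [w <= a], the second for [w > a]. With the level [a] left free, this
    truncation does the work of Hölder's inequality between moments in all the averages below. *)
Lemma powR_interp t r a w : 0 < a -> 0 <= w -> 0 <= t -> t <= r ->
  w `^ t <= a `^ t + a `^ (t - r) * w `^ r.
Proof.
move=> a0 w0 t0 tr; have [wa|aw] := leP w a.
  rewrite (le_trans (powR_le_mono t0 w0 wa)) // lerDl.
  by rewrite mulr_ge0 ?powR_ge0.
have w1 : 0 < w by exact: lt_trans aw.
apply: (@le_trans _ _ (a `^ (t - r) * w `^ r)); last by rewrite lerDr powR_ge0.
rewrite -[t in leLHS](subrK r) (@powRD _ w) ?(gt_eqF w1) ?implybT //.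
rewrite ler_wpM2r ?powR_ge0 // -opprB !powRN lef_pV2 ?posrE ?powR_gt0 //.
by rewrite powR_le_mono ?subr_ge0 // ltW.
Qed.

(** A mean value inequality with the integer [n] above [s] as constant. After division by [b] it
    reads [1 - u^s <= 1 - u^n <= n (1 - u)] for [u = a / b] in [0, 1], the last step being
    Bernoulli's inequality. *)
Lemma powR_incr_le s : 1 <= s -> exists2 K : R, 1 <= K & forall a b, 0 <= a -> a <= b ->
  b `^ s - a `^ s <= K * b `^ (s - 1) * (b - a).
Proof.
move=> s1; have s0 : 0 < s by exact: lt_le_trans s1.
pose n := `|Num.ceil s|%N.
have sn : s <= n%:R.
  by rewrite (le_trans (Num.Theory.ceil_ge _)) // natr_absz ler_int ler_norm.
have n1 : 1 <= n%:R :> R by exact: le_trans sn.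
exists n%:R => // a b a0 ab.
have [b0|b0] := eqVneq b 0.
  have -> : a = 0 by apply/eqP; rewrite eq_le a0 andbT -b0.
  by rewrite b0 !subrr mulr0.
have bp : 0 < b by rewrite lt_neqAle eq_sym b0 (le_trans a0).
pose u := a / b; have u0 : 0 <= u by rewrite divr_ge0 // ltW.
have u1 : u <= 1 by rewrite ler_pdivrMr // mul1r.
have -> : a = u * b by rewrite mulfVK.
rewrite powRM ?(ltW bp) // -mulr_powRB1 ?(ltW bp) //.
have -> : n%:R * b `^ (s - 1) * (b - u * b) = b * b `^ (s - 1) * (n%:R * (1 - u)).
  by ring.
have -> : b * b `^ (s - 1) - u `^ s * (b * b `^ (s - 1)) =
  b * b `^ (s - 1) * (1 - u `^ s) by ring.
rewrite ler_wpM2l ?mulr_ge0 ?powR_ge0 ?(ltW bp) //.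
have un : u ^+ n <= u `^ s.
  have [->|un0] := eqVneq u 0.
    rewrite expr0n powR0 ?gt_eqF //.
    by move: n1; case: (n) => //; rewrite ler10.
  rewrite -powR_mulrn // ger_powR // u1 andbT lt_neqAle eq_sym un0.
  exact: u0.
apply: (@le_trans _ _ (1 - u ^+ n)); first by rewrite lerD2l lerN2.
elim: (n) => [|k IH]; first by rewrite expr0 subrr mul0r.
rewrite exprS -natr1 mulrDl mul1r.
have -> : 1 - u * u ^+ k = u * (1 - u ^+ k) + (1 - u) by ring.
rewrite lerD2r (le_trans _ IH) // ler_piMl // subr_ge0 exprn_ile1 //.
Qed.
End real_powers.

Section odd_power.
Context {R : realType}.

(** Up to the factor [t + 2], the derivative of [|w|^(t+2)]. *)
Definition oddpow (t w : R) : R := w * `|w| `^ t.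

Lemma oddpow_mul t w : 0 <= t -> w * oddpow t w = `|w| `^ (t + 2).
Proof.
move=> t0; rewrite /oddpow; have [->|w0] := eqVneq w 0.
  by rewrite mul0r normr0 powR0 // gt_eqF // ltr_wpDl.
rewrite powRD ?normr_eq0 ?w0 ?implybT // powR_mulrn //.
by rewrite real_normK ?num_real // mulrA -expr2 mulrC.
Qed.

Lemma oddpowN t w : oddpow t (- w) = - oddpow t w.
Proof. by rewrite /oddpow normrN mulNr. Qed.

Definition oddpow_lipschitz (t K : R) := forall p q M : R,
  `|p| <= M -> `|q| <= M -> `|oddpow t p - oddpow t q| <= K * M `^ t * `|p - q|.

(** For arguments of the same sign this is [powR_incr_le] with exponent [t + 1]. For opposite signs
    [|p - q| = |p| + |q|], and the two values are bounded one by one, which is where [1 <= K] is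
    used. *)
Lemma oddpow_lip (t : R) : 0 <= t -> exists2 K : R, 1 <= K & oddpow_lipschitz t K.
Proof.
move=> t0; have [|K K1 HK] := @powR_incr_le R (t + 1); first by rewrite lerDr.
have K0 : 0 <= K by exact: le_trans K1.
exists K => // p q M pM qM.
have M0 : 0 <= M by exact: le_trans pM.
have gE (w : R) : 0 <= w -> oddpow t w = w `^ (t + 1).
  move=> w0; rewrite /oddpow ger0_norm // -(@mulr_powRB1 _ w (t + 1)) ?addrK //.
  by rewrite ltr_wpDl.
have same a b : 0 <= a -> a <= b -> b <= M ->
    `|oddpow t b - oddpow t a| <= K * M `^ t * `|b - a|.
  move=> a0 ab bM; have b0 : 0 <= b by exact: le_trans ab.
  rewrite !gE // ger0_norm ?subr_ge0 ?powR_le_mono ?addr_ge0 //.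
  rewrite (ger0_norm (_ : 0 <= b - a)) ?subr_ge0 //.
  rewrite (le_trans (HK _ _ a0 ab)) // addrK ler_wpM2r ?subr_ge0 // ler_wpM2l //.
  exact: powR_le_mono.
have opp a b : 0 <= a -> a <= M -> 0 <= b -> b <= M ->
    `|oddpow t b - oddpow t (- a)| <= K * M `^ t * `|b - (- a)|.
  move=> a0 aM b0 bM; rewrite oddpowN !opprK.
  rewrite !ger0_norm ?addr_ge0 //; last first.
    by rewrite /oddpow mulr_ge0 // powR_ge0.
    by rewrite /oddpow mulr_ge0 // powR_ge0.
  rewrite /oddpow !ger0_norm // mulrDr lerD //.
    rewrite mulrC ler_wpM2r // (@le_trans _ _ (M `^ t)) ?powR_le_mono //.
    by rewrite ler_peMl ?powR_ge0.
  rewrite mulrC ler_wpM2r // (@le_trans _ _ (M `^ t)) ?powR_le_mono //.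
  by rewrite ler_peMl ?powR_ge0.
have nneg a b : 0 <= a -> a <= M -> 0 <= b -> b <= M ->
    `|oddpow t b - oddpow t a| <= K * M `^ t * `|b - a|.
  move=> a0 aM b0 bM; have [ab|/ltW ba] := leP a b; first exact: same.
  by rewrite distrC [X in _ * X]distrC; exact: same.
have [p0|/ltW p0] := leP 0 p; have [q0|/ltW q0] := leP 0 q;
  move: pM qM; rewrite ?(ger0_norm p0) ?(ger0_norm q0) ?(ler0_norm p0)
    ?(ler0_norm q0) => pM qM.
- exact: nneg.
- by rewrite -[q]opprK; apply: opp; rewrite ?oppr_ge0.
- rewrite distrC [X in _ * X]distrC -[p]opprK; apply: opp; rewrite ?oppr_ge0 //.
- have := nneg (- p) (- q); rewrite !oppr_ge0 => /(_ p0 pM q0 qM).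
  by rewrite (oddpowN t p) (oddpowN t q) -(opprD (oddpow t q)) -(opprD q) !normrN
    distrC [X in _ * X]distrC.
Qed.

End odd_power.

(** * Uniform averages over finite sets, redrawing one coordinate *)

Section averages.
Context {R : realType}.

Definition avg (T : finType) (F : T -> R) : R := (\sum_t F t) / #|T|%:R.

Context {T : finType} (T0 : (0 < #|T|)%N).
Implicit Types F G : T -> R.

Lemma avg_cst c : avg (fun _ : T => c) = c.
Proof.
by rewrite /avg sumr_const -[X in X / _]mulr_natr mulfK // pnatr_eq0 -lt0n.
Qed.

Lemma avgD F G : avg (fun t => F t + G t) = avg F + avg G.
Proof. by rewrite /avg big_split mulrDl. Qed.

Lemma avgZ c F : avg (fun t => c * F t) = c * avg F.
Proof. by rewrite /avg -mulr_sumr mulrA. Qed.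

Lemma avg_sum (I : Type) (s : seq I) (P : pred I) (F : I -> T -> R) :
  avg (fun t => \sum_(i <- s | P i) F i t) = \sum_(i <- s | P i) avg (F i).
Proof. by rewrite /avg exchange_big /= mulr_suml. Qed.

Lemma ler_avg F G : (forall t, F t <= G t) -> avg F <= avg G.
Proof. by move=> FG; rewrite /avg ler_wpM2r ?invr_ge0 // ler_sum. Qed.

Lemma avg_ge0 F : (forall t, 0 <= F t) -> 0 <= avg F.
Proof. by move=> F0; rewrite /avg mulr_ge0 ?invr_ge0 // sumr_ge0. Qed.

Lemma ler_norm_avg F : `|avg F| <= avg (fun t => `|F t|).
Proof.
rewrite /avg normrM (ger0_norm (_ : 0 <= #|T|%:R^-1)) ?invr_ge0 //.
by rewrite ler_wpM2r ?invr_ge0 // ler_norm_sum.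
Qed.

Lemma avg_inj (h : T -> T) F : injective h -> avg (F \o h) = avg F.
Proof. by move=> hi; rewrite /avg; congr (_ / _); rewrite [RHS](reindex_inj hi). Qed.

End averages.

Section resample.
Context {R : realType} (I J : finType) (J0 : (0 < #|J|)%N).

Definition upd (w : {ffun I -> J}) (i : I) (j : J) : {ffun I -> J} :=
  [ffun k => if k == i then j else w k].

(** Exchanging [w i] with the fresh value [j] is an involution of the pairs [(w, j)]. This stands in
    for independence: the inner average is taken with all other coordinates frozen. *)
Lemma avg_resample (i : I) (F : {ffun I -> J} -> R) :
  avg F = avg (fun w => avg (fun j => F (upd w i j))).
Proof.
pose h (z : {ffun I -> J} * J) := (upd z.1 i z.2, z.1 i).
have hK : involutive h.
  move=> [w j]; rewrite /h /=; congr (_, _); last by rewrite ffunE eqxx.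
  by apply/ffunP => k; rewrite !ffunE; case: eqP => // ->.
rewrite /avg -mulr_suml pair_bigA /=.
have -> : \sum_p F (upd p.1 i p.2) = \sum_(p : {ffun I -> J} * J) F p.1.
  rewrite [RHS](reindex_inj (inv_inj hK)) /=; apply: eq_bigr => -[w j] _ //.
rewrite -(pair_bigA _ (fun w j => F w)) /=.
under [in RHS]eq_bigr do rewrite sumr_const -mulr_natr.
by rewrite -mulr_suml mulfK // pnatr_eq0 -lt0n.
Qed.

End resample.

Section selectors.
Context {R : realType} (d : nat).
Local Notation J := (bool * 'I_d.+1)%type.
Local Notation delta := (d.+1%:R^-1 : R).

(* A random sign, kept with probability [delta]. *)
Definition sel (j : J) : R := if j.2 == ord0 then (-1) ^+ j.1 else 0.

Definition selN (j : J) : J := (~~ j.1, j.2).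

Lemma selNE j : sel (selN j) = - sel j.
Proof. by rewrite /sel /selN /=; case: ifP; rewrite ?oppr0 // signrN. Qed.

Lemma selN_inj : injective selN.
Proof. by move=> [a i] [b j] /= [/negb_inj -> ->]. Qed.

Lemma card_sel : #|{: J}| = (2 * d.+1)%N.
Proof. by rewrite card_prod card_bool card_ord. Qed.

Lemma card_sel_gt0 : (0 < #|{: J}|)%N. Proof. by rewrite card_sel. Qed.

Lemma avg_sel (h : R -> R) :
  avg (fun j => h (sel j)) = delta * ((h 1 + h (-1)) / 2) + (1 - delta) * h 0.
Proof.
rewrite /avg card_sel -(pair_bigA _ (fun b i => h (sel (b, i)))) /=.
rewrite big_bool /= !big_ord_recl /= /sel /= expr1 expr0.
rewrite !sumr_const !card_ord -[h 0 *+ d]mulr_natr.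
have d0 : d%:R + 1 != 0 :> R by rewrite natr1 pnatr_eq0.
by rewrite natrM -natr1; field.
Qed.

Lemma delta_gt0 : 0 < delta. Proof. by rewrite invr_gt0. Qed.
Lemma delta_le1 : delta <= 1. Proof. by rewrite invf_le1 // ler1n. Qed.

Lemma norm_sel j : `|sel j| = (sel j) ^+ 2.
Proof.
by rewrite /sel; case: ifP => _; rewrite ?normr0 ?expr0n //= normr_sign sqrr_sign.
Qed.

(** One of [v + y] and [v - y] is at least as large as [v] in absolute value, and [selN] pairs the
    two; hence the factor 2. *)
Lemma le_avg_sel_shift (t v x : R) : 0 <= t ->
  `|v| `^ t <= 2 * avg (fun j => `|v + sel j * x| `^ t).
Proof.
move=> t0; have {1}-> : `|v| `^ t = avg (fun _ : J => `|v| `^ t).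
  by rewrite avg_cst ?card_sel_gt0.
pose F j := `|v + sel j * x| `^ t.
rewrite mulr_natl mulr2n -{2}(avg_inj F selN_inj) -avgD.
apply: ler_avg => j; rewrite /F /= selNE mulNr.
set y := sel j * x.
have [vy|vy] := leP 0 (v * y).
  apply: (@le_trans _ _ (`|v + y| `^ t)); last by rewrite lerDl powR_ge0.
  apply: powR_le_mono => //; rewrite -ler_sqr ?nnegrE // !real_normK ?num_real //.
  by rewrite sqrrD -addrA lerDl addr_ge0 ?sqr_ge0 // mulrn_wge0.
apply: (@le_trans _ _ (`|v - y| `^ t)); last by rewrite lerDr powR_ge0.
apply: powR_le_mono => //; rewrite -ler_sqr ?nnegrE // !real_normK ?num_real //.
by rewrite sqrrB -addrA lerDl addr_ge0 ?sqr_ge0 // -mulNrn mulrn_wge0 // oppr_ge0 ltW.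
Qed.

(** The value 0 of the selector contributes nothing, which leaves the factor [delta]. The two signs
    produce the difference of [oddpow] at [v + x] and [v - x], so what is of first order in [x]
    cancels and the Lipschitz bound leaves a second order term. *)
Lemma avg_sel_oddpow (t K v x : R) : 0 <= t -> 0 <= K -> oddpow_lipschitz t K ->
  avg (fun j => sel j * x * oddpow t (v + sel j * x)) <=
  delta * (K * 2 `^ t) * (x ^+ 2 * `|v| `^ t + `|x| `^ (t + 2)).
Proof.
move=> t0 K0 HK; rewrite (avg_sel (fun s => s * x * oddpow t (v + s * x))).
rewrite !mul0r mulr0 addr0 -!mulrA ler_wpM2l ?(ltW delta_gt0) //.
rewrite !mul1r !mulN1r.
have -> : (x * oddpow t (v + x) - x * oddpow t (v - x)) / 2 =
  x / 2 * (oddpow t (v + x) - oddpow t (v - x)) by field.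
rewrite (le_trans (ler_norm _)) // normrM.
have := HK (v + x) (v - x) (`|v| + `|x|) (ler_normD _ _) (ler_normB _ _).
have -> : v + x - (v - x) = 2 * x by ring.
move=> H; apply: (le_trans (ler_wpM2l (normr_ge0 _) H)).
rewrite !normrM normfV normr_nat.
have -> : `|x| / 2 * (K * (`|v| + `|x|) `^ t * (2 * `|x|)) =
  K * (x ^+ 2 * (`|v| + `|x|) `^ t).
  by rewrite -(real_normK (num_real x)); field.
rewrite ler_wpM2l //.
apply: (le_trans (ler_wpM2l (sqr_ge0 _) (powR_add_le t0 (normr_ge0 v) (normr_ge0 x)))).
rewrite mulrCA ler_wpM2l ?powR_ge0 // mulrDr !mulrA -expr2 lerD2l -(oddpow_mul _ t0).
rewrite /oddpow.
by rewrite expr2 mulrA.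
Qed.

Context {m : nat}.
Local Notation O := {ffun 'I_m -> J}.
Implicit Types (x : 'I_m -> R) (w : O).

Lemma card_O_gt0 : (0 < #|{: O}|)%N.
Proof. by rewrite card_ffun expn_gt0 card_sel_gt0. Qed.

Definition selsum x w : R := \sum_i sel (w i) * x i.

Lemma selsum_upd x w i j :
  selsum x (upd w i j) = (\sum_(k | k != i) sel (w k) * x k) + sel j * x i.
Proof.
rewrite /selsum (bigD1 i) //= !ffunE eqxx addrC; congr (_ + _).
by apply: eq_bigr => k ki; rewrite ffunE (negbTE ki).
Qed.

Lemma avg_sel_selsum x y i :
  avg (fun w => sel (w i) * x i * selsum y w) = delta * (x i * y i).
Proof.
rewrite (avg_resample card_sel_gt0 i) -[RHS](avg_cst card_O_gt0).
congr (_ / _); apply: eq_bigr => w _.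
under [X in avg X]eq_fun do rewrite selsum_upd ffunE eqxx.
set v := \sum_(k | _) _.
rewrite (avg_sel (fun s => s * x i * (v + s * y i))); field.
by rewrite gt_eqF.
Qed.

(** Selectors at distinct indices are uncorrelated and each has variance [delta]. Applied
    coordinatewise, this identity turns an average of pairings into a trace. *)
Lemma avg_selsum_mul x y :
  avg (fun w => selsum x w * selsum y w) = delta * \sum_i x i * y i.
Proof.
rewrite mulr_sumr -[RHS](eq_bigr _ (fun i _ => avg_sel_selsum x y i)) -avg_sum.
by congr (_ / _); apply: eq_bigr => w _; rewrite {1}/selsum mulr_suml.
Qed.

(** Rosenthal's inequality by absorption: the moment of order [t + 2] is bounded by the moment of
    order [t], which truncation at the level [a] bounds by the moment of order [t + 2] again, with
    coefficient 1/2. Of the constant 4, one factor 2 comes from [le_avg_sel_shift], the other from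
    this absorption. *)
Lemma rosenthal_aux (t K0 : R) x (a : R) : 0 <= t -> 1 <= K0 ->
  oddpow_lipschitz t K0 -> 0 < a ->
  4 * (K0 * 2 `^ t) * delta * \sum_i x i ^+ 2 <= a ^+ 2 ->
  avg (fun w => `|selsum x w| `^ (t + 2)) <=
  4 * (K0 * 2 `^ t) * delta * \sum_i `|x i| `^ (t + 2) + a `^ (t + 2).
Proof.
move=> t0 K1 lipK a0; have K00 : 0 <= K0 by exact: le_trans K1.
have HK v y := avg_sel_oddpow v y t0 K00 lipK.
set K := K0 * _ in HK *; have {K1} Kp : 0 < K.
  by rewrite mulr_gt0 ?powR_gt0 // (lt_le_trans ltr01).
move=> aB; set u := avg _; set A := \sum_i `|_| `^ _.
set B := \sum_i _ in aB.
pose ut := avg (fun w => `|selsum x w| `^ t).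
have B0 : 0 <= B by rewrite sumr_ge0 // => i _; exact: sqr_ge0.
have u0 : 0 <= u by apply: avg_ge0 => w; exact: powR_ge0.
(* One factor of the power is expanded as a sum over [i]. Redrawing [w i] then isolates a single
   selector, and [le_avg_sel_shift] puts the removed coordinate back into the sum. *)
have H1 : u <= delta * K * (2 * B * ut + A).
  have -> : u = \sum_i avg (fun w => sel (w i) * x i * oddpow t (selsum x w)).
    rewrite -avg_sum; congr (_ / _); apply: eq_bigr => w _.
    by rewrite -mulr_suml oddpow_mul.
  have -> : delta * K * (2 * B * ut + A) =
      \sum_i delta * K * (x i ^+ 2 * (2 * ut) + `|x i| `^ (t + 2)).
    rewrite -mulr_sumr big_split -mulr_suml /= -/A -/B; ring.
  apply: ler_sum => i _; rewrite (avg_resample card_sel_gt0 i).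
  rewrite /ut (avg_resample card_sel_gt0 i (fun w => `|selsum x w| `^ t)) -!avgZ.
  rewrite -[X in _ * (_ + X)](avg_cst card_O_gt0) -avgD -avgZ.
  apply: ler_avg => w.
  under [X in avg X <= _]eq_fun do rewrite selsum_upd ffunE eqxx.
  under [X in _ <= _ * (_ * (_ * avg X) + _)]eq_fun do rewrite selsum_upd.
  set v := \sum_(k | _) _.
  rewrite (le_trans (HK v (x i))) // ler_wpM2l ?mulr_ge0 ?(ltW delta_gt0) ?(ltW Kp) //.
  by rewrite lerD2r ler_wpM2l ?sqr_ge0 // le_avg_sel_shift.
have H2 : ut <= a `^ t + a `^ (- 2) * u.
  rewrite /ut /u -avgZ -[X in X + _](avg_cst card_O_gt0) -avgD; apply: ler_avg => w.
  have -> : - 2 = t - (t + 2) :> R by ring.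
  by apply: powR_interp => //; rewrite lerDl.
have dK : 0 <= delta * K by rewrite mulr_ge0 ?(ltW delta_gt0) ?(ltW Kp).
have a2 : a `^ (- 2) = (a ^+ 2)^-1 by rewrite powRN powR_mulrn // ltW.
(* The lower bound on [a ^+ 2] is exactly what makes the coefficient of [u] equal to 1/2 on the
   right. *)
have H3 : delta * K * (2 * B * ut) <= (a ^+ 2 / 2) * (a `^ t + a `^ (- 2) * u).
  rewrite mulrA; apply: ler_pM => //.
  - by rewrite !mulr_ge0 // ?(ltW delta_gt0) ?(ltW Kp).
  - by apply: avg_ge0 => w; exact: powR_ge0.
  - have -> : delta * K * (2 * B) = 4 * K * delta * B / 2 by field; rewrite ?nat1r ?pnatr_eq0.
    by rewrite ler_wpM2r.
have H4 : (a ^+ 2 / 2) * (a `^ t + a `^ (- 2) * u) = a `^ (t + 2) / 2 + u / 2.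
  rewrite a2 (@powRD _ a t 2) ?(gt_eqF a0) ?implybT // powR_mulrn ?(ltW a0) //.
  by field; rewrite gt_eqF.
have A0 : 0 <= A by rewrite sumr_ge0 // => i _; exact: powR_ge0.
have := mulr_ge0 dK A0.
have -> : 4 * K * delta * A = 4 * (delta * K * A) by ring.
move: H1 H3; rewrite H4 mulrDr.
move: (delta * K * A) (delta * K * _) (a `^ _) => X Y Z; lra.
Qed.

End selectors.

(** * Moments of random sums *)

Section moments.
Context {R : realType}.

(** Jensen's inequality up to a constant. Truncating at the level [a] with [a ^+ 2 = B / 2] leaves
    at least half of the second moment to the part controlled by the moment of order [r]. *)
Lemma avg_sqr_powR (T : finType) (F : T -> R) (r : R) : (0 < #|T|)%N -> 2 <= r ->
  (avg (fun t => F t ^+ 2)) `^ (r / 2) <= 2 `^ (r / 2) * avg (fun t => `|F t| `^ r).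
Proof.
move=> T0 r2; set B := avg _; set u := avg _.
have r0 : 0 < r by exact: lt_le_trans r2.
have B0 : 0 <= B by apply: avg_ge0 => t; exact: sqr_ge0.
have u0 : 0 <= u by apply: avg_ge0 => t; exact: powR_ge0.
have [BE|Bn] := eqVneq B 0.
  rewrite BE powR0; first by rewrite mulr_ge0 ?powR_ge0.
  by rewrite gt_eqF // divr_gt0.
have Bp : 0 < B / 2 by rewrite divr_gt0 // lt_neqAle eq_sym Bn.
pose a := (B / 2) `^ 2^-1; have a0 : 0 < a by rewrite powR_gt0.
have a2 : a ^+ 2 = B / 2 by rewrite -powR_mulrn ?ltW // -powRrM mulVf // powRr1 // ltW.
have ar : a `^ r = (B / 2) `^ (r / 2) by rewrite -powRrM [2^-1 * _]mulrC.
have H : B <= a ^+ 2 + a `^ (2 - r) * u.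
  rewrite /u -avgZ -[X in X + _](avg_cst T0) -avgD; apply: ler_avg => t.
  rewrite -real_normK ?num_real // -!powR_mulrn ?(ltW a0) //.
  exact: powR_interp.
have {}H : a ^+ 2 <= a `^ (2 - r) * u by move: H; rewrite a2; lra.
have -> : B = 2 * (B / 2) by field.
rewrite powRM ?(ltW Bp) // ler_wpM2l ?powR_ge0 // -ar.
rewrite -(ler_pM2l (powR_gt0 (2 - r) a0)); apply: le_trans H.
by rewrite -powRDp // subrK powR_mulrn // ltW.
Qed.

Context {d m : nat}.
Local Notation delta := (d.+1%:R^-1 : R).
Local Notation O := {ffun 'I_m -> bool * 'I_d.+1}.
Implicit Types (x : 'I_m -> R) (w : O).

Lemma selsum0 x w : \sum_i x i ^+ 2 = 0 -> selsum x w = 0.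
Proof.
move=> /eqP; rewrite psumr_eq0 => [|i _]; last exact: sqr_ge0.
move=> /allP H; rewrite /selsum big1 // => i _.
have := H i (mem_index_enum _); rewrite /= sqrf_eq0 => /eqP ->.
by rewrite mulr0.
Qed.

(** The least admissible level in [rosenthal_aux] is taken; as a level must be positive, a vanishing
    square sum is treated apart. *)
Lemma rosenthal (t K : R) x : 0 <= t -> 1 <= K -> oddpow_lipschitz t K ->
  avg (fun w => `|selsum x w| `^ (t + 2)) <=
  4 * (K * 2 `^ t) * delta * \sum_i `|x i| `^ (t + 2) +
  (4 * (K * 2 `^ t) * delta * \sum_i x i ^+ 2) `^ ((t + 2) / 2).
Proof.
move=> t0 K1 lipK; set C := 4 * _ * _; set B := \sum_i x i ^+ 2.
have C0 : 0 < C.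
  by rewrite !mulr_gt0 ?powR_gt0 ?delta_gt0 // (lt_le_trans ltr01).
have B0 : 0 <= B by rewrite sumr_ge0 // => i _; exact: sqr_ge0.
have [BE|Bn] := eqVneq B 0.
  have -> : (fun w => `|selsum x w| `^ (t + 2)) = fun _ => 0.
    by apply/funext => w; rewrite selsum0 // normr0 powR0 // gt_eqF // ltr_wpDl.
  rewrite avg_cst ?card_O_gt0 // addr_ge0 ?powR_ge0 // mulr_ge0 ?(ltW C0) //.
  by rewrite sumr_ge0 // => i _; exact: powR_ge0.
have CB : 0 < C * B by rewrite mulr_gt0 // lt_neqAle eq_sym Bn.
have -> : (C * B) `^ ((t + 2) / 2) = ((C * B) `^ 2^-1) `^ (t + 2).
  by rewrite -powRrM [2^-1 * _]mulrC.
apply: rosenthal_aux => //; first by rewrite powR_gt0.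
by rewrite -/C -/B -powR_mulrn ?powR_ge0 // -powRrM mulVf // powRr1 // ltW.
Qed.

(** The type [r] inequality. With [a] the Euclidean norm of [x], truncation reduces to the second
    moment and leaves [2 a^r]. Since every [|x i|] is at most [a], [a^(r-2) |x i|^2 <= |x i|^r], and
    summation gives [a^r <= A]. *)
Lemma selsum_le2 (r : R) x : 0 < r -> r <= 2 ->
  avg (fun w => `|selsum x w| `^ r) <= 2 * \sum_i `|x i| `^ r.
Proof.
move=> r0 r2; set A := \sum_i _; set B := \sum_i x i ^+ 2.
have A0 : 0 <= A by rewrite sumr_ge0 // => i _; exact: powR_ge0.
have B0 : 0 <= B by rewrite sumr_ge0 // => i _; exact: sqr_ge0.
have [BE|Bn] := eqVneq B 0.
  have -> : (fun w => `|selsum x w| `^ r) = fun _ => 0.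
    by apply/funext => w; rewrite selsum0 // normr0 powR0 // gt_eqF // ltr_wpDl.
  by rewrite avg_cst ?card_O_gt0 // mulr_ge0.
have Bp : 0 < B by rewrite lt_neqAle eq_sym Bn.
pose a := B `^ 2^-1; have a0 : 0 < a by rewrite powR_gt0.
have a2 : a ^+ 2 = B by rewrite -powR_mulrn ?ltW // -powRrM mulVf // powRr1 // ltW.
have xa i : `|x i| <= a.
  rewrite -ler_sqr ?nnegrE ?(ltW a0) // real_normK ?num_real // a2 /B (bigD1 i) //=.
  by rewrite lerDl sumr_ge0 // => j _; exact: sqr_ge0.
have H1 : avg (fun w => `|selsum x w| `^ r) <= a `^ r + a `^ (r - 2) * B.
  apply: (@le_trans _ _ (a `^ r + a `^ (r - 2) * (delta * B))).
    have -> : B = \sum_i x i * x i by apply: eq_bigr => i _; rewrite expr2.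
    rewrite -(avg_selsum_mul d) -avgZ -[X in X + _](avg_cst (@card_O_gt0 d m)) -avgD.
    apply: ler_avg => w; rewrite -expr2 -real_normK ?num_real // -powR_mulrn //.
    by apply: powR_interp => //; exact: ltW.
  by rewrite lerD2l ler_wpM2l ?powR_ge0 // ler_piMl // delta_le1.
have H2 : a `^ (r - 2) * B <= A.
  have -> : A = a `^ (r - 2) * (a `^ (2 - r) * A).
    rewrite mulrA -powRD ?(gt_eqF a0) ?implybT //.
    by rewrite (_ : r - 2 + (2 - r) = 0) ?powRr0 ?mul1r //; ring.
  rewrite ler_wpM2l ?powR_ge0 // mulr_sumr; apply: ler_sum => i _.
  rewrite -real_normK ?num_real // -powR_mulrn // -{1}(subrK r 2).
  have [->|xi] := eqVneq `|x i| 0.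
    by rewrite subrK powR0 // mulr_ge0 ?powR_ge0.
  rewrite powRD ?xi ?implybT // ler_wpM2r ?powR_ge0 //.
  by apply: powR_le_mono => //; rewrite subr_ge0.
have H3 : a `^ r = a `^ (r - 2) * B.
  by rewrite -a2 -powR_mulrn ?(ltW a0) // -powRDp // subrK.
by move: H1; rewrite H3; lra.
Qed.

End moments.

Section selector_bound.
Context {R : realType}.

(* The coefficients with [`|c i| = c i ^+ 2] are those in {-1, 0, 1}. *)
Definition sign_bounded (m N : nat) (x : 'I_m -> nat -> R) (r t : R) :=
  forall c : 'I_m -> R, (forall i, `|c i| = c i ^+ 2) ->
  \sum_(k < N) `|\sum_i c i * x i k| `^ r <= (\sum_i `|c i|) `^ t.

Lemma sign_bounded_unit m N (x : 'I_m -> nat -> R) r t i :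
  sign_bounded N x r t -> \sum_(k < N) `|x i k| `^ r <= 1.
Proof.
move=> H; have := H (fun j => (j == i)%:R).
have -> : \sum_j `|(j == i)%:R : R| = 1.
  rewrite (bigD1 i) //= eqxx normr1 big1 ?addr0 // => j /negbTE ->.
  by rewrite normr0.
rewrite powR1; have E (k : 'I_N) : \sum_j (j == i)%:R * x j k = x i k.
  rewrite (bigD1 i) //= eqxx mul1r big1 ?addr0 // => j /negbTE ->.
  by rewrite mul0r.
under eq_bigr do rewrite E; apply => j.
by case: eqP; rewrite ?normr1 ?expr1n // normr0 expr0n.
Qed.

Lemma sum_sign_bounded m N (x : 'I_m -> nat -> R) r t :
  sign_bounded N x r t -> \sum_(k < N) \sum_i `|x i k| `^ r <= m%:R.
Proof.
move=> H; rewrite exchange_big /=.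
apply: (@le_trans _ _ (\sum_(i < m) 1)).
  by apply: ler_sum => i _; exact: sign_bounded_unit H.
by rewrite sumr_const card_ord.
Qed.

Lemma powR_growth (a b K eta : R) : a < b -> 0 < eta ->
  exists l0, forall l : nat, (l0 <= l)%N -> (0 < l)%N ->
    K * l%:R `^ a <= eta * l%:R `^ b.
Proof.
move=> ab e0; have ba : 0 < b - a by rewrite subr_gt0.
(* The point at which the two sides, with [K] replaced by its absolute value, are equal. *)
pose z := (`|K| / eta) `^ (b - a)^-1.
exists `|Num.ceil z|%N => l lz l0.
have lp : 0 < l%:R :> R by rewrite ltr0n.
have zl : z <= l%:R.
  rewrite (le_trans (Num.Theory.ceil_ge _)) // (le_trans (ler_norm _)) //.
  by rewrite -intr_norm -natr_absz ler_nat.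
have H : `|K| / eta <= l%:R `^ (b - a).
  have -> : `|K| / eta = z `^ (b - a).
    by rewrite -powRrM mulVf ?gt_eqF // powRr1 // divr_ge0 // ltW.
  by apply: powR_le_mono => //; [exact: ltW|exact: powR_ge0].
rewrite -(subrK a b) (@powRD _ l%:R (b - a) a) ?(gt_eqF lp) ?implybT // mulrA.
rewrite ler_wpM2r ?powR_ge0 // (le_trans (ler_norm _)) //.
by rewrite -ler_pdivrMl // mulrC.
Qed.

Context (s r : R) (s1 : 1 < s) (sr : s < r) (s2 : s != 2).

(** On average [l] of the [l * d.+1] indices are selected, so [sign_bounded] alone suggests the size
    [l^(r/s)]. The gain is the arbitrarily small factor [eta], with [d] and [l] independent of [N]
    and [x]. *)
Lemma selector_bound (eta : R) : 0 < eta -> exists d l : nat, (0 < l)%N /\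
  forall N (x : 'I_(l * d.+1) -> nat -> R), sign_bounded N x r (r / s) ->
  avg (fun w : {ffun 'I_(l * d.+1) -> bool * 'I_d.+1} =>
    \sum_(k < N) `|selsum (fun i => x i k) w| `^ r) <= eta * l%:R `^ (r / s).
Proof.
move=> e0; have s0 : 0 < s by exact: lt_trans s1.
have r0 : 0 < r by exact: lt_trans sr.
have rs1 : 1 < r / s by rewrite ltr_pdivlMr // mul1r.
(* For [r <= 2], full signs suffice: the type inequality gives a bound linear in [l], and
   [r / s > 1]. *)
have [r2|r2] := leP r 2.
  have [l0 Hl] := powR_growth 2 rs1 e0.
  exists 0%N, (maxn l0 1); split=> [|N x xb]; first by rewrite leq_max orbT.
  rewrite avg_sum; apply: le_trans (Hl _ (leq_maxl _ _) _); last first.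
    by rewrite leq_max orbT.
  have := sum_sign_bounded xb; rewrite powRr1 // => H.
  have -> : (maxn l0 1)%:R = (maxn l0 1 * 1)%:R :> R by rewrite muln1.
  apply: le_trans (ler_wpM2l (ler0n _ 2) H); rewrite mulr_sumr.
  by apply: ler_sum => k _; exact: selsum_le2.
pose t := r - 2; have t0 : 0 <= t by rewrite subr_ge0 ltW.
have rE : r = t + 2 by rewrite subrK.
have [K0 K01 lipK] := oddpow_lip t0.
pose K : R := 4 * (K0 * 2 `^ t).
have Kp : 0 < K by rewrite !mulr_gt0 ?powR_gt0 // (lt_le_trans ltr01).
have main d m N (x : 'I_m -> nat -> R) : sign_bounded N x r (r / s) ->
  avg (fun w : {ffun 'I_m -> bool * 'I_d.+1} =>
    \sum_(k < N) `|selsum (fun i => x i k) w| `^ r) <=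
  K * (m%:R / d.+1%:R) +
  (K / d.+1%:R) `^ (r / 2) * \sum_(k < N) (\sum_i x i k ^+ 2) `^ (r / 2).
  move=> xb; have D0 : 0 <= K / d.+1%:R by rewrite divr_ge0 // ltW.
  have -> : K * (m%:R / d.+1%:R) = K / d.+1%:R * m%:R by ring.
  apply: le_trans (lerD (ler_wpM2l D0 (sum_sign_bounded xb)) (lexx _)).
  rewrite avg_sum !mulr_sumr -big_split /=; apply: ler_sum => k _.
  rewrite -powRM //; last by rewrite sumr_ge0 // => i _; exact: sqr_ge0.
  rewrite {1 2 3}rE; exact: rosenthal.
(* For [s < 2 < r], full signs still suffice: the two Rosenthal terms have orders [l] and [l^(r/2)],
   both below [l^(r/s)]. *)
have [ss2|ss2] := ltP s 2.
  have rs2 : r / 2 < r / s by rewrite ltr_pM2l // ltf_pV2 ?posrE.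
  have e2 : 0 < eta / 2 by rewrite divr_gt0.
  have [l1 Hl1] := powR_growth K rs1 e2.
  have [l2 Hl2] := powR_growth (K `^ (r / 2) * 2 `^ (r / 2)) rs2 e2.
  pose l := maxn (maxn l1 l2) 1; have l0 : (0 < l)%N by rewrite leq_max orbT.
  have lE : (l * 1)%:R = l%:R :> R by rewrite muln1.
  exists 0%N, l; split=> // N x xb; rewrite (le_trans (main 0%N _ _ _ xb)) //.
  have -> : eta = eta / 2 + eta / 2 by field.
  rewrite mulrDl; apply: lerD.
    rewrite lE divr1 -[X in K * X]powRr1 //; apply: Hl1 => //.
    by rewrite !leq_max leqnn.
  apply: le_trans (Hl2 _ _ l0); last by rewrite !leq_max leqnn orbT.
  rewrite divr1 -mulrA ler_wpM2l ?powR_ge0 //.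
  have lR : 0 < l%:R :> R by rewrite ltr0n.
  (* The power mean inequality over the [l] indices, read off from [avg_sqr_powR] on the
     ordinals. *)
  have H k : (\sum_(i < l * 1) x i k ^+ 2) `^ (r / 2) <=
      2 `^ (r / 2) * l%:R `^ (r / 2 - 1) * \sum_i `|x i k| `^ r.
    have := @avg_sqr_powR R 'I_(l * 1) (x ^~ k) r; rewrite /avg card_ord lE.
    have l10 : (0 < l * 1)%N by rewrite muln1.
    move=> /(_ l10 (ltW r2)).
    rewrite powRM ?invr_ge0 //; last by rewrite sumr_ge0 // => i _; exact: sqr_ge0.
    rewrite powR_invl // ler_pdivrMr ?powR_gt0 //.
    move=> /le_trans; apply; rewrite powRB ?(gt_eqF lR) ?implybT //.
    by rewrite powRr1 // le_eqVlt; apply/orP; left; apply/eqP; ring.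
  apply: (le_trans (ler_sum _ (fun (k : 'I_N) _ => H k))).
  rewrite -mulr_sumr -mulrA ler_wpM2l ?powR_ge0 //.
  apply: le_trans (ler_wpM2l (powR_ge0 _ _) (sum_sign_bounded xb)) _.
  by rewrite lE mulrC -{1}(powRr1 (ltW lR)) -powRDp // addrC subrK.
have {}ss2 : 2 < s by rewrite lt_neqAle eq_sym s2.
have rs2 : r / s < r / 2 by rewrite ltr_pM2l // ltf_pV2 ?posrE.
have e2 : 0 < eta / 2 by rewrite divr_gt0.
(* For [s > 2], a large [d] makes the square function term small against [l^(r/s)] for every [l],
   and a large [l] then takes care of the linear term [K * l]. *)
have [d0 Hd] := powR_growth (K `^ (r / 2) * 2 `^ (r / 2)) rs2 e2.
have [l1 Hl1] := powR_growth K rs1 e2.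
pose l := maxn l1 1; have l0 : (0 < l)%N by rewrite leq_max orbT.
have lR : 0 < l%:R :> R by rewrite ltr0n.
exists d0, l; split=> // N x xb; rewrite (le_trans (main d0 _ _ _ xb)) //.
have D0 : 0 < d0.+1%:R :> R by [].
have -> : eta = eta / 2 + eta / 2 by field.
rewrite mulrDl; apply: lerD.
  rewrite natrM mulfK ?gt_eqF // -[X in K * X]powRr1 //; apply: Hl1 => //.
  by rewrite !leq_max leqnn.
set m := (l * d0.+1)%N in x xb *.
(* The lower Khintchine inequality: the square function is dominated by the moments of the full sign
   sums ([d = 0], variance 1), and [sign_bounded] applies to each choice of signs. *)
have H : \sum_(k < N) (\sum_(i < m) x i k ^+ 2) `^ (r / 2) <=
    2 `^ (r / 2) * m%:R `^ (r / s).
  pose W k (w : {ffun 'I_m -> bool * 'I_1}) := selsum (x ^~ k) w.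
  have Hk k : (\sum_(i < m) x i k ^+ 2) `^ (r / 2) <=
      2 `^ (r / 2) * avg (fun w => `|W k w| `^ r).
    have := @avg_sqr_powR R _ (W k) r (@card_O_gt0 0 m) (ltW r2).
    have -> : avg (fun w => W k w ^+ 2) = \sum_(i < m) x i k ^+ 2.
      have := @avg_selsum_mul R 0 m (x ^~ k) (x ^~ k).
      by rewrite invr1 mul1r => <-.
    by [].
  apply: (le_trans (ler_sum _ (fun (k : 'I_N) _ => Hk k))).
  rewrite -mulr_sumr ler_wpM2l ?powR_ge0 // -avg_sum.
  rewrite -[leRHS](avg_cst (@card_O_gt0 0 m)); apply: ler_avg => w.
  apply: le_trans (xb (fun i => sel (w i)) _) _ => [i|].
    by rewrite norm_sel.
  apply: powR_le_mono; first by rewrite divr_ge0 // ltW.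
    by rewrite sumr_ge0.
  rewrite -[m in leRHS]card_ord -sumr_const; apply: ler_sum => i _.
  by rewrite /sel; case: ifP => _; rewrite ?normr_sign // normr0.
apply: (le_trans (ler_wpM2l (powR_ge0 _ _) H)); rewrite mulrA.
rewrite powRM ?invr_ge0 ?(ltW Kp) // natrM powRM // powR_invl //.
have := Hd d0.+1 (leqnSn _) (ltn0Sn _).
rewrite -ler_pdivrMr ?powR_gt0 // => Hd'.
apply: le_trans (ler_wpM2r (powR_ge0 l%:R (r / s)) Hd').
by rewrite le_eqVlt; apply/orP; left; apply/eqP; ring.
Qed.

End selector_bound.

(** * Traces of finite matrices *)

Section finite_trace.
Context {R : realType}.

Lemma avg_sel_norm (d m : nat) (i : 'I_m) :
  avg (fun w : {ffun 'I_m -> bool * 'I_d.+1} => `|sel (w i)| : R) = d.+1%:R^-1.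
Proof.
rewrite (avg_resample (card_sel_gt0 d) i) -[RHS](avg_cst (@card_O_gt0 d m)).
congr (_ / _); apply: eq_bigr => w _.
under [X in avg X]eq_fun do rewrite ffunE eqxx.
rewrite (avg_sel d (fun z => `|z|)) normr0 mulr0 addr0 normrN normr1.
by rewrite divff ?mulr1.
Qed.

(** Young's inequality for [a / z] and [z * b] with [z = c^(1/r')], the factors [1/r] and [1/r']
    being dropped. The exponent of [c] comes from [r / r' = r - 1]. *)
Lemma young_scaled (a b c r r' : R) : 0 <= a -> 0 <= b -> 0 < c -> 1 < r -> 1 < r' ->
  r^-1 + r'^-1 = 1 -> a * b <= c `^ (- (r - 1)) * a `^ r + c * b `^ r'.
Proof.
move=> a0 b0 c0 r1 r'1 rr; have r0 := lt_trans ltr01 r1.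
have r'0 := lt_trans ltr01 r'1.
pose z := c `^ r'^-1; have z0 : 0 < z by rewrite powR_gt0.
have -> : a * b = (z^-1 * a) * (z * b) by rewrite mulrACA mulVf ?mul1r // gt_eqF.
have z1 : 0 <= z^-1 * a by rewrite mulr_ge0 // invr_ge0 ltW.
have z2 : 0 <= z * b by rewrite mulr_ge0 // ltW.
apply: (le_trans (conjugate_powR z1 z2 r0 r'0 rr)); apply: lerD.
  rewrite powRM ?invr_ge0 ?(ltW z0) // ler_pdivrMr //.
  have -> : z^-1 `^ r = c `^ (- (r - 1)).
    rewrite -powR_inv1 ?(ltW z0) // -!powRrM; congr (_ `^ _).
    have -> : r'^-1 = 1 - r^-1 by rewrite -rr addrAC subrr add0r.
    by field; rewrite gt_eqF.
  by rewrite ler_peMr ?mulr_ge0 ?powR_ge0 // ltW.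
rewrite powRM ?(ltW z0) // -powRrM mulVf ?gt_eqF // powRr1 ?(ltW c0) //.
by rewrite ler_pdivrMr // ler_peMr ?mulr_ge0 ?powR_ge0 ?(ltW c0) // ltW.
Qed.

(** The average of the pairings of the random sums [W] and [Z] is the trace times the density.
    Young's inequality splits each pairing: the [r]-th powers of [W] are small by [selector_bound],
    and those of [Z] are bounded by [sign_bounded] alone. *)
Lemma finite_trace_lt (s r s' r' e : R) : 1 < s -> s < r -> s != 2 -> 1 < s' -> 1 < r' ->
  s^-1 + s'^-1 = 1 -> r^-1 + r'^-1 = 1 -> 0 < e ->
  exists2 m : nat, (0 < m)%N & forall N (x y : 'I_m -> nat -> R),
  sign_bounded N x r (r / s) -> sign_bounded N y r' (r' / s') ->
  `|\sum_i \sum_(k < N) x i k * y i k| <= e * m%:R.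
Proof.
move=> s1 sr s2 s'1 r'1 ss rr e0; have r1 := lt_trans s1 sr.
have s0 := lt_trans ltr01 s1; have r0 := lt_trans ltr01 r1.
have s'0 := lt_trans ltr01 s'1; have r'0 := lt_trans ltr01 r'1.
have e4 : 0 < e / 4 by rewrite divr_gt0.
(* This [eta] cancels the power [(e / 4)^(- (r - 1))] that the weight [c] below creates in front of
   the moments of [W]. *)
have eta0 : 0 < (e / 2) * (e / 4) `^ (r - 1) by rewrite mulr_gt0 ?powR_gt0 // divr_gt0.
have [d [l [l0 HU]]] := selector_bound s1 sr s2 eta0.
exists (l * d.+1)%N; first by rewrite muln_gt0 l0.
set m := (l * d.+1)%N in HU *; move=> N x y xb yb.
have lR : 0 < l%:R :> R by rewrite ltr0n.
have dR : 0 < d.+1%:R^-1 :> R by rewrite invr_gt0.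
have mE : l%:R = d.+1%:R^-1 * m%:R :> R by rewrite natrM mulrC mulfK.
pose O := {ffun 'I_m -> bool * 'I_d.+1}.
pose W k (w : O) := selsum (x ^~ k) w; pose Z k (w : O) := selsum (y ^~ k) w.
pose n (w : O) : R := \sum_i `|sel (w i)|.
(* Conjugation reverses [s < r]. With an exponent at most 1, the average of [n w ^ (r' / s')] is
   controlled by the mean [l] of [n]. *)
have t1 : r' / s' <= 1.
  rewrite ler_pdivrMr // mul1r -lef_pV2 ?posrE //.
  have -> : r'^-1 = 1 - r^-1 by rewrite -rr addrAC subrr add0r.
  have -> : s'^-1 = 1 - s^-1 by rewrite -ss addrAC subrr add0r.
  by rewrite lerD2l lerN2 lef_pV2 ?posrE // ltW.
have Zb w : \sum_(k < N) `|Z k w| `^ r' <= n w `^ (r' / s').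
  by apply: yb => i; exact: norm_sel.
have nb w : n w `^ (r' / s') <=
    l%:R `^ (r' / s') + l%:R `^ (r' / s' - 1) * n w.
  have n0 : 0 <= n w by rewrite sumr_ge0.
  rewrite -[n w in leRHS]powRr1 //; apply: powR_interp => //.
  by rewrite divr_ge0 // ltW.
have An : avg n = l%:R.
  rewrite avg_sum (eq_bigr _ (fun i _ => avg_sel_norm d i)) sumr_const card_ord.
  by rewrite mE mulr_natr.
(* The [Z] part is [c] times twice [l^(r'/s')], so this weight makes it [(e / 2) * l]. The [W] part
   then matches because [(1 - r'/s') (r - 1) = r/s - 1]. *)
pose c : R := e / 4 * l%:R `^ (1 - r' / s').
have c0 : 0 < c by rewrite mulr_gt0 // powR_gt0.
have P1 w : `|\sum_(k < N) W k w * Z k w| <=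
    c `^ (- (r - 1)) * \sum_(k < N) `|W k w| `^ r +
    c * (l%:R `^ (r' / s') + l%:R `^ (r' / s' - 1) * n w).
  apply: (@le_trans _ _ (c `^ (- (r - 1)) * \sum_(k < N) `|W k w| `^ r +
      c * \sum_(k < N) `|Z k w| `^ r')).
    rewrite !mulr_sumr -big_split /= (le_trans (ler_norm_sum _ _ _)) //.
    by apply: ler_sum => k _; rewrite normrM; exact: young_scaled.
  by rewrite lerD2l ler_wpM2l ?(ltW c0) // (le_trans (Zb w)).
have T : avg (fun w : O => \sum_(k < N) W k w * Z k w) =
    d.+1%:R^-1 * \sum_i \sum_(k < N) x i k * y i k.
  rewrite avg_sum exchange_big mulr_sumr; apply: eq_bigr => k _.
  exact: avg_selsum_mul.
rewrite -(ler_pM2l dR) -{1}(gtr0_norm dR) -normrM -T (le_trans (ler_norm_avg _)) //.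
apply: le_trans (ler_avg P1) _; rewrite avgD !avgZ avgD avgZ avg_cst ?card_O_gt0 //.
rewrite An -[X in X `^ _ * X]/(l%:R : R).
have -> : d.+1%:R^-1 * (e * m%:R) = e / 2 * l%:R + e / 2 * l%:R.
  by rewrite mE; field; rewrite ?nat1r ?pnatr_eq0.
apply: lerD.
  apply: le_trans (ler_wpM2l (powR_ge0 _ _) (HU N x xb)) _.
  rewrite /c powRM ?powR_ge0 ?(ltW e4) // -powRrM.
  have -> : (1 - r' / s') * - (r - 1) = 1 - r / s.
    have -> : s'^-1 = 1 - s^-1 by rewrite -ss addrAC subrr add0r.
    have -> : r' = (1 - r^-1)^-1 by rewrite -rr addrAC subrr add0r invrK.
    by field; rewrite ?gt_eqF ?subr_gt0 //.
  rewrite powRN; set E := (e / 4) `^ (r - 1).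
  have En : E != 0 by rewrite gt_eqF // powR_gt0.
  have -> : E^-1 * l%:R `^ (1 - r / s) * (e / 2 * E * l%:R `^ (r / s)) =
    (e / 2) * (l%:R `^ (1 - r / s) * l%:R `^ (r / s)) by field.
  by rewrite -powRDp // subrK powRr1 // ltW.
rewrite -{3}[l%:R](powRr1 (ltW lR)) -powRDp // subrK.
have -> : c * (l%:R `^ (r' / s') + l%:R `^ (r' / s')) =
  e / 2 * (l%:R `^ (1 - r' / s') * l%:R `^ (r' / s')) by rewrite /c; field.
by rewrite -powRDp // subrK powRr1 // ltW.
Qed.

Lemma finite_trace (s r s' r' e : R) : 1 < s -> 1 < r -> s != r -> s != 2 ->
  1 < s' -> 1 < r' -> s^-1 + s'^-1 = 1 -> r^-1 + r'^-1 = 1 -> 0 < e ->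
  exists2 m : nat, (0 < m)%N & forall N (x y : 'I_m -> nat -> R),
  sign_bounded N x r (r / s) -> sign_bounded N y r' (r' / s') ->
  `|\sum_i \sum_(k < N) x i k * y i k| <= e * m%:R.
Proof.
move=> s1 r1 sr s2 s'1 r'1 ss rr e0.
have s0 := lt_trans ltr01 s1; have r0 := lt_trans ltr01 r1.
have s'0 := lt_trans ltr01 s'1; have r'0 := lt_trans ltr01 r'1.
move: sr; rewrite neq_lt => /orP[sr|rs]; first exact: finite_trace_lt ss rr e0.
have sr' : s' < r'.
  rewrite -ltf_pV2 ?posrE //.
  have -> : r'^-1 = 1 - r^-1 by rewrite -rr addrAC subrr add0r.
  have -> : s'^-1 = 1 - s^-1 by rewrite -ss addrAC subrr add0r.
  by rewrite ltrD2l ltrN2 ltf_pV2 ?posrE.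
have s'2 : s' != 2.
  apply: contraNneq s2 => s'2; apply/eqP/invr_inj; move: ss; rewrite s'2; lra.
have ss' : s'^-1 + s^-1 = 1 by rewrite addrC.
have rr' : r'^-1 + r^-1 = 1 by rewrite addrC.
have [m m0 H] := finite_trace_lt s'1 sr' s'2 s1 r1 ss' rr' e0.
exists m => // N x y xb yb; have := H N y x yb xb.
by under eq_bigr do under eq_bigr do rewrite mulrC.
Qed.

End finite_trace.

(** * Duality and traces on l^p *)

Section hoelder_sums.
Context {R : realType}.
Implicit Types p q : R.

Lemma hoelder_sum (I : finType) (f g : I -> R) p q : 0 < p -> 0 < q ->
  p^-1 + q^-1 = 1 -> (forall i, 0 <= f i) -> (forall i, 0 <= g i) ->
  \sum_i f i * g i <=
  (\sum_i f i `^ p) `^ p^-1 * (\sum_i g i `^ q) `^ q^-1.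
Proof.
move=> p0 q0 pq f0 g0; set A := \sum_i f i `^ p; set B := \sum_i g i `^ q.
have A0 : 0 <= A by rewrite sumr_ge0 // => i _; exact: powR_ge0.
have B0 : 0 <= B by rewrite sumr_ge0 // => i _; exact: powR_ge0.
have sum0 (h : I -> R) t : 0 < t -> \sum_i h i `^ t = 0 -> forall i, h i = 0.
  move=> t0 /eqP; rewrite psumr_eq0 => [|i _]; last exact: powR_ge0.
  move=> /allP H i; apply/(@powR_eq0_eq0 _ _ t)/eqP.
  exact: H (mem_index_enum _).
have [AE|An] := eqVneq A 0.
  rewrite big1 ?mulr_ge0 ?powR_ge0 // => i _.
  by rewrite (sum0 _ _ p0 AE) mul0r.
have [BE|Bn] := eqVneq B 0.
  rewrite big1 ?mulr_ge0 ?powR_ge0 // => i _.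
  by rewrite (sum0 _ _ q0 BE) mulr0.
pose a := A `^ p^-1; pose b := B `^ q^-1.
have a0 : 0 < a by rewrite powR_gt0 // lt_neqAle eq_sym An.
have b0 : 0 < b by rewrite powR_gt0 // lt_neqAle eq_sym Bn.
have aE : a `^ p = A by rewrite -powRrM mulVf ?powRr1 // gt_eqF.
have bE : b `^ q = B by rewrite -powRrM mulVf ?powRr1 // gt_eqF.
have -> : A `^ p^-1 * B `^ q^-1 = a * b by [].
clearbody a b; rewrite -[leRHS]mul1r -ler_pdivrMr ?mulr_gt0 //.
rewrite mulr_suml; apply: (@le_trans _ _ (\sum_i (f i `^ p / A / p + g i `^ q / B / q))).
  apply: ler_sum => i _.
  have -> : f i * g i / (a * b) = (f i / a) * (g i / b) by rewrite invfM mulrACA.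
  have H1 : 0 <= f i / a by rewrite divr_ge0 // ltW.
  have H2 : 0 <= g i / b by rewrite divr_ge0 // ltW.
  rewrite (le_trans (conjugate_powR H1 H2 p0 q0 pq)) //.
  rewrite !powRM ?invr_ge0 ?(ltW a0) ?(ltW b0) //.
  by rewrite !powR_invl ?(ltW a0) ?(ltW b0) // aE bE.
rewrite big_split /= -!mulr_suml (divff An) (divff Bn) !mul1r pq //.
Qed.

Lemma rnormM (a b : R[i]) : rnorm (a * b) = rnorm a * rnorm b.
Proof. exact: (rnormZ a (b : R[i])). Qed.

Lemma rnorm1 : rnorm (1 : R[i]) = 1.
Proof. by rewrite -[1]/(1%:C) rnorm_real normr1. Qed.

Lemma rnormV (a : R[i]) : rnorm a^-1 = (rnorm a)^-1.
Proof.
have [->|a0] := eqVneq a 0; first by rewrite invr0 rnorm0 invr0.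
have an : rnorm a != 0 by apply: contra a0 => /eqP/rnorm0_eq0 ->.
by apply: (mulfI an); rewrite -rnormM !divff // rnorm1.
Qed.

Lemma rnorm_sum (V : normedModType R[i]) (I : Type) (s : seq I) (P : pred I)
    (F : I -> V) : rnorm (\sum_(i <- s | P i) F i) <= \sum_(i <- s | P i) rnorm (F i).
Proof.
elim/big_rec2: _ => [|i y1 y2 _ H]; first by rewrite rnorm0.
by rewrite (le_trans (rnormD _ _)) // lerD2l.
Qed.

(** Testing on the vector extremal for Hölder's inequality gives [A <= K * A^(1/p)], hence
    [A^(1/q) <= K]. *)
Lemma dual_sum N (c : nat -> R[i]) (K : R) p q : 0 <= K -> 0 < p -> 0 < q ->
  p^-1 + q^-1 = 1 ->
  (forall v : nat -> R[i], rnorm (\sum_(k < N) v k * c k) <=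
     K * (\sum_(k < N) rnorm (v k) `^ p) `^ p^-1) ->
  \sum_(k < N) rnorm (c k) `^ q <= K `^ q.
Proof.
move=> K0 p0 q0 pq H; set A := \sum_(k < N) _.
have A0 : 0 <= A by rewrite sumr_ge0 // => i _; exact: powR_ge0.
have [->|An] := eqVneq A 0; first exact: powR_ge0.
have Ap : 0 < A by rewrite lt_neqAle eq_sym An.
have q1 : q - 1 = q / p.
  have -> : p^-1 = 1 - q^-1 by rewrite -pq addrK.
  by rewrite mulrBr mulr1 divff // gt_eqF.
have qn0 : q != 0 by rewrite gt_eqF.
(* At a zero entry the quotient is 0, so such entries contribute to neither side. *)
have := H (fun k => (rnorm (c k) `^ q)%:C / c k).
have -> : \sum_(k < N) (rnorm (c k) `^ q)%:C / c k * c k = A%:C.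
  rewrite rmorph_sum; apply: eq_bigr => k _.
  have [->|ck] := eqVneq (c k) 0; first by rewrite rnorm0 powR0 // mulr0.
  by rewrite mulfVK.
rewrite rnorm_real ger0_norm //.
have -> : \sum_(k < N) rnorm ((rnorm (c k) `^ q)%:C / c k) `^ p = A.
  apply: eq_bigr => k _; rewrite rnormM rnorm_real ger0_norm ?powR_ge0 // rnormV.
  have [->|ck] := eqVneq (rnorm (c k)) 0.
    by rewrite powR0 // mul0r !powR0 // gt_eqF.
  rewrite -{2}[rnorm (c k)]powRr1 ?rnorm_ge0 // -powRB ?ck ?implybT //.
  by rewrite -powRrM q1 mulfVK // gt_eqF.
have AE : A = A `^ q^-1 * A `^ p^-1 by rewrite -powRDp // addrC pq powRr1.
rewrite {1}AE ler_pM2r ?powR_gt0 // => HK.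
have -> : A = (A `^ q^-1) `^ q by rewrite -powRrM mulVf // powRr1.
by apply: powR_le_mono => //; [exact: ltW|exact: powR_ge0].
Qed.

End hoelder_sums.

Section bounded_operators.
Context {R : realType}.

Lemma bop_predP (E F : normedModType R[i]) (f : E -> F) (M : R) : linear f ->
  (forall x, rnorm (f x) <= M * rnorm x) -> f \in bop_pred E F.
Proof. by move=> fl fM; rewrite inE; split => //; exists M. Qed.

Definition mkbop (E F : normedModType R[i]) (f : E -> F) (M : R) (fl : linear f)
  (fM : forall x, rnorm (f x) <= M * rnorm x) : bop E F := Bop (bop_predP fl fM).

Lemma bop_sum (E F : normedModType R[i]) (T : bop E F) (I : Type) (s : seq I)
    (P : pred I) (x : I -> E) :
  T (\sum_(i <- s | P i) x i) = \sum_(i <- s | P i) T (x i).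
Proof.
elim/big_rec2: _ => [|i y1 y2 _ <-]; first exact: bop0.
by rewrite bopDx.
Qed.

Lemma bopBx (E F : normedModType R[i]) (T : bop E F) x y : T (x - y) = T x - T y.
Proof. by rewrite bopDx -[- y]scaleN1r bopZx scaleN1r. Qed.

Lemma le_rnorm_bop (E F : normedModType R[i]) (T : bop E F) (M : R) x :
  rnorm T <= M -> rnorm (T x) <= M * rnorm x.
Proof.
by move=> TM; rewrite (le_trans (le_opnorm _ _)) // ler_wpM2r ?rnorm_ge0.
Qed.

Lemma rnorm_bop_le_ball (E F : normedModType R[i]) (T : bop E F) (M : R) :
  (forall x, rnorm x <= 1 -> rnorm (T x) <= M) -> rnorm T <= M.
Proof.
move=> TM; rewrite rnorm_bop; apply: ge_sup.
  by exists (rnorm (T 0)); exists 0 => //=; rewrite rnorm0.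
by move=> _ [x /= x1 <-]; exact: TM.
Qed.

Lemma bop_scompP (E F G : normedModType R[i]) (S : bop F G) (T : bop E F) :
  (fun x => S (T x)) \in bop_pred E G.
Proof.
apply: (@bop_predP _ _ _ (rnorm S * rnorm T)) => [c x y|x]; first by rewrite !bopDx !bopZx.
rewrite (le_trans (le_opnorm _ _)) // -mulrA ler_wpM2l ?opnorm_ge0 //.
exact: le_opnorm.
Qed.

Definition bop_scomp (E F G : normedModType R[i]) (S : bop F G) (T : bop E F) :
  bop E G := Bop (bop_scompP S T).

Lemma rnorm_scomp (E F G : normedModType R[i]) (S : bop F G) (T : bop E F) :
  rnorm (bop_scomp S T) <= rnorm S * rnorm T.
Proof.
apply: opnorm_le => [|x]; first by rewrite mulr_ge0 ?rnorm_ge0.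
apply: le_trans (le_opnorm S (T x)) _; rewrite -mulrA ler_wpM2l ?opnorm_ge0 //.
exact: le_opnorm.
Qed.

(* The bound on the representing point would follow from Hahn-Banach; having it
   in the definition costs nothing for the spaces at hand. *)
Definition reflexive_space (E : normedModType R[i]) := exists2 K : R, 0 <= K &
  forall G : bop (bop E R[i]) R[i],
  exists2 x : E, (forall g, G g = g x) & rnorm x <= K * rnorm G.

End bounded_operators.

Section lp_theory.
Context {R : realType} (p : R) (p1 : 1 <= p).
Implicit Types (x : lp p1) (v : nat -> R[i]) (N : nat).

Let p0 : 0 < p. Proof. exact: lt_le_trans p1. Qed.

Lemma lp_sum_le x N : \sum_(k < N) rnorm (x k) `^ p <= rnorm x `^ p.
Proof. by have := lp_partial p1 N (lpP x); rewrite big_mkord. Qed.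

Lemma lp_coord_le x k : rnorm (x k) <= rnorm x.
Proof. exact: lp_coord (lpP x). Qed.

Lemma lp_of_bounded v (r : R) : 0 <= r ->
  (forall N, \sum_(k < N) rnorm (v k) `^ p <= r `^ p) ->
  exists2 x : lp p1, (forall k, x k = v k) & rnorm x <= r.
Proof.
move=> r0 H; have [|voo vr] := @lp_norm_le R p p1 v r r0.
  by move=> N; rewrite big_mkord.
have vP : v \in lp_pred p by rewrite inE.
by exists (Lp p1 vP).
Qed.

Lemma lp_ext (x y : lp p1) : (forall k, x k = y k) -> x = y.
Proof. by move=> xy; apply: val_inj; apply: funext. Qed.

Definition trunc N v : nat -> R[i] := fun k => if (k < N)%N then v k else 0.

Lemma trunc_sum N v n : \sum_(k < n) rnorm (trunc N v k) `^ p <=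
  \sum_(k < N) rnorm (v k) `^ p.
Proof.
rewrite -!(big_mkord xpredT (fun k => rnorm (_ k) `^ p)).
have [nN|Nn] := leqP n N.
  rewrite [leRHS](big_cat_nat (n := n)) //= -[leLHS]addr0 lerD //; last first.
    by rewrite sumr_ge0 // => k _; exact: powR_ge0.
  rewrite !big_nat; apply: ler_sum => k /andP[_ kn].
  by rewrite /trunc (leq_trans kn).
rewrite (big_cat_nat (n := N)) //=; last exact: ltnW.
rewrite [X in _ + X]big_nat [X in _ + X]big1 ?addr0; last first.
  by move=> k /andP[Nk _]; rewrite /trunc ltnNge Nk /= rnorm0 powR0 // gt_eqF.
by rewrite !big_nat; apply: ler_sum => k /andP[_ kN]; rewrite /trunc kN.
Qed.

Lemma truncP N v : trunc N v \in lp_pred p.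
Proof.
rewrite inE /=.
have [|n|] := @lp_norm_le R p p1 (trunc N v) ((\sum_(k < N) rnorm (v k) `^ p) `^ p^-1).
- exact: powR_ge0.
- rewrite big_mkord powR_rootK ?trunc_sum //.
  by rewrite sumr_ge0 // => k _; exact: powR_ge0.
- by [].
Qed.

Definition lp_fin N v : lp p1 := Lp p1 (truncP N v).

Lemma lp_finE N v k : lp_fin N v k = if (k < N)%N then v k else 0.
Proof. by []. Qed.

Lemma rnorm_lp_fin N v : rnorm (lp_fin N v) <= (\sum_(k < N) rnorm (v k) `^ p) `^ p^-1.
Proof.
rewrite rnorm_lp.
have [|n|_] := @lp_norm_le R p p1 (trunc N v) ((\sum_(k < N) rnorm (v k) `^ p) `^ p^-1).
- exact: powR_ge0.
- rewrite big_mkord powR_rootK ?trunc_sum //.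
  by rewrite sumr_ge0 // => k _; exact: powR_ge0.
- by [].
Qed.

Definition lp_unit k : lp p1 := lp_fin k.+1 (fun j => (j == k)%:R).

Lemma lp_unitE k j : lp_unit k j = (j == k)%:R.
Proof. by rewrite lp_finE ltnS; case: eqP => [->|_]; rewrite ?leqnn ?if_same. Qed.

Lemma lp_fin_sum N v : lp_fin N v = \sum_(k < N) v k *: lp_unit k.
Proof.
apply: lp_ext => j.
have E (f : 'I_N -> lp p1) : (\sum_k f k) j = \sum_k f k j.
  by elim/big_rec2: _ => [//|k y1 y2 _ <-].
rewrite E lp_finE; under eq_bigr do rewrite lpZ lp_unitE.
have [jN|Nj] := ltnP j N.
  rewrite (bigD1 (Ordinal jN)) //= eqxx mulr1 big1 ?addr0 // => k.
  by rewrite -val_eqE /= eq_sym => /negbTE ->; rewrite mulr0.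
rewrite big1 // => k _; case: eqP => [jk|_]; last by rewrite mulr0.
by have := ltn_ord k; rewrite -jk ltnNge Nj.
Qed.

Lemma lp_fin_approx x (e : R) : 0 < e ->
  exists N0, forall N, (N0 <= N)%N -> rnorm (x - lp_fin N x) <= e.
Proof.
move=> e0; pose S N := \sum_(k < N) rnorm (x k) `^ p.
have Sx N : S N <= rnorm x `^ p by exact: lp_sum_le.
have Smono M N : (M <= N)%N -> S M <= S N.
  move=> MN; rewrite /S -!(big_mkord xpredT (fun k => rnorm (_ k) `^ p)).
  rewrite [leRHS](big_cat_nat (n := M)) //= lerDl.
  by rewrite sumr_ge0 // => k _; exact: powR_ge0.
(* If every partial sum stayed below [rnorm x ^ p - e ^ p], [lp_of_bounded] would rebuild [x] with a
   norm smaller than its own. *)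
have [N0 HN0] : exists N0, rnorm x `^ p - e `^ p <= S N0.
  apply: contrapT => /forallNP H.
  have HS N : S N <= rnorm x `^ p - e `^ p by rewrite leNgt; apply/negP => /ltW /H.
  have T0 : 0 <= rnorm x `^ p - e `^ p by rewrite (le_trans _ (HS 0%N)) // /S big_ord0.
  have [|N|y yE yr] := @lp_of_bounded x ((rnorm x `^ p - e `^ p) `^ p^-1).
  - exact: powR_ge0.
  - by rewrite powR_rootK //; exact: HS.
  have yx : y = x by exact: lp_ext.
  have := powR_le_mono (ltW p0) (rnorm_ge0 y) yr.
  rewrite yx powR_rootK // leNgt => /negP; apply.
  by rewrite gtrDl oppr_lt0 powR_gt0.
exists N0 => N N0N.
have [n|y yE yr] := @lp_of_bounded (x - lp_fin N x) e (ltW e0).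
- pose D k := rnorm ((x - lp_fin N x) k) `^ p.
  have D0 k : (k < N)%N -> D k = 0.
    by move=> kN; rewrite /D lpD lpN lp_finE kN subrr rnorm0 powR0 // gt_eqF.
  have Dx k : (N <= k)%N -> D k = rnorm (x k) `^ p.
    by move=> Nk; rewrite /D lpD lpN lp_finE ltnNge Nk subr0.
  rewrite -(big_mkord xpredT D); move: D0 Dx; move: (D) => {}D D0 Dx.
  have [nN|Nn] := leqP n N.
    rewrite big_nat big1 ?powR_ge0 // => k /andP[_ kn].
    by rewrite D0 // (leq_trans kn).
  rewrite (big_cat_nat (n := N)) //=; last exact: ltnW.
  rewrite big_nat big1 ?add0r => [|k /andP[_ kn]]; last exact: D0.
  have : S N + \sum_(N <= k < n) D k <= rnorm x `^ p.
    apply: le_trans (Sx n); rewrite /S -!(big_mkord xpredT (fun k => rnorm (x k) `^ p)).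
    rewrite [leRHS](big_cat_nat (n := N)) //=; last exact: ltnW.
    by rewrite lerD2l !big_nat; apply: ler_sum => k /andP[Nk _]; rewrite Dx.
  have := Smono _ _ N0N; move: HN0; lra.
by rewrite (_ : x - lp_fin N x = y) //; apply: lp_ext => k; rewrite yE.
Qed.

Lemma bop_lp_fin (F : normedModType R[i]) (T : bop (lp p1) F) N v :
  T (lp_fin N v) = \sum_(k < N) v k *: T (lp_unit k).
Proof. by rewrite lp_fin_sum bop_sum; apply: eq_bigr => k _; rewrite bopZx. Qed.

End lp_theory.

Section lp_duality.
Context {R : realType} (p q : R) (p1 : 1 <= p) (q1 : 1 <= q).
Hypothesis pq : p^-1 + q^-1 = 1.
Implicit Types (x : lp p1) (v : nat -> R[i]) (N : nat).

Let p0 : 0 < p. Proof. exact: lt_le_trans p1. Qed.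
Let q0 : 0 < q. Proof. exact: lt_le_trans q1. Qed.

Local Notation lp_unit := (lp_unit p1).

Lemma lp_dual_coef (g : bop (lp p1) R[i]) N :
  \sum_(k < N) rnorm (g (lp_unit k)) `^ q <= rnorm g `^ q.
Proof.
apply: (@dual_sum R N (fun k => g (lp_unit k)) _ p q) => // [|v]; first exact: rnorm_ge0.
rewrite -[X in rnorm X](bop_lp_fin g) (le_trans (le_opnorm _ _)) //.
by rewrite ler_wpM2l ?opnorm_ge0 // rnorm_lp_fin.
Qed.

Lemma lp_pairing N v x : rnorm (\sum_(k < N) v k * x k) <=
  (\sum_(k < N) rnorm (v k) `^ q) `^ q^-1 * rnorm x.
Proof.
rewrite (le_trans (rnorm_sum _ _ _)) //.
under eq_bigr do rewrite rnormM.
have qp : q^-1 + p^-1 = 1 by rewrite addrC.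
apply: (le_trans (hoelder_sum q0 p0 qp _ _)) => [i|i|]; try exact: rnorm_ge0.
rewrite ler_wpM2l ?powR_ge0 //.
rewrite -[leRHS](powRK_root p0) ?rnorm_ge0 //.
apply: powR_le_mono; first by rewrite invr_ge0 ltW.
  by rewrite sumr_ge0 // => k _; exact: powR_ge0.
exact: lp_sum_le.
Qed.

Lemma lp_coef_linear N v : linear (fun x => \sum_(k < N) v k * x k : R[i]).
Proof.
move=> a x y; rewrite scaler_sumr -big_split; apply: eq_bigr => k _ /=.
have -> : v k * (a *: x + y) k = v k * (a * x k + y k) by [].
rewrite mulrDr; congr (_ + _).
by rewrite mulrCA.
Qed.

Definition lp_coef N v : bop (lp p1) R[i] :=
  mkbop (lp_coef_linear N v) (lp_pairing N v).

Lemma rnorm_lp_coef N v :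
  rnorm (lp_coef N v) <= (\sum_(k < N) rnorm (v k) `^ q) `^ q^-1.
Proof. by apply: opnorm_le; [exact: powR_ge0|exact: lp_pairing]. Qed.

(** Hölder's inequality on finitely supported vectors, which are dense by [lp_fin_approx]. *)
Lemma bop_lp_le (g : bop (lp p1) R[i]) (M : R) : 0 <= M ->
  (forall N, \sum_(k < N) rnorm (g (lp_unit k)) `^ q <= M `^ q) -> rnorm g <= M.
Proof.
move=> M0 H; apply: opnorm_le => // x; apply/ler_addgt0Pl => e e0.
have g1 : 0 < rnorm g + 1 by rewrite ltr_wpDl // rnorm_ge0.
have [N0 HN] := lp_fin_approx x (divr_gt0 e0 g1).
have {HN} := HN N0 (leqnn _) => xN.
rewrite -[x](subrK (lp_fin p1 N0 x)) bopDx (le_trans (rnormD _ _)) // subrK lerD //.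
  rewrite (le_trans (le_opnorm _ _)) // -rnorm_bop.
  apply: (le_trans (ler_wpM2l (rnorm_ge0 g) xN)).
  by rewrite mulrCA ler_piMr ?(ltW e0) // ler_pdivrMr // mul1r lerDl.
rewrite bop_lp_fin; under eq_bigr do rewrite [_ *: _]mulrC.
rewrite (le_trans (lp_pairing N0 (fun k => g (lp_unit k)) x)) // ler_wpM2r ?rnorm_ge0 //.
rewrite -[leRHS](powRK_root q0) //.
apply: powR_le_mono; rewrite ?invr_ge0 ?(ltW q0) //.
by rewrite sumr_ge0 // => k _; exact: powR_ge0.
Qed.

(** The coordinates of the representing point are forced by the coordinate functionals; [dual_sum]
    with [p] and [q] exchanged puts them in l^p with the right norm. *)
Lemma lp_reflexive_aux (G : bop (bop (lp p1) R[i]) R[i]) :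
  exists2 x : lp p1, (forall k, x k = G (lp_coef k.+1 (fun j => (j == k)%:R)))
    & rnorm x <= rnorm G.
Proof.
apply: lp_of_bounded => [|N]; first exact: rnorm_ge0.
have qp : q^-1 + p^-1 = 1 by rewrite addrC.
apply: (@dual_sum R N (fun k => G (lp_coef k.+1 (fun j => (j == k)%:R))) _ q p) => // [|v].
  exact: rnorm_ge0.
have -> : \sum_(k < N) v k * G (lp_coef k.+1 (fun j => (j == k)%:R)) = G (lp_coef N v).
  under eq_bigr do rewrite -[_ * _]/(_ *: _) -bopZx.
  rewrite -bop_sum; congr (G _); apply: bop_ext => x.
  have E (f : 'I_N -> bop (lp p1) R[i]) : (\sum_k f k) x = \sum_k f k x.
    by elim/big_rec2: _ => [//|k y1 y2 _ <-].
  rewrite E; apply: eq_bigr => k _; rewrite bopZ /= (bigD1 ord_max) //= eqxx mul1r.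
  rewrite big1 ?addr0 // => j; rewrite -val_eqE /= => /negbTE ->.
  by rewrite mul0r.
rewrite (le_trans (le_opnorm _ _)) // ler_wpM2l ?opnorm_ge0 //.
exact: rnorm_lp_coef.
Qed.

End lp_duality.

Section lp_reflexive.
Context {R : realType} (p q : R) (p1 : 1 <= p) (q1 : 1 <= q).
Hypothesis pq : p^-1 + q^-1 = 1.

(** The point is already right on functionals with finitely many coefficients. These are dense in
    the dual, because the coefficients of [g] form a point [gam] of l^q, whose truncations converge
    to it. *)
Lemma lp_reflexive : reflexive_space (lp p1).
Proof.
exists 1 => // G; have [x xE xG] := lp_reflexive_aux q1 pq G.
exists x; last by rewrite mul1r.
have Gcoef N v : G (lp_coef p1 q1 pq N v) = \sum_(k < N) v k * x k.
  have -> : lp_coef p1 q1 pq N v = \sum_(k < N) v k *: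
      lp_coef p1 q1 pq k.+1 (fun j => (j == k)%:R).
    apply: bop_ext => y.
    have E (f : 'I_N -> bop (lp p1) R[i]) : (\sum_k f k) y = \sum_k f k y.
      by elim/big_rec2: _ => [//|k y1 y2 _ <-].
    rewrite E; apply: eq_bigr => k _; rewrite bopZ /= (bigD1 ord_max) //= eqxx mul1r.
    rewrite big1 ?addr0 // => j; rewrite -val_eqE /= => /negbTE ->.
    by rewrite mul0r.
  by rewrite bop_sum; apply: eq_bigr => k _; rewrite bopZx xE.
move=> g; apply/eqP; rewrite -subr_eq0; apply/eqP/rnorm0_eq0/eqP.
rewrite eq_le rnorm_ge0 andbT; apply/ler_addgt0Pl => e e0; rewrite addr0.
have [gam gamE _] := @lp_of_bounded R q q1 (fun k => g (lp_unit p1 k)) _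
  (rnorm_ge0 g) (lp_dual_coef q1 pq g).
pose M := rnorm G + rnorm g + 1.
have M0 : 0 < M by rewrite ltr_wpDl // addr_ge0 // rnorm_ge0.
have [N1 HN1] := lp_fin_approx gam (divr_gt0 e0 M0).
have [N2 HN2] := lp_fin_approx x (divr_gt0 e0 M0).
pose N := maxn N1 N2.
have {}HN1 := HN1 N (leq_maxl _ _); have {}HN2 := HN2 N (leq_maxr _ _).
pose gN := lp_coef p1 q1 pq N (fun k => g (lp_unit p1 k)).
have gNE : G gN = g (lp_fin p1 N x).
  by rewrite Gcoef bop_lp_fin; apply: eq_bigr => k _; rewrite mulrC.
have gN1 : rnorm (g - gN) <= e / M.
  apply: (bop_lp_le q1 pq); first by rewrite divr_ge0 // ltW.
  move=> n; apply: (@le_trans _ _ (rnorm (gam - lp_fin q1 N gam) `^ q)); last first.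
    apply: powR_le_mono; [exact: le_trans q1|exact: rnorm_ge0|exact: HN1].
  apply: le_trans (lp_sum_le _ n); rewrite le_eqVlt; apply/orP; left; apply/eqP.
  apply: eq_bigr => k _; congr (rnorm _ `^ _).
  rewrite bopD bopN lpD lpN lp_finE gamE; congr (_ - _).
  have -> : gN (lp_unit p1 k) =
      \sum_(j < N) g (lp_unit p1 j) * (j == k :> nat)%:R.
    by rewrite /gN /=; apply: eq_bigr => j _; rewrite -(lp_unitE p1).
  case: ifP => kN.
    rewrite (bigD1 (Ordinal kN)) //= eqxx mulr1 big1 ?addr0 // => j.
    by rewrite -val_eqE /= => /negbTE ->; rewrite mulr0.
  rewrite big1 // => j _; case: eqP => [jk|]; last by rewrite mulr0.
  by have := ltn_ord j; rewrite jk kN.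
have -> : G g - g x = G (g - gN) - g (x - lp_fin p1 N x).
  by rewrite !bopBx gNE opprB addrA subrK.
rewrite (le_trans (rnormD _ _)) // rnormN.
apply: (@le_trans _ _ (rnorm G * (e / M) + rnorm g * (e / M))).
  by apply: lerD; apply: (le_trans (le_opnorm _ _)); rewrite ler_wpM2l ?opnorm_ge0.
rewrite -mulrDl mulrCA ler_piMr ?(ltW e0) // ler_pdivrMr // mul1r.
by rewrite /M lerDl.
Qed.

End lp_reflexive.

Section lp_trace.
Context {R : realType} (s r : R) (hs : 1 < s) (hr : 1 < r).
Hypotheses (sr : s != r) (s2 : s != 2).

Let s1 := ltW hs.
Let r1 := ltW hr.

Lemma Re_le_rnorm (z : R[i]) : `|complex.Re z| <= rnorm z.
Proof.
case: z => a b; rewrite /rnorm normc_def /= -sqrtr_sqr ler_wsqrtr //.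
by rewrite lerDl sqr_ge0.
Qed.

Lemma Im_le_rnorm (z : R[i]) : `|complex.Im z| <= rnorm z.
Proof.
case: z => a b; rewrite /rnorm normc_def /= -sqrtr_sqr ler_wsqrtr //.
by rewrite lerDr sqr_ge0.
Qed.

Lemma rnorm_le_ReIm (z : R[i]) : rnorm z <= `|complex.Re z| + `|complex.Im z|.
Proof.
case: z => a b /=.
have -> : (a +i* b : R[i]) = a%:C + (0 +i* b).
  by apply/eqP; rewrite eq_complex /= addr0 add0r !eqxx.
rewrite (le_trans (rnormD _ _)) // rnorm_real lerD2l.
by rewrite /rnorm normc_def /= expr0n /= add0r sqrtr_sqr.
Qed.

(** The passage from complex to real matrices: the real and imaginary parts are real linear and do
    not increase absolute values, and the test coefficients are real. *)
Lemma sign_bounded_part (h : R[i] -> R) m N (x : 'I_m -> nat -> R[i]) (t u : R) :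
  0 <= t -> (forall z, `|h z| <= rnorm z) ->
  (forall y z, h (y + z) = h y + h z) -> (forall (c : R) z, h (c%:C * z) = c * h z) ->
  (forall c : 'I_m -> R, (forall i, `|c i| = c i ^+ 2) ->
    \sum_(k < N) rnorm (\sum_i (c i)%:C * x i k) `^ t <= (\sum_i `|c i|) `^ u) ->
  sign_bounded N (fun i k => h (x i k)) t u.
Proof.
move=> t0 hle hD hZ H c cE; apply: le_trans (H c cE); apply: ler_sum => k _.
apply: powR_le_mono => //; rewrite (le_trans _ (hle _)) // le_eqVlt; apply/orP; left.
apply/eqP; congr `|_|; have h0 : h 0 = 0 by rewrite -[0](mul0r 0) -[0 in LHS]/(0%:C) hZ mul0r.
by elim/big_rec2: _ => [//|i y1 y2 _ ->]; rewrite hD hZ.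
Qed.

Lemma sign_powR (c t : R) : 0 < t -> `|c| = c ^+ 2 -> `|c| `^ t = `|c|.
Proof.
move=> t0; rewrite -real_normK ?num_real // => /eqP.
rewrite -subr_eq0 expr2 -{1}[`|c|]mul1r -mulrBl mulf_eq0 subr_eq0 => /orP[/eqP <-|/eqP ->].
  by rewrite powR1.
by rewrite powR0 // gt_eqF.
Qed.

(** The rows [x i] are the coordinates of the images of the basis vectors under [S], the rows [y i]
    those of the coordinate functionals under the transpose of [T]. For signs [c], the s-norm is the
    power [1/s] of the number of nonzero entries, and contractivity gives [sign_bounded]. *)
Lemma lp_trace (e : R) : 0 < e -> exists2 m : nat, (0 < m)%N &
  forall (S : bop (lp s1) (lp r1)) (T : bop (lp r1) (lp s1)),
  rnorm S <= 1 -> rnorm T <= 1 ->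
  rnorm (\sum_(i < m) T (S (lp_unit s1 i)) i) <= e * m%:R.
Proof.
(* Real and imaginary parts produce four real traces, each at most [e / 8 * m]; the other [e / 2] is
   spent on cutting the images [S (lp_unit s1 i)] to finitely many coordinates. *)
move=> e0; have e8 : 0 < e / 8 by rewrite divr_gt0.
have s0 : 0 < s := lt_trans ltr01 hs; have r0 : 0 < r := lt_trans ltr01 hr.
pose s' := (1 - s^-1)^-1; pose r' := (1 - r^-1)^-1.
have ss : s^-1 + s'^-1 = 1 by rewrite invrK addrC subrK.
have rr : r^-1 + r'^-1 = 1 by rewrite invrK addrC subrK.
have hs' : 1 < s' by rewrite invf_gt1 ?subr_gt0 ?invf_lt1 // gtrDl oppr_lt0 invr_gt0.
have hr' : 1 < r' by rewrite invf_gt1 ?subr_gt0 ?invf_lt1 // gtrDl oppr_lt0 invr_gt0.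
have s'0 : 0 < s' := lt_trans ltr01 hs'; have r'0 : 0 < r' := lt_trans ltr01 hr'.
have [m m0 H] := finite_trace hs hr sr s2 hs' hr' ss rr e8.
exists m => // S T S1 T1.
pose x (i : 'I_m) k : R[i] := S (lp_unit s1 i) k.
pose y (i : 'I_m) k : R[i] := T (lp_unit r1 k) i.
pose tr N := \sum_(i < m) \sum_(k < N) x i k * y i k.
have lpE (t : R) (t1 : 1 <= t) (I : Type) (l : seq I) (f : I -> lp t1) k :
    (\sum_(i <- l) f i) k = \sum_(i <- l) f i k.
  by elim/big_rec2: _ => [//|i y1 y2 _ <-].
have xb N (c : 'I_m -> R) : (forall i, `|c i| = c i ^+ 2) ->
    \sum_(k < N) rnorm (\sum_i (c i)%:C * x i k) `^ r <= (\sum_i `|c i|) `^ (r / s).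
  move=> cE; pose v k : R[i] := if insub k is Some i then (c i)%:C else 0.
  have vE (i : 'I_m) : v i = (c i)%:C by rewrite /v valK.
  have -> : \sum_(k < N) rnorm (\sum_i (c i)%:C * x i k) `^ r =
      \sum_(k < N) rnorm (S (lp_fin s1 m v) k) `^ r.
    apply: eq_bigr => k _; congr (rnorm _ `^ _); rewrite bop_lp_fin lpE.
    by apply: eq_bigr => i _; rewrite lpZ vE.
  apply: (le_trans (lp_sum_le _ N)).
  apply: (@le_trans _ _ (rnorm (lp_fin s1 m v) `^ r)).
    apply: powR_le_mono; [exact: ltW|exact: rnorm_ge0|].
    by rewrite (le_trans (le_rnorm_bop _ S1)) // mul1r.
  rewrite [r / s]mulrC powRrM; apply: powR_le_mono; [exact: ltW|exact: rnorm_ge0|].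
  rewrite (le_trans (rnorm_lp_fin _ _ _)) // le_eqVlt; apply/orP; left; apply/eqP.
  by congr (_ `^ _); apply: eq_bigr => i _; rewrite vE rnorm_real sign_powR.
have yb N (c : 'I_m -> R) : (forall i, `|c i| = c i ^+ 2) ->
    \sum_(k < N) rnorm (\sum_i (c i)%:C * y i k) `^ r' <= (\sum_i `|c i|) `^ (r' / s').
  move=> cE; pose v k : R[i] := if insub k is Some i then (c i)%:C else 0.
  have vE (i : 'I_m) : v i = (c i)%:C by rewrite /v valK.
  (* The transpose of [T] applied to the functional with coefficients [c]; its own coefficients are
     the sums to be bounded. *)
  pose g := bop_scomp (lp_coef s1 (ltW hs') ss m v) T.
  have -> : \sum_(k < N) rnorm (\sum_i (c i)%:C * y i k) `^ r' =
      \sum_(k < N) rnorm (g (lp_unit r1 k)) `^ r'.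
    apply: eq_bigr => k _; congr (rnorm _ `^ _).
    by apply: eq_bigr => i _; rewrite /= vE.
  apply: (le_trans (lp_dual_coef (ltW hr') rr g N)).
  rewrite [r' / s']mulrC powRrM; apply: powR_le_mono; [exact: ltW|exact: rnorm_ge0|].
  rewrite (le_trans (rnorm_scomp _ _)) // (le_trans (ler_piMr (rnorm_ge0 _) T1)) //.
  rewrite (le_trans (rnorm_lp_coef _ _ _ _ _)) // le_eqVlt; apply/orP; left; apply/eqP.
  by congr (_ `^ _); apply: eq_bigr => i _; rewrite vE rnorm_real sign_powR.
have trb N : rnorm (tr N) <= e / 2 * m%:R.
  have ReM c (z : R[i]) : complex.Re (c%:C * z) = c * complex.Re z.
    by case: z => a b /=; rewrite mul0r subr0.
  have ImM c (z : R[i]) : complex.Im (c%:C * z) = c * complex.Im z.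
    by case: z => a b /=; rewrite mul0r addr0.
  have ReD (z w : R[i]) : complex.Re (z + w) = complex.Re z + complex.Re w.
    by case: z w => ? ? [].
  have ImD (z w : R[i]) : complex.Im (z + w) = complex.Im z + complex.Im w.
    by case: z w => ? ? [].
  have xR := sign_bounded_part (ltW r0) Re_le_rnorm ReD ReM (xb N).
  have xI := sign_bounded_part (ltW r0) Im_le_rnorm ImD ImM (xb N).
  have yR := sign_bounded_part (ltW r'0) Re_le_rnorm ReD ReM (yb N).
  have yI := sign_bounded_part (ltW r'0) Im_le_rnorm ImD ImM (yb N).
  have := H N _ _ xR yR; have := H N _ _ xI yI.
  have := H N _ _ xR yI; have := H N _ _ xI yR.
  set IR := \sum_i _; set RI := \sum_i _; set II := \sum_i _; set RR := \sum_i _.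
  move=> hIR hRI hII hRR.
  have ReE : complex.Re (tr N) = RR - II.
    rewrite /tr /RR /II -sumrB.
    elim/big_rec2: _ => [//|i a b _ IH]; rewrite ReD IH -sumrB; congr (_ + _).
    elim/big_rec2: _ => [//|k a' b' _ IH']; rewrite ReD IH'; congr (_ + _).
    by case: (x i k) (y i k) => ? ? [].
  have ImE : complex.Im (tr N) = RI + IR.
    rewrite /tr /RI /IR -big_split.
    elim/big_rec2: _ => [//|i a b _ IH]; rewrite ImD IH -big_split; congr (_ + _).
    elim/big_rec2: _ => [//|k a' b' _ IH']; rewrite ImD IH'; congr (_ + _).
    by case: (x i k) (y i k) => ? ? [].
  rewrite (le_trans (rnorm_le_ReIm _)) // ReE ImE.
  have := ler_normB RR II; have := ler_normD RI IR.
  move: hIR hRI hII hRR; move: (m%:R) => M; lra.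
have e2m : 0 < e / 2 by rewrite divr_gt0.
have HN : exists N, forall i : 'I_m, rnorm (S (lp_unit s1 i) - lp_fin r1 N (x i)) <= e / 2.
  have /choice[f Hf] : forall i : 'I_m, exists N0, forall N, (N0 <= N)%N ->
      rnorm (S (lp_unit s1 i) - lp_fin r1 N (S (lp_unit s1 i))) <= e / 2.
    by move=> i; exact: lp_fin_approx.
  exists (\max_(i < m) f i)%N => i; apply: Hf; exact: leq_bigmax.
have {HN} [N HN] := HN.
have -> : \sum_(i < m) T (S (lp_unit s1 i)) i =
    tr N + \sum_(i < m) T (S (lp_unit s1 i) - lp_fin r1 N (x i)) i.
  rewrite -big_split; apply: eq_bigr => i _ /=.
  rewrite bopBx lpD lpN bop_lp_fin lpE.
  have -> : \sum_(k < N) (x i k *: T (lp_unit r1 k)) i = \sum_(k < N) x i k * y i k.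
    by apply: eq_bigr => k _; rewrite lpZ.
  by rewrite addrC subrK.
have -> : e * m%:R = e / 2 * m%:R + e / 2 * m%:R by field.
rewrite (le_trans (rnormD _ _)) // lerD //.
rewrite (le_trans (rnorm_sum _ _ _)) //.
apply: (@le_trans _ _ (\sum_(i < m) e / 2)).
  apply: ler_sum => i _; rewrite (le_trans (lp_coord_le _ _)) //.
  by rewrite (le_trans (le_rnorm_bop _ T1)) // mul1r.
by rewrite sumr_const card_ord mulr_natr.
Qed.

End lp_trace.

(** * Hahn-Banach on tensors and the norm closed predual *)

Section infimum_of_family.
Context {R : realType} (I : Type) (i0 : I).
Implicit Types (f : I -> R) (c : R).

Lemma range_inf_le f c i : (forall j, c <= f j) -> inf (range f) <= f i.
Proof. by move=> cf; apply: ge_inf; [exists c => _ [j _ <-]|exists i]. Qed.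

Lemma le_range_inf f c : (forall i, c <= f i) -> c <= inf (range f).
Proof. by move=> cf; apply: lb_le_inf => [|_ [i _ <-] //]; exists (f i0), i0. Qed.

End infimum_of_family.

Section tensors.
Context {R : realType} (E F : normedModType R[i]).
Local Notation tensor := (seq (E * F)).
Implicit Types (u v w : tensor) (t : R).

Definition tscale t u : tensor := [seq (t%:C *: z.1, z.2) | z <- u].
Definition topp u : tensor := [seq (- z.1, z.2) | z <- u].

Definition bilinear_form (beta : E -> F -> R[i]) : Prop :=
  (forall y, linear (beta^~ y)) /\ (forall x, linear (beta x)).

Definition tsum (beta : E -> F -> R[i]) u := \sum_(z <- u) beta z.1 z.2.

Lemma same_tensorP u v :
  same_tensor u v <-> forall beta, bilinear_form beta -> tsum beta u = tsum beta v.
Proof. by split=> [H beta [b1 b2]|H beta b1 b2]; exact: H. Qed.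

Lemma tsum_cat beta u v : tsum beta (u ++ v) = tsum beta u + tsum beta v.
Proof. by rewrite /tsum big_cat. Qed.

Lemma bilinearZ beta a x y : bilinear_form beta -> beta (a *: x) y = a * beta x y.
Proof.
move=> [b1 _]; have b0 : beta 0 y = 0.
  have := b1 y 1 0 0; rewrite scaler0 addr0 scale1r => /eqP.
  by rewrite -subr_eq0 opprD addrA subrr sub0r oppr_eq0 => /eqP.
by have := b1 y a x 0; rewrite addr0 b0 addr0.
Qed.

Lemma tsum_scale beta t u : bilinear_form beta ->
  tsum beta (tscale t u) = t%:C * tsum beta u.
Proof.
by move=> bb; rewrite /tsum big_map mulr_sumr; apply: eq_bigr => z _; exact: bilinearZ.
Qed.

Lemma tsum_opp beta u : bilinear_form beta -> tsum beta (topp u) = - tsum beta u.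
Proof.
move=> bb; rewrite /tsum big_map -sumrN; apply: eq_bigr => z _ /=.
by rewrite -scaleN1r bilinearZ // mulN1r.
Qed.

(* [p] descends to a sublinear functional on the algebraic tensor product. *)
Definition sublinear (p : tensor -> R) : Prop :=
  [/\ forall u v, p (u ++ v) <= p u + p v,
      forall t u, 0 <= t -> p (tscale t u) <= t * p u
    & forall u v, same_tensor u v -> p u = p v].

Section sublinear_theory.
Variables (p : tensor -> R).
Hypothesis ps : sublinear p.

Lemma sublinear_cat u v : p (u ++ v) <= p u + p v. Proof. by case: ps. Qed.
Lemma sublinear_inv u v : same_tensor u v -> p u = p v. Proof. by case: ps => _ _; exact. Qed.
Lemma sublinear_scale_le t u : 0 <= t -> p (tscale t u) <= t * p u.
Proof. by case: ps => _ + _; exact. Qed.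

Lemma sublinear_nil : p [::] = 0.
Proof.
apply/eqP; rewrite eq_le; apply/andP; split.
  by have := @sublinear_scale_le 0 [::] (lexx _); rewrite mul0r.
by have := sublinear_cat [::] [::]; rewrite /= -subr_ge0 addrK.
Qed.

Lemma sublinear_opp u : - p (topp u) <= p u.
Proof.
rewrite lerNl -subr_ge0 opprK addrC -sublinear_nil.
rewrite (@sublinear_inv [::] (u ++ topp u)) ?sublinear_cat //.
apply/same_tensorP => beta bb; rewrite tsum_cat tsum_opp // subrr.
by rewrite /tsum big_nil.
Qed.

Lemma sublinear_scale t u : 0 < t -> p (tscale t u) = t * p u.
Proof.
move=> t0; apply/eqP; rewrite eq_le sublinear_scale_le ?(ltW t0) //=.
rewrite -ler_pdivlMl //.
have {1}-> : p u = p (tscale t^-1 (tscale t u)).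
  apply: sublinear_inv; apply/same_tensorP => beta bb.
  by rewrite !tsum_scale // mulrA -rmorphM /= mulVf ?gt_eqF // mul1r.
by rewrite sublinear_scale_le // invr_ge0 ltW.
Qed.

(** The lowering of a sublinear functional used in Hahn-Banach arguments: it remains sublinear and
    below [p], while [shift_opp] shows that it is pushed down to at most [- p y] at the opposite of
    [y]. *)
Definition shift (y : tensor) (u : tensor) : R :=
  inf (range (fun t : {nonneg R} => p (u ++ tscale t%:num y) - t%:num * p y)).

Let shift_lb y u (t : {nonneg R}) :
  - p (topp u) <= p (u ++ tscale t%:num y) - t%:num * p y.
Proof.
rewrite lerBrDr addrC lerBlDr.
have -> : t%:num * p y = p (tscale t%:num y).
  have [t0|] := eqVneq t%:num 0.
    rewrite t0 mul0r -[LHS]sublinear_nil; apply: sublinear_inv; apply/same_tensorP => beta bb.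
    by rewrite tsum_scale // mul0r /tsum big_nil.
  by rewrite neq_lt ltNge ge0 /= => t0; rewrite sublinear_scale.
rewrite (@sublinear_inv _ ((u ++ tscale t%:num y) ++ topp u)) ?sublinear_cat //.
by apply/same_tensorP => beta bb; rewrite !tsum_cat tsum_opp // addrAC subrr add0r.
Qed.

Lemma shift_le y u (t : R) : 0 <= t -> shift y u <= p (u ++ tscale t y) - t * p y.
Proof. by move=> t0; exact: (range_inf_le (NngNum t0) (shift_lb y u)). Qed.

Lemma le_shift y u c :
  (forall t : R, 0 <= t -> c <= p (u ++ tscale t y) - t * p y) -> c <= shift y u.
Proof. by move=> H; apply: (le_range_inf 0%:nng) => t; exact: H. Qed.

Lemma shift_le_self y u : shift y u <= p u.
Proof.
apply: le_trans (shift_le y u (lexx _)) _; rewrite mul0r subr0 le_eqVlt.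
apply/orP; left; apply/eqP/sublinear_inv/same_tensorP => beta bb.
by rewrite tsum_cat tsum_scale // mul0r addr0.
Qed.

Lemma shift_sublinear y : sublinear (shift y).
Proof.
split.
- move=> u v; rewrite -lerBlDr; apply: le_shift => t t0.
  rewrite lerBlDr -lerBlDl; apply: le_shift => t' t'0; rewrite lerBlDl.
  have tt : 0 <= t + t' by rewrite addr_ge0.
  apply: le_trans (shift_le y _ tt) _.
  rewrite (@sublinear_inv _ ((u ++ tscale t y) ++ (v ++ tscale t' y))); last first.
    apply/same_tensorP => beta bb; rewrite !tsum_cat !tsum_scale // rmorphD /= mulrDl.
    by rewrite addrACA.
  have := sublinear_cat (u ++ tscale t y) (v ++ tscale t' y).
  rewrite mulrDl; lra.
- move=> c u; rewrite le_eqVlt => /predU1P[<-|c0].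
    rewrite mul0r (le_trans (shift_le_self _ _)) // (@sublinear_inv _ [::]) ?sublinear_nil //.
    by apply/same_tensorP => beta bb; rewrite tsum_scale // mul0r /tsum big_nil.
  rewrite -ler_pdivrMl //; apply: le_shift => t t0; rewrite ler_pdivrMl //.
  have ct : 0 <= c * t by rewrite mulr_ge0 // ltW.
  apply: le_trans (shift_le y _ ct) _; rewrite mulrBr mulrA -(sublinear_scale (u ++ _) c0).
  rewrite lerD2r le_eqVlt; apply/orP; left; apply/eqP/sublinear_inv/same_tensorP.
  by move=> beta bb; rewrite !(tsum_cat, tsum_scale) // rmorphM /= mulrDr mulrA.
- move=> u v /same_tensorP uv; apply: (congr1 (fun f => inf (range f))).
  apply/funext => t; congr (_ - _); apply: sublinear_inv; apply/same_tensorP => beta bb.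
  by rewrite !tsum_cat uv.
Qed.

Lemma shift_opp y : shift y (topp y) <= - p y.
Proof.
apply: le_trans (shift_le y _ ler01) _; rewrite mul1r (@sublinear_inv _ [::]).
  by rewrite sublinear_nil sub0r.
apply/same_tensorP => beta bb; rewrite tsum_cat tsum_scale // tsum_opp // mul1r addNr.
by rewrite /tsum big_nil.
Qed.

End sublinear_theory.

(* A minimal sublinear functional equals all its shifts, hence is additive. *)
Lemma exists_additive (p : tensor -> R) : sublinear p -> exists q,
  [/\ sublinear q, forall u, q u <= p u & forall u v, q (u ++ v) = q u + q v].
Proof.
move=> ps; pose T := {q | sublinear q /\ forall u, q u <= p u}.
(* The order is reversed, so that a maximal element for Zorn's lemma is a minimal functional. *)
pose below (a b : T) := `[< forall u, sval b u <= sval a u >].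
have [| | | |[q [qs qp]] qmin] := @Zorn T below.
- by move=> a; apply/asboolP.
- move=> a b c /asboolP ab /asboolP bc; apply/asboolP => u.
  exact: le_trans (bc u) (ab u).
- move=> [a Ha] [b Hb] /asboolP /= ab /asboolP /= ba; apply: eq_exist.
  by apply/funext => u; apply/eqP; rewrite eq_le ab ba.
- move=> A Atot; have [[a0 Aa0]|A0] := pselect (exists a, A a); last first.
    exists (exist _ p (conj ps (fun=> lexx _))) => a Aa.
    by exfalso; apply: A0; exists a.
  pose I := {a : T | A a}; pose i0 : I := exist _ a0 Aa0.
  (* The pointwise infimum bounds the chain; it exists because sublinearity keeps every member above
     [- p (topp u)]. An empty chain was bounded by [p] itself. *)
  pose m u := inf (range (fun i : I => sval (sval i) u)).
  have lb u (i : I) : - p (topp u) <= sval (sval i) u.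
    case: i => [[q [qs qp]] Aq] /=.
    by rewrite (le_trans _ (sublinear_opp qs u)) // lerN2.
  have mi u (i : I) : m u <= sval (sval i) u := range_inf_le i (lb u).
  have ms : sublinear m.
    split.
    + move=> u v; rewrite -lerBlDr; apply: (le_range_inf i0) => i.
      rewrite lerBlDr -lerBlDl; apply: (le_range_inf i0) => j; rewrite lerBlDl.
      have [k [ki kj]] : exists k : I, (forall w, sval (sval k) w <= sval (sval i) w) /\
          (forall w, sval (sval k) w <= sval (sval j) w).
        have := Atot _ _ (svalP i) (svalP j).
        by case=> /asboolP H; [exists j|exists i].
      rewrite (le_trans (mi _ k)) //; have [ks _] := svalP (sval k).
      by rewrite (le_trans (sublinear_cat ks _ _)) // lerD.
    + move=> t u; rewrite le_eqVlt => /predU1P[<-|t0].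
        rewrite mul0r (le_trans (mi _ i0)) //; have [sl _] := svalP (sval i0).
        by have := @sublinear_scale_le _ sl 0 u (lexx _); rewrite mul0r.
      rewrite -ler_pdivrMl //; apply: (le_range_inf i0) => i; rewrite ler_pdivrMl //.
      have [sl _] := svalP (sval i).
      by rewrite (le_trans (mi _ i)) // sublinear_scale_le // ltW.
    + move=> u v uv; apply: (congr1 (fun f => inf (range f))); apply/funext => i.
      by have [sl _] := svalP (sval i); exact: sublinear_inv.
  have mp u : m u <= p u.
    by rewrite (le_trans (mi _ i0)) //; have [_] := svalP (sval i0); exact.
  exists (exist _ m (conj ms mp)) => a Aa; apply/asboolP => u /=.
  exact: (mi u (exist _ a Aa)).
exists q; split=> // u v.
(* By minimality. Taking the parameter 1 in [shift q v u] then yields the inequality opposite to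
   subadditivity. *)
have H : shift q v = q.
  have sp w : shift q v w <= p w by rewrite (le_trans (shift_le_self qs _ _)).
  have := qmin (exist _ _ (conj (shift_sublinear qs v) sp)).
  have le : below (exist _ q (conj qs qp))
      (exist _ _ (conj (shift_sublinear qs v) sp)).
    by apply/asboolP => w /=; exact: shift_le_self.
  by move=> /(_ le) /(congr1 sval).
apply/eqP; rewrite eq_le sublinear_cat //=.
rewrite -lerBrDr -{1}H (le_trans (shift_le qs v u ler01)) // mul1r lerD2r.
rewrite le_eqVlt; apply/orP; left; apply/eqP/(sublinear_inv qs)/same_tensorP.
by move=> beta bb; rewrite !tsum_cat tsum_scale // mul1r.
Qed.

(** An additive functional below [shift p u0] is at most [- p u0] at the opposite of [u0], hence at
    least [p u0] at [u0]. *)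
Lemma hahn_banach_tensor (p : tensor -> R) u0 : sublinear p -> exists q,
  [/\ sublinear q, forall u, q u <= p u, forall u v, q (u ++ v) = q u + q v
    & p u0 <= q u0].
Proof.
move=> ps; have [q [qs qle qD]] := exists_additive (shift_sublinear ps u0).
exists q; split=> // [u|]; first by rewrite (le_trans (qle u)) // shift_le_self.
have qN : q u0 + q (topp u0) = 0.
  rewrite -qD -(sublinear_nil qs); apply: (sublinear_inv qs); apply/same_tensorP.
  by move=> beta bb; rewrite tsum_cat tsum_opp // subrr /tsum big_nil.
have := le_trans (qle (topp u0)) (shift_opp ps u0); move: qN; lra.
Qed.

Local Notation cost v := (\sum_(z <- v) rnorm z.1 * rnorm z.2).

Lemma cost_ge0 v : 0 <= cost v.
Proof. by rewrite sumr_ge0 // => z _; rewrite mulr_ge0 ?rnorm_ge0. Qed.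

Lemma projective_norm_le u v : same_tensor u v -> projective_norm u <= cost v.
Proof.
move=> uv; apply: ge_inf; last by exists v.
by exists 0 => _ [w _ <-]; exact: cost_ge0.
Qed.

Lemma le_projective_norm u c :
  (forall v, same_tensor u v -> c <= cost v) -> c <= projective_norm u.
Proof.
move=> H; apply: lb_le_inf => [|_ [v uv <-]]; last exact: H.
by exists (cost u), u.
Qed.

Lemma projective_norm_sublinear : sublinear (@projective_norm R E F).
Proof.
split.
- move=> u v; rewrite -lerBlDr; apply: le_projective_norm => u' uu'.
  rewrite lerBlDr -lerBlDl; apply: le_projective_norm => v' vv'; rewrite lerBlDl.
  rewrite -big_cat; apply: projective_norm_le; apply/same_tensorP => beta bb.
  rewrite !tsum_cat; move/same_tensorP: uu' => ->//.
  by move/same_tensorP: vv' => ->.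
- move=> t u; rewrite le_eqVlt => /predU1P[<-|t0].
    rewrite mul0r (le_trans (@projective_norm_le _ [::] _)) ?big_nil //.
    by apply/same_tensorP => beta bb; rewrite tsum_scale // mul0r /tsum big_nil.
  rewrite -ler_pdivrMl //; apply: le_projective_norm => v uv; rewrite ler_pdivrMl //.
  have -> : t * cost v = cost (tscale t v).
    rewrite big_map mulr_sumr; apply: eq_bigr => z _ /=.
    by rewrite rnormZr gtr0_norm // mulrA.
  apply: projective_norm_le; apply/same_tensorP => beta bb.
  by rewrite !tsum_scale //; move/same_tensorP: uv => ->.
- move=> u v uv; congr inf; apply/seteqP; split=> _ [w /= uw <-]; exists w => //=.
    move=> beta b1 b2; rewrite -(uw beta b1 b2); symmetry; exact: uv.
  move=> beta b1 b2; rewrite -(uw beta b1 b2); exact: uv.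
Qed.

(* A real functional [rho] is the real part of [x |-> rho x - i rho (i x)]. *)
Lemma norming_bilinear_form u : exists beta, [/\ bilinear_form beta,
  forall x y, rnorm (beta x y) <= 2 * (rnorm x * rnorm y)
  & projective_norm u <= rnorm (tsum beta u)].
Proof.
have [q [qs qle qD qu]] := hahn_banach_tensor u projective_norm_sublinear.
pose rho x y := q [:: (x, y)].
have rhoD x x' y : rho (x + x') y = rho x y + rho x' y.
  rewrite /rho -qD; apply: (sublinear_inv qs); apply/same_tensorP => beta [b1 b2].
  rewrite /tsum big_cat /= !big_seq1 /=.
  by have := b1 y 1 x x'; rewrite !scale1r.
have rhoDr x y y' : rho x (y + y') = rho x y + rho x y'.
  rewrite /rho -qD; apply: (sublinear_inv qs); apply/same_tensorP => beta [b1 b2].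
  rewrite /tsum big_cat /= !big_seq1 /=.
  by have := b2 x 1 y y'; rewrite !scale1r.
have rho0 y : rho 0 y = 0.
  by have /eqP := rhoD 0 0 y; rewrite addr0 -subr_eq0 opprD addrA subrr sub0r oppr_eq0 => /eqP.
have rhoN x y : rho (- x) y = - rho x y.
  by apply/eqP; rewrite -addr_eq0 -rhoD addNr rho0.
have rho_le t x y : 0 <= t -> rho (t%:C *: x) y <= t * rho x y.
  by move=> t0; exact: (sublinear_scale_le qs [:: (x, y)] t0).
have rho_pos t x y : 0 <= t -> rho (t%:C *: x) y = t * rho x y.
  move=> t0; apply/eqP; rewrite eq_le rho_le //=.
  by have := rho_le t (- x) y t0; rewrite scalerN !rhoN mulrN lerN2.
have rhoZ t x y : rho (t%:C *: x) y = t * rho x y.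
  have [t0|/ltW t0] := leP 0 t; first exact: rho_pos.
  rewrite -[t]opprK rmorphN /= scaleNr rhoN rho_pos ?oppr_ge0 //.
  by rewrite -mulNr.
(* The additive functional is only real homogeneous, but a complex scalar may change factor without
   changing the tensor; this gives [beta] complex linearity in the second variable. *)
have rhoC (a : R[i]) x y : rho x (a *: y) = rho (a *: x) y.
  rewrite /rho; apply: (sublinear_inv qs); apply/same_tensorP => beta [b1 b2].
  rewrite /tsum !big_seq1 /= bilinearZ //.
  have := b2 x a y 0; rewrite addr0 => ->.
  have := b2 x 1 0 0; rewrite scaler0 addr0 scale1r => /eqP.
  by rewrite -subr_eq0 opprD addrA subrr sub0r oppr_eq0 => /eqP ->; rewrite addr0.
pose beta x y : R[i] := rho x y +i* (- rho ('i *: x) y).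
have betaD x x' y : beta (x + x') y = beta x y + beta x' y.
  by rewrite /beta scalerDr !rhoD opprD; apply/eqP; rewrite eq_complex /= !eqxx.
have betaZ (a : R[i]) x y : beta (a *: x) y = a * beta x y.
  case: a => a b; have -> : (a +i* b) *: x = a%:C *: x + b%:C *: ('i *: x).
    rewrite scalerA -scalerDl; congr (_ *: _).
    by apply/eqP; rewrite eq_complex /= !(mulr0, mul0r, mulr1, subr0, addr0, add0r) !eqxx.
  rewrite /beta.
  have -> : 'i *: (a%:C *: x + b%:C *: ('i *: x)) = a%:C *: ('i *: x) + (- b)%:C *: x.
    rewrite scalerDr !scalerA; congr (_ *: _ + _ *: _).
      by rewrite mulrC.
    by apply/eqP; rewrite eq_complex /=
      !(mulr0, mul0r, mulr1, mul1r, subr0, addr0, add0r, sub0r, oppr0) !eqxx.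
  rewrite !rhoD !rhoZ; apply/eqP; rewrite eq_complex /=.
  by apply/andP; split; apply/eqP; ring.
have bb : bilinear_form beta.
  split=> [y a x x'|x a y y']; first by rewrite betaD betaZ.
  have -> : beta x (a *: y + y') = beta x (a *: y) + beta x y'.
    by rewrite /beta !rhoDr opprD; apply/eqP; rewrite eq_complex /= !eqxx.
  congr (_ + _); rewrite -[RHS]betaZ /beta rhoC; congr (_ +i* - _).
  by rewrite rhoC !scalerA mulrC.
have rho_norm x y : `|rho x y| <= rnorm x * rnorm y.
  have H z : rho z y <= rnorm z * rnorm y.
    rewrite (le_trans (qle _)) // (le_trans (@projective_norm_le _ [:: (z, y)] _)) //.
    by rewrite big_seq1.
  by rewrite ler_norml H andbT lerNl -rhoN -[X in _ <= X * _]rnormN H.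
(* The factor 2 comes from bounding the real and imaginary parts separately. *)
exists beta; split=> //.
  move=> x y; rewrite (le_trans (rnorm_le_ReIm _)) //= normrN.
  have := rho_norm x y; have := rho_norm ('i *: x) y; rewrite rnormZ.
  have -> : rnorm ('i : R[i]) = 1.
    by rewrite /rnorm normc_def /= expr0n add0r expr1n sqrtr1.
  rewrite mul1r; lra.
rewrite (le_trans qu) // (le_trans _ (Re_le_rnorm _)) // (le_trans _ (ler_norm _)) //.
rewrite le_eqVlt; apply/orP; left; apply/eqP; rewrite /tsum.
elim: u {qu} => [|[x y] u IH]; first by rewrite big_nil (sublinear_nil qs).
rewrite -cat1s qD IH big_cat big_seq1 /=; by case: (\sum_(_ <- _) _).
Qed.

End tensors.

Section predual.
Context {R : realType} (E : completeNormedModType R[i]).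

Definition separating_dual := forall x : E, (forall g : bop E R[i], g x = 0) -> x = 0.

(** The norming bilinear form is an operator from [E] to its bidual. Reflexivity turns it into an
    element of L(E) of norm at most [2 * K], so pairing with L(E) controls the projective norm. *)
Lemma projective_norm_dual : reflexive_space E -> separating_dual ->
  exists2 K : R, 0 <= K & forall (u : seq (E * bop E R[i])) (M : R), 0 <= M ->
  (forall T : bop E E, rnorm (\sum_(z <- u) z.2 (T z.1)) <= M * rnorm T) ->
  projective_norm u <= K * M.
Proof.
move=> [K K0 HK] sep; exists (2 * K); first by rewrite mulr_ge0.
move=> u M M0 HM; have [beta [[b1 b2] bn bu]] := norming_bilinear_form u.
have bn' x g : rnorm (beta x g) <= 2 * rnorm x * rnorm g by rewrite -mulrA.
pose G x : bop (bop E R[i]) R[i] := mkbop (b2 x) (bn' x).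
have Gn x : rnorm (G x) <= 2 * rnorm x.
  by apply: opnorm_le => [|g]; [rewrite mulr_ge0 ?rnorm_ge0|exact: bn'].
have /choice[T HT] : forall x, exists y, (forall g, G x g = g y) /\ rnorm y <= K * rnorm (G x).
  by move=> x; have [y yE yn] := HK (G x); exists y.
(* The representing points were merely chosen; linearity holds because functionals separate
   points. *)
have Tl : linear T.
  move=> a x y; apply/eqP; rewrite -subr_eq0; apply/eqP/sep => g.
  rewrite bopBx bopDx bopZx -!(HT _).1 /=; apply/eqP; rewrite subr_eq0; apply/eqP.
  exact: b1.
have Tn x : rnorm (T x) <= 2 * K * rnorm x.
  by rewrite (le_trans (HT x).2) // mulrAC mulrC ler_wpM2r // mulrC.
have T2 : rnorm (mkbop Tl Tn) <= 2 * K by apply: opnorm_le => //; rewrite mulr_ge0.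
rewrite (le_trans bu) // mulrC; apply: le_trans (ler_wpM2l M0 T2).
apply: le_trans (HM (mkbop Tl Tn)); rewrite le_eqVlt; apply/orP; left; apply/eqP.
congr rnorm; apply: eq_bigr => z _ /=.
by rewrite -(HT z.1).1.
Qed.

(** Finite tensors that approximate [h] in the norm of the dual of L(E) are Cauchy for the
    projective norm by [projective_norm_dual]. So membership in the predual can be checked by norm
    approximation. *)
Lemma operator_predual_closed : reflexive_space E -> separating_dual ->
  forall h : bop (operator_algebra E) R[i],
  (forall e : R, 0 < e -> exists u : seq (E * bop E R[i]), forall b : bop E E,
    rnorm (h b - \sum_(z <- u) z.2 (b z.1)) <= e * rnorm b) ->
  operator_predual E h.
Proof.
move=> Er Es h H; have [K K0 HK] := projective_norm_dual Er Es.
have /choice[u Hu] : forall n : nat, exists u : seq (E * bop E R[i]),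
    forall b : bop E E, rnorm (h b - \sum_(z <- u) z.2 (b z.1)) <= n.+1%:R^-1 * rnorm b.
  by move=> n; apply: H; rewrite invr_gt0.
have small (e : R) : 0 < e -> exists N, forall n, (N <= n)%N -> n.+1%:R^-1 <= e.
  move=> e0; exists `|Num.ceil e^-1|%N => n Nn.
  rewrite -[e]invrK lef_pV2 ?posrE ?invr_gt0 //.
  rewrite (le_trans (Num.Theory.ceil_ge _)) // (le_trans (ler_norm _)) //.
  by rewrite -intr_norm -natr_absz ler_nat (leq_trans Nn).
exists u.
  (* Both tensors are within half of this quantity of [h]; multiplied by [K], it stays strictly
     below [e]. *)
  move=> e e0; have e1 : 0 < e / (2 * (K + 1)).
    by rewrite divr_gt0 // mulr_gt0 // ltr_wpDl.
  have [N HN] := small _ (divr_gt0 e1 (ltr0n _ 2)).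
  exists N => m n Nm Nn.
  have e1' := ltW e1.
  apply: le_lt_trans (HK _ _ e1' _) _ => [T|].
    have -> : \sum_(z <- tensor_sub (u m) (u n)) z.2 (T z.1) =
        (h T - \sum_(z <- u n) z.2 (T z.1)) - (h T - \sum_(z <- u m) z.2 (T z.1)).
      rewrite /tensor_sub big_cat big_map /=.
      under [X in _ + X]eq_bigr do rewrite -scaleN1r bopZx bopZx scaleN1r.
      by rewrite sumrN opprB [RHS]addrC addrA subrK.
    rewrite (le_trans (rnormD _ _)) // rnormN.
    have Am := le_trans (Hu m T) (ler_wpM2r (rnorm_ge0 T) (HN m Nm)).
    have An := le_trans (Hu n T) (ler_wpM2r (rnorm_ge0 T) (HN n Nn)).
    by rewrite (le_trans (lerD An Am)) // -mulrDl -splitr.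
  rewrite mulrCA gtr_pMr // ltr_pdivrMr ?mulr_gt0 // ?ltr_wpDl // mul1r.
  by move: K0; lra.
move=> T; apply/cvg_rnorm => e e0.
have T1 : 0 < rnorm T + 1 by rewrite ltr_wpDl // rnorm_ge0.
have [N HN] := small _ (divr_gt0 e0 T1).
exists N => // n /= Nn; rewrite (le_trans (Hu n T)) //.
rewrite (le_trans (ler_wpM2r (rnorm_ge0 T) (HN n Nn))) //.
by rewrite mulrAC ler_pdivrMr // ler_wpM2l ?(ltW e0) // lerDl.
Qed.

End predual.

(** * Spaces of trilinear forms *)

Section closed_subspace.
Context {R : realType} (W : completeNormedModType R[i]) (S : set W).

Definition subspace_set : Prop :=
  S 0 /\ forall (a : R[i]) u v, S u -> S v -> S (a *: u + v).

Definition closure_pred : {pred W} :=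
  mem [set w | forall e : R, 0 < e -> exists2 v, S v & rnorm (w - v) <= e].

Lemma closure_sub v : S v -> v \in closure_pred.
Proof. by move=> Sv; rewrite inE => e e0; exists v; rewrite // subrr rnorm0 ltW. Qed.

Lemma closure_bop (T : bop W W) w : (forall v, S v -> S (T v)) ->
  w \in closure_pred -> T w \in closure_pred.
Proof.
move=> ST; rewrite !inE => wS e e0.
have T1 : 0 < rnorm T + 1 by rewrite ltr_wpDl // rnorm_ge0.
have [v Sv wv] := wS _ (divr_gt0 e0 T1).
exists (T v); first exact: ST.
rewrite -bopBx (le_trans (le_opnorm _ _)) //.
apply: (le_trans (ler_wpM2l (rnorm_ge0 T) wv)).
by rewrite mulrCA ler_piMr ?(ltW e0) // ler_pdivrMr // mul1r lerDl.
Qed.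

Context (Ssub : subspace_set).

Lemma closure_submod_closed : submod_closed closure_pred.
Proof.
have [S0 SD] := Ssub; split; first exact: closure_sub.
move=> a w w'; rewrite !inE => wS w'S e e0.
have a1 : 0 < rnorm a + 1 by rewrite ltr_wpDl // rnorm_ge0.
have e2 : 0 < e / 2 by rewrite divr_gt0.
have [v Sv wv] := wS _ (divr_gt0 e2 a1); have [v' Sv' wv'] := w'S _ e2.
exists (a *: v + v'); first exact: SD.
rewrite opprD addrACA -scalerBr (le_trans (rnormD _ _)) // [leRHS]splitr lerD //.
rewrite rnormZ (le_trans (ler_wpM2l (rnorm_ge0 a) wv)) //.
by rewrite mulrCA ler_piMr ?(ltW e2) // ler_pdivrMr // mul1r lerDl.
Qed.

(** The subspace proof is a parameter of the type because the vector space structure attached to it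
    below depends on that proof. *)
Record closed_span_of (Ssub : subspace_set) := ClosedSpan {
  span_val :> W ;
  span_valP : span_val \in closure_pred
}.
Arguments ClosedSpan Ssub span_val span_valP : rename.

Local Notation closed_span := (closed_span_of Ssub).

HB.instance Definition _ := [isSub for @span_val Ssub].
HB.instance Definition _ := [Choice of closed_span by <:].
HB.instance Definition _ := GRing.isSubmodClosed.Build _ _ closure_pred
  closure_submod_closed.
HB.instance Definition _ := [SubChoice_isSubLmodule of closed_span by <:].

Let span_norm (x : closed_span) : R[i] := `|span_val x|.

Let span_normD (x y : closed_span) : span_norm (x + y) <= span_norm x + span_norm y.
Proof. exact: ler_normD. Qed.

Let span_normZ (a : R[i]) (x : closed_span) : span_norm (a *: x) = `|a| * span_norm x.
Proof. exact: normrZ. Qed.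

Let span_norm_eq0 (x : closed_span) : span_norm x = 0 -> x = 0.
Proof. by move=> /normr0_eq0 x0; apply: val_inj. Qed.

HB.instance Definition _ := Lmodule_isNormed.Build R[i] closed_span
  span_normD span_normZ span_norm_eq0.

Lemma rnorm_span (x : closed_span) : rnorm x = rnorm (span_val x). Proof. by []. Qed.

Lemma closed_span_complete (G : set_system closed_span) :
  ProperFilter G -> cauchy G -> cvg G.
Proof.
move=> GG Gc; have hc : cauchy ((@span_val Ssub) @ G).
  apply/cauchyP => e e0.
  have e1 : 0 < complex.Re e by move: e0; rewrite ltcE => /andP[].
  have e2 : 0 < complex.Re e / 2 by rewrite divr_gt0.
  have [A GA Ar] := cauchy_rnorm _ Gc e2.
  have [x Ax] := @filter_ex _ _ GG _ GA.
  exists (span_val x); rewrite /fmap /=; apply: filterS GA => y Ay /=.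
  rewrite -ball_normE /= rnormE.
  have -> : e = (complex.Re e)%:C.
    by move: e0; case: (e) => c d; rewrite ltcE /= => /andP[/eqP ->].
  rewrite ltcR (le_lt_trans (Ar _ _ Ax Ay)) //.
  by rewrite ltr_pdivrMr // ltr_pMr // ltr1n.
have /cvg_ex[w /= hw] : cvg ((@span_val Ssub) @ G) by exact: cauchy_cvg hc.
have wG r : 0 < r -> G [set x : closed_span | rnorm (w - span_val x) <= r].
  by move=> r0; move: hw => /cvg_rnorm /(_ r r0).
have wP : w \in closure_pred.
  rewrite inE => e e0; have e2 : 0 < e / 2 by rewrite divr_gt0.
  have [x /= wx] := @filter_ex _ _ GG _ (wG _ e2).
  have := span_valP x; rewrite inE => /(_ _ e2)[v Sv xv]; exists v => //.
  by rewrite -[w](subrK (span_val x)) -addrA (le_trans (rnormD _ _)) // [leRHS]splitr lerD.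
by apply/cvg_ex; exists (@ClosedSpan Ssub w wP); apply/cvg_rnorm => r r0; exact: wG.
Qed.

HB.instance Definition _ := Uniform_isComplete.Build closed_span closed_span_complete.

Lemma span_val_linear : linear (@span_val Ssub). Proof. by []. Qed.

Definition span_incl : bop closed_span W :=
  mkbop span_val_linear (fun x => eq_ind_r (fun z => z <= _) (lexx _) (esym (mul1r _))).

Lemma span_approx (x : closed_span) (e : R) : 0 < e ->
  exists2 v : W, S v & rnorm (span_val x - v) <= e.
Proof. by move=> e0; have := span_valP x; rewrite inE; exact. Qed.

End closed_subspace.

Section operator_maps.
Context {R : realType}.

Section composition.
Context (E F G : normedModType R[i]).

Lemma prec_linear (T : bop E F) : linear (fun S : bop F G => bop_scomp S T).
Proof. by move=> a S S'; apply: bop_ext. Qed.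

Lemma prec_bound (T : bop E F) (S : bop F G) :
  rnorm (bop_scomp S T) <= rnorm T * rnorm S.
Proof. by rewrite mulrC rnorm_scomp. Qed.

Definition prec (T : bop E F) : bop (bop F G) (bop E G) :=
  mkbop (prec_linear T) (prec_bound T).

Lemma postc_linear (T : bop F G) : linear (fun S : bop E F => bop_scomp T S).
Proof.
move=> a S S'; apply: bop_ext => x.
have -> : bop_scomp T (a *: S + S') x = T (a *: S x + S' x) by [].
by rewrite bopDx bopZx.
Qed.

Definition postc (T : bop F G) : bop (bop E F) (bop E G) :=
  mkbop (postc_linear T) (rnorm_scomp T).

Lemma prec_lin : linear prec.
Proof.
move=> k T T'; apply: bop_ext => S; apply: bop_ext => x.
have -> : prec (k *: T + T') S x = S (k *: T x + T' x) by [].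
by rewrite bopDx bopZx.
Qed.

Lemma postc_lin : linear postc.
Proof. by move=> k T T'; apply: bop_ext => S; apply: bop_ext. Qed.

Lemma rnorm_prec T : rnorm (prec T) <= rnorm T.
Proof. by apply: opnorm_le => [|S]; [exact: rnorm_ge0|exact: prec_bound]. Qed.

Lemma rnorm_postc T : rnorm (postc T) <= rnorm T.
Proof. by apply: opnorm_le => [|S]; [exact: rnorm_ge0|exact: rnorm_scomp]. Qed.

End composition.

Definition bop_id (E : normedModType R[i]) : bop E E :=
  @mkbop R E E id 1 (fun _ _ _ => erefl) (fun x => eq_ind_r (fun z => _ <= z) (lexx _) (mul1r _)).

Lemma bop_eval_linear (E F : normedModType R[i]) (x : E) :
  linear (fun T : bop E F => T x).
Proof. by []. Qed.

Lemma bop_eval_bound (E F : normedModType R[i]) (x : E) (T : bop E F) :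
  rnorm (T x) <= rnorm x * rnorm T.
Proof. by rewrite mulrC; exact: le_opnorm. Qed.

Definition bop_eval (E F : normedModType R[i]) (x : E) : bop (bop E F) F :=
  mkbop (@bop_eval_linear E F x) (@bop_eval_bound E F x).

Section trilinear_theory.
Context (E1 E2 E3 : normedModType R[i]) (G : completeNormedModType R[i]).

(** Bounded trilinear forms in curried form, so that completeness and the supremum norm come from
    [bop]. Completing a seminormed space becomes taking a closure here, and the null space of the
    seminorm is divided out by evaluation. *)
Definition tri_space : completeNormedModType R[i] := bop E1 (bop E2 (bop E3 G)).
Implicit Types w : tri_space.

Definition tri_ev x y z : bop tri_space G :=
  bop_scomp (bop_eval G z) (bop_scomp (bop_eval _ y) (bop_eval _ x)).

Lemma rnorm_tri_ev x y z : rnorm (tri_ev x y z) <= rnorm x * rnorm y * rnorm z.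
Proof.
apply: opnorm_le => [|w]; first by rewrite !mulr_ge0 ?rnorm_ge0.
have -> : rnorm x * rnorm y * rnorm z * rnorm w =
  rnorm w * rnorm x * rnorm y * rnorm z by ring.
apply: le_trans (le_opnorm (w x y) z) _.
apply: le_trans (ler_wpM2r (rnorm_ge0 z) (le_opnorm (w x) y)) _.
rewrite ler_wpM2r ?rnorm_ge0 // ler_wpM2r ?rnorm_ge0 //.
exact: (le_opnorm w x).
Qed.

Lemma rnorm_tri_ball w (M : R) :
  (forall x y z, rnorm x <= 1 -> rnorm y <= 1 -> rnorm z <= 1 ->
    rnorm (tri_ev x y z w) <= M) -> rnorm w <= M.
Proof.
move=> H; apply: rnorm_bop_le_ball => x x1; apply: rnorm_bop_le_ball => y y1.
by apply: rnorm_bop_le_ball => z z1; exact: H.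
Qed.

Lemma tri_ext w w' : (forall x y z, tri_ev x y z w = tri_ev x y z w') -> w = w'.
Proof.
by move=> H; apply: bop_ext => x; apply: bop_ext => y; apply: bop_ext => z; exact: H.
Qed.

Lemma tri_ev_linear3 x y : linear (tri_ev x y).
Proof.
move=> k z z'; apply: bop_ext => w.
exact: (etrans (bopDx (w x y) _ _) (congr2 +%R (bopZx (w x y) _ _) erefl)).
Qed.

Definition tri_map1 (T : bop E1 E1) : bop tri_space tri_space := prec _ T.
Definition tri_map2 (T : bop E2 E2) : bop tri_space tri_space := postc E1 (prec _ T).

Lemma tri_map1E T x y z w : tri_ev x y z (tri_map1 T w) = tri_ev (T x) y z w.
Proof. by []. Qed.

Lemma tri_map2E T x y z w : tri_ev x y z (tri_map2 T w) = tri_ev x (T y) z w.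
Proof. by []. Qed.

Lemma tri_map1_linear : linear tri_map1. Proof. exact: prec_lin. Qed.

Lemma tri_map2_linear : linear tri_map2.
Proof. by move=> k T T'; rewrite /tri_map2 prec_lin postc_lin. Qed.

Lemma rnorm_tri_map1 T : rnorm (tri_map1 T) <= rnorm T. Proof. exact: rnorm_prec. Qed.

Lemma rnorm_tri_map2 T : rnorm (tri_map2 T) <= rnorm T.
Proof. exact: le_trans (rnorm_postc _ _) (rnorm_prec _ _). Qed.

Context (h : E1 -> E2 -> E3 -> G) (K : R).
Hypothesis K0 : 0 <= K.
Hypothesis hl1 : forall y z, linear (fun x => h x y z).
Hypothesis hl2 : forall x z, linear (fun y => h x y z).
Hypothesis hl3 : forall x y, linear (h x y).
Hypothesis hb : forall x y z,
  rnorm (h x y z) <= K * rnorm x * rnorm y * rnorm z.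

Definition trilin1 x y : bop E3 G := mkbop (hl3 x y) (hb x y).

Lemma trilin2_linear x : linear (trilin1 x).
Proof. by move=> k y y'; apply: bop_ext => z; exact: hl2. Qed.

Lemma trilin2_bound x y : rnorm (trilin1 x y) <= K * rnorm x * rnorm y.
Proof. by apply: opnorm_le => [|z]; [rewrite !mulr_ge0 ?rnorm_ge0|exact: hb]. Qed.

Definition trilin2 x : bop E2 (bop E3 G) := mkbop (trilin2_linear x) (trilin2_bound x).

Lemma trilin3_linear : linear trilin2.
Proof.
by move=> k x x'; apply: bop_ext => y; apply: bop_ext => z; exact: hl1.
Qed.

Lemma trilin3_bound x : rnorm (trilin2 x) <= K * rnorm x.
Proof. by apply: opnorm_le => [|y]; [rewrite !mulr_ge0 ?rnorm_ge0|exact: trilin2_bound]. Qed.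

Definition trilin : tri_space := mkbop trilin3_linear trilin3_bound.

Lemma trilinE x y z : tri_ev x y z trilin = h x y z. Proof. by []. Qed.

Lemma rnorm_trilin : rnorm trilin <= K.
Proof. by apply: opnorm_le; [exact: K0|exact: trilin3_bound]. Qed.

End trilinear_theory.

End operator_maps.

(** * The commutator module *)

Section commutator_atoms.
Context {R : realType} (E : completeNormedModType R[i]) (P : bop E E).
Local Notation A := (bop E E).
Local Notation E' := (bop E R[i]).
Local Notation W := (tri_space A A A R[i]).
Local Notation ev := (@tri_ev R A A A R[i]).
Implicit Types (a b c : A) (f : E) (g : E').

Definition commutator c : A := bop_comp c P - bop_comp P c.

Lemma commutatorE c z : commutator c z = c (P z) - P (c z). Proof. by []. Qed.

Lemma commutator_linear : linear commutator.
Proof.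
move=> k c c'; apply: bop_ext => z; rewrite commutatorE.
have -> : (k *: commutator c + commutator c') z =
  k *: (c (P z) - P (c z)) + (c' (P z) - P (c' z)) by [].
have -> : (k *: c + c') (P z) = k *: c (P z) + c' (P z) by [].
have -> : P ((k *: c + c') z) = k *: P (c z) + P (c' z) by rewrite -bopZx -bopDx.
by rewrite scalerBr opprD addrACA.
Qed.

Lemma commutator_bound c : rnorm (commutator c) <= 2 * rnorm P * rnorm c.
Proof.
rewrite (le_trans (rnormD _ _)) // rnormN.
have := bop_comp_norm c P; have := bop_comp_norm P c; lra.
Qed.

Lemma atom_bound f g a b c : rnorm (g (a (commutator c (b f)))) <=
  2 * rnorm P * rnorm f * rnorm g * rnorm a * rnorm b * rnorm c.
Proof.
have H1 := le_opnorm g (a (commutator c (b f))).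
have H2 := ler_wpM2l (rnorm_ge0 g) (le_opnorm a (commutator c (b f))).
have H3 := ler_wpM2l (mulr_ge0 (rnorm_ge0 g) (rnorm_ge0 a))
  (le_opnorm (commutator c) (b f)).
have H4 := ler_wpM2l (mulr_ge0 (rnorm_ge0 g) (rnorm_ge0 a))
  (ler_pM (rnorm_ge0 _) (rnorm_ge0 _) (commutator_bound c) (le_opnorm b f)).
rewrite -!rnorm_bop in H1 H2 H3 H4.
rewrite (le_trans H1) // (le_trans H2) // mulrA (le_trans H3) // (le_trans H4) //.
by rewrite le_eqVlt; apply/orP; left; apply/eqP; ring.
Qed.

Definition tri f g a b c : R[i] := g (a (commutator c (b f))).

Lemma tri_linear1 f g b c : linear (fun a => tri f g a b c).
Proof.
move=> k a a'; rewrite /tri; set z := commutator c (b f).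
have -> : (k *: a + a') z = k *: a z + a' z by [].
by rewrite bopDx bopZx.
Qed.

Lemma tri_linear2 f g a c : linear (fun b => tri f g a b c).
Proof.
move=> k b b'; rewrite /tri.
have -> : (k *: b + b') f = k *: b f + b' f by [].
move: (commutator c) => T.
by rewrite (bopDx T) (bopZx T) (bopDx a) (bopZx a) (bopDx g) (bopZx g).
Qed.

Lemma tri_linear3 f g a b : linear (tri f g a b).
Proof.
move=> k c c'; rewrite /tri commutator_linear.
move: (commutator c) (commutator c') => T T'.
have -> : (k *: T + T') (b f) = k *: T (b f) + T' (b f) by [].
by rewrite (bopDx a) (bopZx a) (bopDx g) (bopZx g).
Qed.

Lemma tri_linear_l g a b c : linear (fun f => tri f g a b c).
Proof.
move=> k f f'; rewrite /tri; move: (commutator c) => T.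
by rewrite (bopDx b) (bopZx b) (bopDx T) (bopZx T) (bopDx a) (bopZx a) (bopDx g) (bopZx g).
Qed.

Lemma atom_const_ge0 f g : 0 <= 2 * rnorm P * rnorm f * rnorm g.
Proof. by rewrite !mulr_ge0 ?rnorm_ge0. Qed.

(* The functional [tr (R a [c, P] b)] for the rank one operator [R = g (.) f]. *)
Definition atom f g : W :=
  trilin (atom_const_ge0 f g) (tri_linear1 f g) (tri_linear2 f g) (tri_linear3 f g)
    (atom_bound f g).

Lemma atomE f g a b c : ev a b c (atom f g) = tri f g a b c.
Proof. exact: trilinE. Qed.

Lemma rnorm_atom f g : rnorm (atom f g) <= 2 * rnorm P * rnorm f * rnorm g.
Proof. exact: rnorm_trilin. Qed.

Lemma atom_linl g : linear (atom^~ g).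
Proof.
move=> k f f'; apply: tri_ext => a b c; rewrite bopDx bopZx !atomE.
exact: (tri_linear_l g a b c k f f').
Qed.

Lemma atom_linr f : linear (atom f).
Proof. by move=> k g g'; apply: tri_ext => a b c; rewrite bopDx bopZx !atomE. Qed.

Definition Lmul a : bop A A := mkbop (bop_comp_linr a) (bop_comp_norm a).

Lemma Rmul_bound b a : rnorm (bop_comp a b) <= rnorm b * rnorm a.
Proof. by rewrite mulrC bop_comp_norm. Qed.

Definition Rmul b : bop A A := mkbop (bop_comp_linl b) (Rmul_bound b).

Lemma rnorm_Lmul a : rnorm (Lmul a) <= rnorm a.
Proof. by apply: opnorm_le => [|b]; [exact: rnorm_ge0|exact: bop_comp_norm]. Qed.

Lemma rnorm_Rmul b : rnorm (Rmul b) <= rnorm b.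
Proof. by apply: opnorm_le => [|a]; [exact: rnorm_ge0|exact: Rmul_bound]. Qed.

(** For the form [tr (R x [c, P] y)], replacing [R] by [R a] multiplies [x] by [a] on the left.
    Replacing [R] by [b R] multiplies [y] by [b] on the right, by cyclicity of the trace; hence
    [tri_lact] acts on the second variable. *)
Definition tri_ract a : bop W W := tri_map1 A A R[i] (Lmul a).
Definition tri_lact b : bop W W := tri_map2 A A R[i] (Rmul b).

Lemma tri_ractE a (w : W) x y c : ev x y c (tri_ract a w) = ev (bop_comp a x) y c w.
Proof. exact: tri_map1E. Qed.

Lemma tri_lactE b (w : W) x y c : ev x y c (tri_lact b w) = ev x (bop_comp y b) c w.
Proof. exact: tri_map2E. Qed.

Lemma rnorm_tri_ract a : rnorm (tri_ract a) <= rnorm a.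
Proof. exact: le_trans (rnorm_tri_map1 _ _ _ _) (rnorm_Lmul a). Qed.

Lemma rnorm_tri_lact b : rnorm (tri_lact b) <= rnorm b.
Proof. exact: le_trans (rnorm_tri_map2 _ _ _ _) (rnorm_Rmul b). Qed.

Lemma tri_ract_atom a f g : tri_ract a (atom f g) = atom f (bop_scomp g a).
Proof. by apply: tri_ext => x y c; rewrite tri_ractE !atomE. Qed.

Lemma tri_lact_atom b f g : tri_lact b (atom f g) = atom (b f) g.
Proof. by apply: tri_ext => x y c; rewrite tri_lactE !atomE. Qed.

Lemma Lmul_linear : linear Lmul.
Proof. by move=> k a a'; apply: bop_ext => b; rewrite /= bop_comp_linl. Qed.

Lemma Rmul_linear : linear Rmul.
Proof. by move=> k b b'; apply: bop_ext => a; rewrite /= bop_comp_linr. Qed.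

Lemma tri_ract_linear : linear tri_ract.
Proof. by move=> k a a'; rewrite /tri_ract Lmul_linear tri_map1_linear. Qed.

Lemma tri_lact_linear : linear tri_lact.
Proof. by move=> k b b'; rewrite /tri_lact Rmul_linear tri_map2_linear. Qed.

Lemma tri_ractA w a b : tri_ract b (tri_ract a w) = tri_ract (bop_comp a b) w.
Proof. by apply: tri_ext => x y c; rewrite !tri_ractE bop_compA. Qed.

Lemma tri_lactA a b w : tri_lact a (tri_lact b w) = tri_lact (bop_comp a b) w.
Proof. by apply: tri_ext => x y c; rewrite !tri_lactE -bop_compA. Qed.

Lemma tri_lractA a b w : tri_ract b (tri_lact a w) = tri_lact a (tri_ract b w).
Proof. by apply: tri_ext => x y c; rewrite tri_ractE !tri_lactE tri_ractE. Qed.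

Definition tri_unit c : bop W R[i] := ev (bop_id E) (bop_id E) c.

Lemma tri_unit_linear : linear tri_unit. Proof. exact: tri_ev_linear3. Qed.

Lemma tri_unit_le c :
  rnorm (tri_unit c) <= rnorm (bop_id E) * rnorm (bop_id E) * rnorm c.
Proof. exact: rnorm_tri_ev. Qed.

Lemma tri_unit_atom c f g : tri_unit c (atom f g) = g (commutator c f).
Proof. exact: atomE. Qed.

End commutator_atoms.

(** * Continuity for the w*-topologies *)

Section continuity.

Lemma ptws_continuous (X : topologicalType) (I : Type) (T : topologicalType)
    (g : X -> I -> T) :
  (forall i, continuous (fun x => g x i)) -> continuous (g : X -> {ptws I -> T}).
Proof.
move=> H x; apply/cvg_sup => i.
exact: (@continuous_comp_initial {ptws I -> T} X T (fun f => f i) g (H i) x).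
Qed.

Lemma ptws_eval_continuous (I : Type) (T : topologicalType) (i : I) :
  continuous ((fun f => f i) : {ptws I -> T} -> T).
Proof.
move=> f; have /cvg_sup/(_ i) h : f --> f by apply: cvg_id.
apply: cvg_trans (cvg_app _ h) _.
exact: (@initial_continuous _ _ (fun g : I -> T => g i)).
Qed.

Context {R : realType} (B : banachAlgebra R) (P : set (bop B R[i])) (F : banachBimodule B).

(** The target carries the initial topology of the evaluations, and each evaluation of [f] is an
    element of the predual, continuous by definition of the source topology. *)
Lemma wstar_continuous (f : B -> dual_bimodule F) :
  (forall x : F, exists2 h : bop B R[i], P h & forall b, (f b : bop F R[i]) x = h b) ->
  continuous (f : wstar P -> wstar_dual F).
Proof.
move=> H; pose ev (phi : dual_bimodule F) (x : F) : R[i] := (phi : bop F R[i]) x.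
apply: (@continuous_comp_initial (dual_bimodule F) (wstar P) {ptws F -> R[i]} ev f).
apply: ptws_continuous => x; have [h Ph hE] := H x.
have -> : (fun b : wstar P => (ev \o f) b x) = h by apply/funext => b; exact: hE.
pose hP : P := exist _ h (mem_set Ph).
move=> b; have := @initial_continuous B {ptws P -> R[i]} (fun b k => set_val k b) b.
by move=> /(cvg_comp _ _)/(_ (@ptws_eval_continuous P R[i] hP _)).
Qed.

End continuity.

(** * The bimodule spanned by the atoms and its derivation *)

Section operator_module.
Context {R : realType} (E : completeNormedModType R[i]) (P : bop E E).
Local Notation A := (bop E E).
Local Notation E' := (bop E R[i]).
Context (V : completeNormedModType R[i]) (atom : E -> E' -> V) (K Ku : R).
Context (r l : A -> bop V V) (unit : A -> bop V R[i]).
Hypothesis Ku0 : 0 <= Ku.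
Hypothesis atom_linl : forall g, linear (atom^~ g).
Hypothesis atom_linr : forall f, linear (atom f).
Hypothesis atom_le : forall f g, rnorm (atom f g) <= K * rnorm f * rnorm g.
Hypothesis r_lin : linear r.
Hypothesis l_lin : linear l.
Hypothesis rA : forall v a b, r b (r a v) = r (bop_comp a b) v.
Hypothesis lA : forall a b v, l a (l b v) = l (bop_comp a b) v.
Hypothesis lrA : forall a b v, r b (l a v) = l a (r b v).
Hypothesis r_le : forall a, rnorm (r a) <= rnorm a.
Hypothesis l_le : forall a, rnorm (l a) <= rnorm a.
Hypothesis r_atom : forall a f g, r a (atom f g) = atom f (bop_scomp g a).
Hypothesis l_atom : forall b f g, l b (atom f g) = atom (b f) g.
Hypothesis unit_lin : linear unit.
Hypothesis unit_le : forall c, rnorm (unit c) <= Ku * rnorm c.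
Hypothesis unit_atom : forall c f g, unit c (atom f g) = g (commutator P c f).

Definition atom_sum (u : seq (E * E')) : V := \sum_(z <- u) atom z.1 z.2.

Definition atom_span : set V := [set w | exists u, w = atom_sum u].

Lemma atom_span_subspace : subspace_set atom_span.
Proof.
split; first by exists [::]; rewrite /atom_sum big_nil.
move=> k _ _ [u ->] [v ->]; exists ([seq (k *: z.1, z.2) | z <- u] ++ v).
rewrite /atom_sum big_cat big_map scaler_sumr; congr (_ + _).
apply: eq_bigr => z _; have := atom_linl z.2 k z.1 0; rewrite !addr0 => ->.
have := atom_linl z.2 1 0 0; rewrite scaler0 addr0 scale1r => /eqP.
by rewrite -subr_eq0 opprD addrA subrr sub0r oppr_eq0 => /eqP ->; rewrite addr0.
Qed.

Lemma r_span a w : atom_span w -> atom_span (r a w).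
Proof.
move=> [u ->]; exists [seq (z.1, bop_scomp z.2 a) | z <- u].
by rewrite /atom_sum bop_sum big_map; apply: eq_bigr => z _; exact: r_atom.
Qed.

Lemma l_span b w : atom_span w -> atom_span (l b w).
Proof.
move=> [u ->]; exists [seq (b z.1, z.2) | z <- u].
by rewrite /atom_sum bop_sum big_map; apply: eq_bigr => z _; exact: l_atom.
Qed.

Local Notation F := (closed_span_of atom_span_subspace).
Implicit Types (t : F) (a b c : A) (f : E) (g : E').

Definition span_ract t a : F :=
  @ClosedSpan _ _ _ atom_span_subspace _ (closure_bop (@r_span a) (span_valP t)).
Definition span_lact b t : F :=
  @ClosedSpan _ _ _ atom_span_subspace _ (closure_bop (@l_span b) (span_valP t)).

Lemma span_lact_linl t : linear (span_lact^~ t).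
Proof. by move=> k a b; apply: val_inj; rewrite /= l_lin. Qed.

Lemma span_lact_linr b : linear (span_lact b).
Proof. by move=> k t t'; apply: val_inj; rewrite /= bopDx bopZx. Qed.

Lemma span_ract_linl a : linear (span_ract^~ a).
Proof. by move=> k t t'; apply: val_inj; rewrite /= bopDx bopZx. Qed.

Lemma span_ract_linr t : linear (span_ract t).
Proof. by move=> k a b; apply: val_inj; rewrite /= r_lin. Qed.

Local Notation B := (operator_algebra E).

Lemma span_lactA (a b : B) t : span_lact a (span_lact b t) = span_lact (ba_mul a b) t.
Proof. by apply: val_inj; rewrite /= lA. Qed.

Lemma span_ractA t (a b : B) : span_ract (span_ract t a) b = span_ract t (ba_mul a b).
Proof. by apply: val_inj; rewrite /= rA. Qed.

Lemma span_lractA (a : B) t (b : B) :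
  span_ract (span_lact a t) b = span_lact a (span_ract t b).
Proof. by apply: val_inj; rewrite /= lrA. Qed.

Lemma span_act_bounded : exists2 M : R, 0 <= M & forall (a : B) t,
  rnorm (span_lact a t) <= M * (rnorm a * rnorm t) /\
  rnorm (span_ract t a) <= M * (rnorm t * rnorm a).
Proof.
exists 1 => // a t; rewrite !mul1r [rnorm t * _]mulrC !rnorm_span; split.
  exact: le_rnorm_bop (l_le a).
exact: le_rnorm_bop (r_le a).
Qed.

Definition operator_module : banachBimodule B :=
  @BanachBimodule R B F span_lact span_ract span_lact_linl span_lact_linr
    span_ract_linl span_ract_linr span_lactA span_ractA span_lractA span_act_bounded.

Lemma atom_spanP f g : atom_span (atom f g).
Proof. by exists [:: (f, g)]; rewrite /atom_sum big_seq1. Qed.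

Definition span_atom f g : F :=
  @ClosedSpan _ _ _ atom_span_subspace _ (closure_sub (atom_spanP f g)).

Lemma span_ract_atom a f g : span_ract (span_atom f g) a = span_atom f (bop_scomp g a).
Proof. by apply: val_inj; rewrite /= r_atom. Qed.

Lemma span_lact_atom b f g : span_lact b (span_atom f g) = span_atom (b f) g.
Proof. by apply: val_inj; rewrite /= l_atom. Qed.

Lemma span_atom_linl g : linear (span_atom^~ g).
Proof. by move=> k f f'; apply: val_inj; rewrite /= atom_linl. Qed.

Lemma span_atom_linr f : linear (span_atom f).
Proof. by move=> k g g'; apply: val_inj; rewrite /= atom_linr. Qed.

Lemma span_sum (u : seq (E * E')) :
  span_val (\sum_(z <- u) span_atom z.1 z.2 : F) = atom_sum u.
Proof. exact: (bop_sum (span_incl atom_span_subspace)). Qed.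

Lemma span_atom_approx t (e : R) : 0 < e -> exists u : seq (E * E'),
  rnorm (t - \sum_(z <- u) span_atom z.1 z.2) <= e.
Proof.
move=> e0; have [v [u ->] tu] := span_approx t e0; exists u.
by rewrite rnorm_span -span_sum in tu *.
Qed.

Lemma span_dense (N : bop F R[i]) :
  (forall f g, N (span_atom f g) = 0) -> forall t, N t = 0.
Proof.
move=> N0 t; apply: rnorm0_eq0; apply/eqP; rewrite eq_le rnorm_ge0 andbT.
apply/ler_addgt0Pl => e e0; rewrite addr0.
have N1 : 0 < rnorm N + 1 by rewrite ltr_wpDl // rnorm_ge0.
have [u tu] := span_atom_approx t (divr_gt0 e0 N1).
have -> : N t = N (t - \sum_(z <- u) span_atom z.1 z.2).
  by rewrite bopBx bop_sum big1 ?subr0 // => z _; exact: N0.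
rewrite (le_trans (le_opnorm _ _)) //.
apply: (le_trans (ler_wpM2l (rnorm_ge0 N) tu)).
by rewrite mulrCA ler_piMr ?(ltW e0) // ler_pdivrMr // mul1r lerDl.
Qed.

Hypotheses (Er : reflexive_space E) (Es : separating_dual E).

(** On atoms the functional is a finite tensor. Approximating [t] by sums of atoms gives finite
    tensors approximating [H b t] uniformly for [b] in the unit ball, and the predual is norm
    closed. *)
Lemma predual_family (H : A -> bop F R[i]) (C : R) : 0 <= C -> linear H ->
  (forall b, rnorm (H b) <= C * rnorm b) ->
  (forall f g, exists u : seq (E * E'), forall b,
    H b (span_atom f g) = \sum_(z <- u) z.2 (b z.1)) ->
  forall t, exists2 h : bop B R[i], operator_predual E h & forall b, H b t = h b.
Proof.
move=> C0 Hl Hb Ha t.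
have hl : linear (fun b : B => H b t) by move=> k b b'; rewrite Hl.
have hb (b : B) : rnorm (H b t) <= C * rnorm t * rnorm b.
  by rewrite (le_trans (le_rnorm_bop _ (Hb b))) // mulrAC.
exists (mkbop hl hb) => //; apply: (operator_predual_closed Er Es) => e e0.
have C1 : 0 < C + 1 by rewrite ltr_wpDl.
have [u tu] := span_atom_approx t (divr_gt0 e0 C1).
have /choice[U HU] : forall z : E * E', exists v : seq (E * E'), forall b,
    H b (span_atom z.1 z.2) = \sum_(y <- v) y.2 (b y.1) by move=> z; exact: Ha.
exists (flatten [seq U z | z <- u]) => b /=.
have -> : \sum_(y <- flatten [seq U z | z <- u]) y.2 (b y.1) =
    H b (\sum_(z <- u) span_atom z.1 z.2).
  by rewrite big_flatten big_map bop_sum; apply: eq_bigr => z _; rewrite HU.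
rewrite -bopBx (le_trans (le_opnorm _ _)) // -rnorm_bop.
apply: (le_trans (ler_pM (rnorm_ge0 _) (rnorm_ge0 _) (Hb b) tu)).
rewrite mulrAC ler_wpM2r ?rnorm_ge0 // mulrCA ler_piMr ?(ltW e0) //.
by rewrite ler_pdivrMr // mul1r lerDl.
Qed.

Lemma atom_slice_linl (phi : bop F R[i]) g : linear (fun f => phi (span_atom f g)).
Proof. by move=> k f f'; rewrite span_atom_linl bopDx bopZx. Qed.

Lemma atom_slice_linr (phi : bop F R[i]) f : linear (fun g => phi (span_atom f g)).
Proof. by move=> k g g'; rewrite span_atom_linr bopDx bopZx. Qed.

Lemma atom_slice_le (phi : bop F R[i]) f g :
  rnorm (phi (span_atom f g)) <= rnorm phi * K * rnorm f * rnorm g.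
Proof.
rewrite (le_trans (le_opnorm _ _)) // -!mulrA ler_wpM2l ?opnorm_ge0 //.
by rewrite !mulrA rnorm_span atom_le.
Qed.

Lemma atom_slice_le' (phi : bop F R[i]) g f :
  rnorm (phi (span_atom f g)) <= rnorm phi * K * rnorm g * rnorm f.
Proof. by rewrite (le_trans (atom_slice_le phi f g)) // mulrAC. Qed.

Lemma operator_module_wstar : wstar_bimodule (operator_predual E) operator_module.
Proof.
move=> phi; have [M M0 HM] := act_bounded (dual_bimodule operator_module).
have Mp : 0 <= M * rnorm phi by rewrite mulr_ge0 // rnorm_ge0.
split; apply: wstar_continuous.
  apply: (@predual_family (fun b => dual_lact (b : B) phi) _ Mp) => [|b|f g].
  - move=> k b b'; exact: (@dual_lact_linl R B operator_module phi k b b').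
  - by have [+ _] := HM b phi; rewrite -mulrA [rnorm phi * _]mulrC.
  (* Here [b] acts on the functional [g], so [phi] is a functional of [bop_scomp g b]; reflexivity
     evaluates it at a point [e] of [E]. For the other action [b] acts on [f], and [phi] gives a
     functional on [E] directly. *)
  have [C C0 HC] := Er.
  have [e eE _] := HC (mkbop (atom_slice_linr phi f) (atom_slice_le phi f)).
  exists [:: (e, g)] => b; rewrite big_seq1 /=.
  by have /= := eE (bop_scomp g b); rewrite -span_ract_atom.
apply: (@predual_family (fun b => dual_ract phi (b : B)) _ Mp) => [|b|f g].
- move=> k b b'; exact: (@dual_ract_linr R B operator_module phi k b b').
- by have [_] := HM b phi; rewrite -mulrA.
exists [:: (f, mkbop (atom_slice_linl phi g) (atom_slice_le' phi g))] => b.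
by rewrite big_seq1 /= -span_lact_atom.
Qed.

Definition unit_derivation (c : B) : dual_bimodule operator_module :=
  bop_scomp (unit c) (span_incl atom_span_subspace).

Lemma unit_derivationE c t : (unit_derivation c : bop F R[i]) t = unit c (span_val t).
Proof. by []. Qed.

Lemma unit_derivation_linear : linear unit_derivation.
Proof. by move=> k c c'; apply: bop_ext => t; rewrite unit_derivationE unit_lin. Qed.

Lemma unit_derivation_le c : rnorm (unit_derivation c) <= Ku * rnorm c.
Proof.
apply: opnorm_le => [|t]; first by rewrite mulr_ge0 ?rnorm_ge0.
rewrite unit_derivationE rnorm_span; exact: le_rnorm_bop (unit_le c).
Qed.

(** The Leibniz rule [[ab, P] = a [b, P] + [a, P] b], checked on atoms and extended by density. *)
Lemma unit_derivationP : derivation unit_derivation.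
Proof.
split; first by split; [exact: unit_derivation_linear|exists Ku; exact: unit_derivation_le].
move=> a b; apply/eqP; rewrite -subr_eq0; apply/eqP/bop_ext; apply: span_dense => f g.
rewrite -[LHS]/(unit (bop_comp a b) (atom f g) -
  (unit b (r a (atom f g)) + unit a (l b (atom f g)))).
rewrite r_atom l_atom !unit_atom !commutatorE /=.
by rewrite (bopBx a) -(bopDx g) addrA subrK subrr.
Qed.

(** On an atom, [g (b (P f)) - g (P (b f))] is the pairing of [b] with a tensor of two terms. *)
Lemma unit_derivation_continuous : continuous
  (unit_derivation : wstar (operator_predual E) -> wstar_dual operator_module).
Proof.
apply: wstar_continuous.
apply: (predual_family Ku0) => [|b|f g]; first exact: unit_derivation_linear.
  exact: unit_derivation_le.
exists [:: (P f, g); (f, - bop_scomp g P)] => b.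
rewrite big_cons big_seq1 unit_derivationE unit_atom commutatorE bopBx.
by rewrite bopN.
Qed.

(* An implementing functional [M] differs from [tr (P .)] by a functional
   commuting with the rank one operators, hence by a multiple of the trace. *)
Lemma Connes_amenable_trace (x0 : E) (g0 : E') : g0 x0 = 1 ->
  Connes_amenable B (operator_predual E) -> exists lam : R[i], exists2 M : R, 0 <= M &
  forall u : seq (E * E'), rnorm (\sum_(z <- u) (z.2 (P z.1) + lam * z.2 z.1)) <=
    M * rnorm (atom_sum u).
Proof.
move=> g0x0 CA; have [M HM] := CA _ operator_module_wstar _ unit_derivationP
  unit_derivation_continuous.
pose L f g := (M : bop F R[i]) (span_atom f g) - g (P f).
(* Subtracting [tr (P .)], which formally implements the same derivation, leaves a functional on
   which the two actions agree. *)
have LE c f g : L f (bop_scomp g c) = L (c f) g.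
  have := congr1 (fun phi : bop F R[i] => phi (span_atom f g)) (HM c).
  rewrite unit_derivationE unit_atom commutatorE bopBx.
  have -> : ((lact (c : B) M - ract M (c : B)) : bop F R[i]) (span_atom f g) =
    (M : bop F R[i]) (span_atom f (bop_scomp g c)) - (M : bop F R[i]) (span_atom (c f) g).
    by rewrite -span_lact_atom -span_ract_atom.
  rewrite /L /= => /eqP; rewrite subr_eq => /eqP H.
  by rewrite H opprD opprB addrA [X in X - _ = _]addrC subrK.
(* For the rank one operator [c = h (.) x0], the normalisation [g0 x0 = 1] gives [g0] composed with
   [c] equal to [h], while [c f = h f *: x0]. So [LE] yields [L f h = h f * L x0 g0], and the
   multiple of the trace is [L x0 g0]. *)
have rank1l (h : E') : linear (fun z : E => h z *: x0).
  by move=> k z z'; rewrite bopDx bopZx scalerDl scalerA.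
have rank1b (h : E') z : rnorm (h z *: x0) <= rnorm h * rnorm x0 * rnorm z.
  by rewrite rnormZ mulrAC ler_wpM2r ?rnorm_ge0 // le_opnorm.
exists (L x0 g0); exists (rnorm M); first exact: rnorm_ge0.
move=> u; have -> : \sum_(z <- u) (z.2 (P z.1) + L x0 g0 * z.2 z.1) =
    (M : bop F R[i]) (\sum_(z <- u) span_atom z.1 z.2).
  rewrite bop_sum; apply: eq_bigr => -[f h] _ /=.
  have := LE (mkbop (rank1l h) (rank1b h)) f g0.
  have -> : bop_scomp g0 (mkbop (rank1l h) (rank1b h)) = h.
    by apply: bop_ext => z /=; rewrite bopZx g0x0 [_ *: _]mulr1.
  have Lz k f' : L (k *: f') g0 = k * L f' g0.
    rewrite /L !bopZx (mulrBr k); congr (_ - _).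
    have := atom_slice_linl M g0 k f' 0; rewrite addr0 => ->.
    have := atom_slice_linl M g0 1 0 0; rewrite scaler0 addr0 scale1r => /eqP.
    by rewrite -subr_eq0 opprD addrA subrr sub0r oppr_eq0 => /eqP ->; rewrite addr0.
  by rewrite /= Lz {1}/L => /eqP; rewrite subr_eq addrC mulrC => /eqP <-.
rewrite (le_trans (le_opnorm _ _)) // ler_wpM2l ?opnorm_ge0 //.
by rewrite rnorm_span span_sum.
Qed.

End operator_module.

Section commutator_trace.
Context {R : realType} (E : completeNormedModType R[i]) (P : bop E E).

Lemma commutator_trace_bound (x0 : E) (g0 : bop E R[i]) :
  reflexive_space E -> separating_dual E -> g0 x0 = 1 ->
  Connes_amenable (operator_algebra E) (operator_predual E) ->
  exists lam : R[i], exists2 M : R, 0 <= M &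
  forall u : seq (E * bop E R[i]), rnorm (\sum_(z <- u) (z.2 (P z.1) + lam * z.2 z.1)) <=
    M * rnorm (\sum_(z <- u) atom P z.1 z.2).
Proof.
move=> Er Es x01 CA.
have K0 : 0 <= rnorm (bop_id E) * rnorm (bop_id E) by rewrite mulr_ge0 ?rnorm_ge0.
exact: (@Connes_amenable_trace R E P _ (atom P) (2 * rnorm P) _ (@tri_ract R E)
  (@tri_lact R E) (@tri_unit R E) K0 (atom_linl P) (atom_linr P) (rnorm_atom P)
  (@tri_ract_linear _ E) (@tri_lact_linear _ E) (@tri_ractA _ E) (@tri_lactA _ E)
  (@tri_lractA _ E) (@rnorm_tri_ract _ E) (@rnorm_tri_lact _ E) (tri_ract_atom P)
  (tri_lact_atom P) (@tri_unit_linear _ E) (@tri_unit_le _ E) (tri_unit_atom P)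
  Er Es x0 g0 x01 CA).
Qed.

End commutator_trace.

(** * The direct sum *)

Section product_space.
Context {R : realType} (X Y : completeNormedModType R[i]).
Local Notation E := ((X * Y)%type : completeNormedModType R[i]).

Lemma prod_fst_linear : linear (fst : E -> X). Proof. by []. Qed.
Lemma prod_snd_linear : linear (snd : E -> Y). Proof. by []. Qed.

Lemma prod_fst_bound (z : E) : rnorm z.1 <= 1 * rnorm z.
Proof. by rewrite mul1r (@rnorm_prod R X Y) le_max lexx. Qed.

Lemma prod_snd_bound (z : E) : rnorm z.2 <= 1 * rnorm z.
Proof. by rewrite mul1r (@rnorm_prod R X Y) le_max lexx orbT. Qed.

Definition pr1 : bop E X := mkbop prod_fst_linear prod_fst_bound.
Definition pr2 : bop E Y := mkbop prod_snd_linear prod_snd_bound.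

Lemma prod_inl_linear : linear (fun x : X => (x, 0) : E).
Proof. by move=> a x x'; congr (_, _); rewrite /= scaler0 addr0. Qed.

Lemma prod_inr_linear : linear (fun y : Y => (0, y) : E).
Proof. by move=> a y y'; congr (_, _); rewrite /= scaler0 addr0. Qed.

Lemma prod_inl_bound (x : X) : rnorm ((x, 0) : E) <= 1 * rnorm x.
Proof. by rewrite mul1r (@rnorm_prod R X Y) /= rnorm0 ge_max lexx rnorm_ge0. Qed.

Lemma prod_inr_bound (y : Y) : rnorm ((0, y) : E) <= 1 * rnorm y.
Proof. by rewrite mul1r (@rnorm_prod R X Y) /= rnorm0 ge_max lexx rnorm_ge0. Qed.

Definition in1 : bop X E := mkbop prod_inl_linear prod_inl_bound.
Definition in2 : bop Y E := mkbop prod_inr_linear prod_inr_bound.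

Lemma rnorm_pr1 : rnorm pr1 <= 1. Proof. by apply: opnorm_le => //; exact: prod_fst_bound. Qed.
Lemma rnorm_pr2 : rnorm pr2 <= 1. Proof. by apply: opnorm_le => //; exact: prod_snd_bound. Qed.
Lemma rnorm_in1 : rnorm in1 <= 1. Proof. by apply: opnorm_le => //; exact: prod_inl_bound. Qed.
Lemma rnorm_in2 : rnorm in2 <= 1. Proof. by apply: opnorm_le => //; exact: prod_inr_bound. Qed.

Lemma prod_decomp (z : E) : z = in1 (pr1 z) + in2 (pr2 z).
Proof. by case: z => x y; congr (_, _); rewrite /= ?addr0 ?add0r. Qed.

Lemma pr1_in2 y : pr1 (in2 y) = 0. Proof. by []. Qed.

Definition proj1 : bop E E := bop_scomp in1 pr1.

(** The diagonal blocks of [c] commute with the projection. Only the two blocks passing between the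
    summands survive, with opposite signs. *)
Lemma commutator_proj1 (c : bop E E) z : commutator proj1 c z =
  in2 (pr2 (c (in1 (pr1 z)))) - in1 (pr1 (c (in2 (pr2 z)))).
Proof.
rewrite commutatorE -![proj1 _]/(in1 (pr1 _)) [X in _ - in1 (pr1 (c X))]prod_decomp.
rewrite [X in X - _]prod_decomp !bopDx opprD addrA; congr (_ - _).
by rewrite addrAC subrr add0r.
Qed.

Lemma prod_reflexive : reflexive_space X -> reflexive_space Y -> reflexive_space E.
Proof.
move=> [K K0 HK] [L L0 HL]; exists (K + L); first exact: addr_ge0.
move=> G; pose G1 := bop_scomp G (prec R[i] pr1); pose G2 := bop_scomp G (prec R[i] pr2).
have [x xE xn] := HK G1; have [y yE yn] := HL G2.
have n1 : rnorm G1 <= rnorm G.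
  rewrite (le_trans (rnorm_scomp _ _)) // ler_piMr ?rnorm_ge0 //.
  exact: le_trans (rnorm_prec _ _) rnorm_pr1.
have n2 : rnorm G2 <= rnorm G.
  rewrite (le_trans (rnorm_scomp _ _)) // ler_piMr ?rnorm_ge0 //.
  exact: le_trans (rnorm_prec _ _) rnorm_pr2.
exists (in1 x + in2 y) => [g|].
  rewrite bopDx; have /= <- := xE (bop_scomp g in1); have /= <- := yE (bop_scomp g in2).
  rewrite -bopDx; congr (G _); apply: bop_ext => z.
  by rewrite bopD {1}(prod_decomp z) bopDx.
rewrite (le_trans (rnormD _ _)) // mulrDl lerD //.
  rewrite (le_trans (le_rnorm_bop _ rnorm_in1)) // mul1r (le_trans xn) //.
  exact: ler_wpM2l.
rewrite (le_trans (le_rnorm_bop _ rnorm_in2)) // mul1r (le_trans yn) //.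
exact: ler_wpM2l.
Qed.

Lemma prod_separating : separating_dual X -> separating_dual Y -> separating_dual E.
Proof.
move=> sX sY z Hz; rewrite [z]prod_decomp.
have -> : pr1 z = 0 by apply: sX => g; exact: (Hz (bop_scomp g pr1)).
have -> : pr2 z = 0 by apply: sY => g; exact: (Hz (bop_scomp g pr2)).
by rewrite !bop0 addr0.
Qed.

End product_space.

Section lp_coordinates.
Context {R : realType} (p : R) (p1 : 1 <= p).

Lemma lp_coord_linear k : linear (fun x : lp p1 => x k). Proof. by []. Qed.

Lemma lp_coord_bound k (x : lp p1) : rnorm (x k) <= 1 * rnorm x.
Proof. by rewrite mul1r lp_coord_le. Qed.

Definition lp_coordinate k : bop (lp p1) R[i] :=
  mkbop (lp_coord_linear k) (lp_coord_bound k).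

Lemma lp_separating : separating_dual (lp p1).
Proof. by move=> x Hx; apply: lp_ext => k; exact: (Hx (lp_coordinate k)). Qed.

End lp_coordinates.

(** * Seminorms of the coordinate projections *)

Section small_atoms.
Context {R : realType} (s r : R) (hs : 1 < s) (hr : 1 < r).
Hypotheses (sr : s != r) (s2 : s != 2).
Local Notation X := (lp (ltW hs)).
Local Notation Y := (lp (ltW hr)).
Context (E : completeNormedModType R[i]) (P : bop E E).
Context (i1 : bop X E) (i2 : bop Y E) (q1 : bop E X) (q2 : bop E Y) (sgn : R[i]).
Hypotheses (ni1 : rnorm i1 <= 1) (ni2 : rnorm i2 <= 1).
Hypotheses (nq1 : rnorm q1 <= 1) (nq2 : rnorm q2 <= 1) (nsgn : rnorm sgn <= 1).
Hypothesis commE : forall (c : bop E E) z, commutator P c z =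
  sgn *: (i2 (q2 (c (i1 (q1 z)))) - i1 (q1 (c (i2 (q2 z))))).

Let le1M (x y : R) : 0 <= x -> 0 <= y -> x <= 1 -> y <= 1 -> x * y <= 1.
Proof. by move=> x0 y0 x1 y1; rewrite -[1]mulr1 ler_pM. Qed.

Let scomp1 (F G H : normedModType R[i]) (S : bop G H) (T : bop F G) :
  rnorm S <= 1 -> rnorm T <= 1 -> rnorm (bop_scomp S T) <= 1.
Proof. by move=> S1 T1; rewrite (le_trans (rnorm_scomp _ _)) // le1M ?rnorm_ge0. Qed.

(** The sum of atoms represents the projection onto the first [m] basis vectors of one summand.
    Embeddings, projections and the sign [sgn] are kept abstract so that either summand can play the
    role of [X]. *)
Lemma small_atoms (e : R) : 0 < e -> exists2 m : nat, (0 < m)%N &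
  rnorm (\sum_(i < m) atom P (i1 (lp_unit _ i)) (bop_scomp (lp_coordinate _ i) q1))
    <= e * m%:R.
Proof.
move=> e0; have e2 : 0 < e / 2 by rewrite divr_gt0.
have [m m0 H] := lp_trace hs hr sr s2 e2; exists m => //.
apply: rnorm_tri_ball => a b c a1 b1 c1; rewrite bop_sum.
(* Each off-diagonal block of [c] gives one trace. In the first, [c] leads from [X] to [Y] and
   belongs to the contraction [S1]; in the second it leads back and belongs to [T2]. *)
pose S1 := bop_scomp q2 (bop_scomp c (bop_scomp i1 (bop_scomp q1 (bop_scomp b i1)))).
pose T1 := bop_scomp q1 (bop_scomp a i2).
pose S2 := bop_scomp q2 (bop_scomp b i1).
pose T2 := bop_scomp q1 (bop_scomp a (bop_scomp i1 (bop_scomp q1 (bop_scomp c i2)))).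
have H1 : rnorm (\sum_(i < m) T1 (S1 (lp_unit _ i)) i) <= e / 2 * m%:R.
  apply: H; last exact: (scomp1 nq1 (scomp1 a1 ni2)).
  exact: (scomp1 nq2 (scomp1 c1 (scomp1 ni1 (scomp1 nq1 (scomp1 b1 ni1))))).
have H2 : rnorm (\sum_(i < m) T2 (S2 (lp_unit _ i)) i) <= e / 2 * m%:R.
  apply: H; first exact: (scomp1 nq2 (scomp1 b1 ni1)).
  exact: (scomp1 nq1 (scomp1 a1 (scomp1 ni1 (scomp1 nq1 (scomp1 c1 ni2))))).
have -> : \sum_(i < m) tri_ev R[i] a b c
    (atom P (i1 (lp_unit _ i)) (bop_scomp (lp_coordinate _ i) q1)) =
    sgn * (\sum_(i < m) T1 (S1 (lp_unit _ i)) i - \sum_(i < m) T2 (S2 (lp_unit _ i)) i).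
  rewrite -sumrB mulr_sumr; apply: eq_bigr => i _; rewrite atomE /tri commE.
  rewrite !bopZx; congr (_ * _).
  by rewrite (bopBx a) bopBx.
rewrite rnormM (le_trans (ler_wpM2r (rnorm_ge0 _) nsgn)) // mul1r.
rewrite (le_trans (rnormD _ _)) // rnormN.
have -> : e * m%:R = e / 2 * m%:R + e / 2 * m%:R by field.
exact: lerD.
Qed.

End small_atoms.

(** * The contradiction *)

Section conclusion.
Context {R : realType}.

Lemma scalar_eq0 (mu : R[i]) (M : R) : 0 <= M ->
  (forall e : R, 0 < e -> exists2 m : nat, (0 < m)%N &
    rnorm (mu * m%:R) <= M * (e * m%:R)) -> mu = 0.
Proof.
move=> M0 H; apply: rnorm0_eq0; apply/eqP; rewrite eq_le rnorm_ge0 andbT.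
apply/ler_addgt0Pl => e e0; rewrite addr0.
have M1 : 0 < M + 1 by rewrite ltr_wpDl.
have [m m0 Hm] := H _ (divr_gt0 e0 M1).
have mR : 0 < m%:R :> R by rewrite ltr0n.
have mC : rnorm (m%:R : R[i]) = m%:R.
  by rewrite -(rmorph_nat (@complex.real_complex R)) rnorm_real normr_nat.
move: Hm; rewrite rnormM mC mulrA ler_pM2r // => /le_trans; apply.
by rewrite mulrCA ler_piMr ?(ltW e0) // ler_pdivrMr // mul1r lerDl.
Qed.

(** On a block where [P] acts as the scalar [mu], the projection onto [m] vectors of a biorthogonal
    system has trace [m], and its product with [P] has trace [mu * m]. *)
Lemma block_trace_bound (E Z : completeNormedModType R[i]) (P : bop E E) (lam mu : R[i])
    (M : R) (i1 : bop Z E) (q1 : bop E Z) (e : nat -> Z) (g : nat -> bop Z R[i]) m :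
  (forall u : seq (E * bop E R[i]), rnorm (\sum_(z <- u) (z.2 (P z.1) + lam * z.2 z.1)) <=
    M * rnorm (\sum_(z <- u) atom P z.1 z.2)) ->
  (forall z, q1 (i1 z) = z) -> (forall k, g k (e k) = 1) ->
  (forall z, P (i1 z) = mu *: i1 z) ->
  rnorm ((mu + lam) * m%:R) <=
  M * rnorm (\sum_(i < m) atom P (i1 (e i)) (bop_scomp (g i) q1)).
Proof.
move=> HM qi ge PE.
have := HM [seq (i1 (e k), bop_scomp (g k) q1) | k <- iota 0 m].
rewrite !big_map -[m in iota 0 m]subn0 -/(index_iota 0 m) !big_mkord.
rewrite (eq_bigr (fun=> mu + lam)) => [|i _]; first by rewrite sumr_const card_ord mulr_natr.
by rewrite PE /= !bopZx qi ge [mu *: _]mulr1 mulr1.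
Qed.

Lemma lp_sum_not_Connes_amenable (p q : R) (hp : 1 < p) (hq : 1 < q) :
  p != 2 -> q != 2 -> p != q ->
  let E : completeNormedModType R[i] := (lp (ltW hp) * lp (ltW hq))%type in
  ~ Connes_amenable (operator_algebra E) (operator_predual E).
Proof.
move=> p2 q2 pq E CA; have qp : q != p by rewrite eq_sym.
pose X : completeNormedModType R[i] := lp (ltW hp).
pose Y : completeNormedModType R[i] := lp (ltW hq).
have conj (t : R) : 1 < t -> exists2 u : R, 1 <= u & t^-1 + u^-1 = 1.
  move=> t1; have t0 := lt_trans ltr01 t1.
  exists (1 - t^-1)^-1; last by rewrite invrK addrC subrK.
  rewrite invf_ge1 ?subr_gt0 ?invf_lt1 // gerDl oppr_le0 invr_ge0 ltW //.
have [p' p'1 pp'] := conj p hp; have [q' q'1 qq'] := conj q hq.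
have Er : reflexive_space E.
  exact: (prod_reflexive (lp_reflexive (ltW hp) p'1 pp') (lp_reflexive (ltW hq) q'1 qq')).
have Es : separating_dual E.
  exact: (prod_separating (@lp_separating _ _ (ltW hp)) (@lp_separating _ _ (ltW hq))).
pose P := proj1 X Y.
have x01 : (bop_scomp (lp_coordinate (ltW hp) 0) (pr1 X Y)) (in1 X Y (lp_unit (ltW hp) 0)) = 1.
  exact: lp_unitE.
have [lam [M M0 HM]] := commutator_trace_bound P Er Es x01 CA.
have sumE Z mu i1 q1 e g m := @block_trace_bound E Z P lam mu M i1 q1 e g m HM.
have n1 : rnorm (1 : R[i]) <= 1 by rewrite rnorm1.
have n1' : rnorm (- 1 : R[i]) <= 1 by rewrite rnormN rnorm1.
(* The block l^p, where [P] acts as 1; this uses that [p] differs from 2. *)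
have L1 : 1 + lam = 0.
  apply: (scalar_eq0 M0) => e e0.
  have comm (c : bop E E) z : commutator P c z =
      1 *: (in2 X Y (pr2 X Y (c (in1 X Y (pr1 X Y z)))) -
            in1 X Y (pr1 X Y (c (in2 X Y (pr2 X Y z))))).
    by rewrite scale1r; exact: commutator_proj1.
  have [m m0 Hm] := @small_atoms R p q hp hq pq p2 E P _ _ _ _ _ (rnorm_in1 X Y)
    (rnorm_in2 X Y) (rnorm_pr1 X Y) (rnorm_pr2 X Y) n1 comm e e0.
  exists m => //; apply: le_trans (ler_wpM2l M0 Hm).
  apply: (@sumE X 1 (in1 X Y) (pr1 X Y) (lp_unit (ltW hp)) (lp_coordinate (ltW hp))) => //.
    by move=> k; rewrite -[LHS]/(lp_unit (ltW hp) k k) lp_unitE eqxx.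
  by move=> z; rewrite scale1r.
(* The block l^q, where [P] acts as 0. The summands exchange roles, which reverses the sign of the
   commutator formula and uses that [q] differs from 2. *)
have L2 : 0 + lam = 0.
  apply: (scalar_eq0 M0) => e e0.
  have comm (c : bop E E) z : commutator P c z =
      - 1 *: (in1 X Y (pr1 X Y (c (in2 X Y (pr2 X Y z)))) -
              in2 X Y (pr2 X Y (c (in1 X Y (pr1 X Y z))))).
    by rewrite scaleN1r opprB; exact: commutator_proj1.
  have [m m0 Hm] := @small_atoms R q p hq hp qp q2 E P _ _ _ _ _ (rnorm_in2 X Y)
    (rnorm_in1 X Y) (rnorm_pr2 X Y) (rnorm_pr1 X Y) n1' comm e e0.
  exists m => //; apply: le_trans (ler_wpM2l M0 Hm).
  apply: (@sumE Y 0 (in2 X Y) (pr2 X Y) (lp_unit (ltW hq)) (lp_coordinate (ltW hq))) => //.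
    by move=> k; rewrite -[LHS]/(lp_unit (ltW hq) k k) lp_unitE eqxx.
  by move=> z; rewrite scale0r -[LHS]/(in1 X Y (pr1 X Y (in2 X Y z))) pr1_in2 bop0.
by move/eqP: L1; rewrite -[lam]add0r L2 addr0 oner_eq0.
Qed.

End conclusion.

Theorem corollary4p5 (R : realType) (p q : R) (hp : 1 < p) (hq : 1 < q)
    (hp2 : p <> 2) (hq2 : q <> 2) (hpq : p <> q) :
  let E : completeNormedModType R[i] := (lp (ltW hp) * lp (ltW hq))%type in
  ~ Connes_amenable (operator_algebra E) (operator_predual E).
Proof. by apply: lp_sum_not_Connes_amenable; apply/eqP. Qed.
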